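(* For every integer $n\ge 5$ there exists a maximal planar graph $G$ with $n$ vertices such that $lpsr(G)\ge \frac{n+2}{3n-6}$, where $lpsr(G)$ is the labeled plane-saturation ratio of $G$.
   Context: All graphs are finite and simple. A plane graph is a planar graph together with a specific plane embedding: vertices are mapped to distinct points of $\mathbb{R}^2$ and edges to simple topological curves joining their endpoints, where no two curves intersect, overlap or touch except possibly at common endpoints. A maximal planar graph on $n\ge 3$ vertices is a planar graph to which no edge can be added while keeping it simple and planar; it has $3n-6$ edges. Let $e(\cdot)$ denote the number of edges. Labeled plane-saturated subgraph: a plane graph $H=(V',E')$ with labeled vertices is a labeled plane-saturated subgraph of $G=(V,E)$ if $V'=V$, $E'\subseteq E$, and no edge of $E\setminus E'$ can be added to the drawing of $H$ (as a curve joining the two correspondingly labeled vertices) without introducing a crossing. The embedding of $H$ is arbitrary and need not extend to an embedding of $G$. The labeled plane-saturation ratio is $lpsr(G)=\min\{\frac{e(H)}{e(G)} : H \text{ is a labeled plane-saturated subgraph of } G\}$. *)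

(* Defs.v *)
From HB Require Import structures.
From mathcomp Require Import all_boot all_order all_algebra.
From mathcomp Require Import all_classical all_reals all_analysis.
Import Order.TTheory GRing.Theory Num.Theory.
Import numFieldNormedType.Exports.

Set Implicit Arguments.
Unset Strict Implicit.
Unset Printing Implicit Defensive.

Local Open Scope classical_set_scope.
Local Open Scope ring_scope.

(* A graph on a finite vertex type V is given by its set of edges, each edge
   being the set of its endpoints; e(E) is #|E|. *)
Definition simple_graph (V : finType) (E : {set {set V}}) : Prop :=
  forall e : {set V}, e \in E -> #|e| = 2%N.

Definition simple_curve (R : realType) (p q : R * R) (A : set (R * R)) : Prop :=
  exists gamma : R -> R * R,
    [/\ {within `[0, 1], continuous gamma},
        {in `[0, 1] &, injective gamma},
        gamma 0 = p, gamma 1 = q & A = gamma @` `[0, 1]].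

(* The values of [curve] outside the edge set at hand are irrelevant. *)
Record drawing (R : realType) (V : finType) := Drawing {
  pos : V -> R * R;
  curve : {set V} -> set (R * R) }.

(* The third clause forbids an edge from passing through a vertex that is not
   one of its endpoints; the fourth clause alone would not exclude this when
   that vertex is isolated. *)
Definition plane_drawing (R : realType) (V : finType) (E : {set {set V}})
    (d : drawing R V) : Prop :=
  [/\ injective (pos d),
      forall u v : V, [set u; v]%SET \in E ->
        simple_curve (pos d u) (pos d v) (curve d [set u; v]%SET),
      forall (e : {set V}) (w : V), e \in E -> curve d e (pos d w) -> w \in e
    & forall e f : {set V}, e \in E -> f \in E -> e != f ->
        curve d e `&` curve d f `<=` [set pos d w | w in [set` e :&: f]]].

Definition planar (R : realType) (V : finType) (E : {set {set V}}) : Prop :=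
  simple_graph E /\ exists d : drawing R V, plane_drawing E d.

Definition maximal_planar (R : realType) (V : finType) (E : {set {set V}}) :
    Prop :=
  planar R E /\ forall e : {set V}, e \notin E -> ~ planar R (e |: E)%SET.

Definition edge_addable (R : realType) (V : finType) (H : {set {set V}})
    (d : drawing R V) (e : {set V}) : Prop :=
  exists d' : drawing R V,
    [/\ plane_drawing (e |: H)%SET d', pos d' =1 pos d
      & {in H, curve d' =1 curve d}].

Definition labeled_plane_saturated (R : realType) (V : finType)
    (G H : {set {set V}}) (d : drawing R V) : Prop :=
  [/\ H \subset G, plane_drawing H d
    & forall e : {set V}, e \in G :\: H -> ~ edge_addable H d e].

Definition saturation_ratios (R : realType) (V : finType)
    (G : {set {set V}}) : set R :=
  [set r | exists (H : {set {set V}}) (d : drawing R V),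
    labeled_plane_saturated G H d /\ r = #|H|%:R / #|G|%:R].
Arguments saturation_ratios R {V} G.

(* This infimum is a minimum: see [lpsr_attained] and [lpsr_le]. *)
Definition lpsr (R : realType) (V : finType) (G : {set {set V}}) : R :=
  inf (saturation_ratios R G).
Arguments lpsr R {V} G.

Lemma labeled_plane_saturated_ex (R : realType) (V : finType)
    (G : {set {set V}}) :
  exists (H : {set {set V}}) (d : drawing R V), labeled_plane_saturated G H d.
Proof.
pose P (k : nat) := `[< exists (H : {set {set V}}) (d : drawing R V),
  [/\ H \subset G, plane_drawing H d & #|H| = k] >].
have exP : exists k, P k.
  exists 0%N; apply/asboolP; exists finset.set0.
  exists (Drawing (fun v : V => ((enum_rank v)%:R, 0 : R)) (fun=> set0)).
  split; rewrite ?finset.sub0set ?cards0 //; split => /=; last 3 first.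
  - by move=> u v; rewrite inE.
  - by move=> e w; rewrite inE.
  - by move=> e f; rewrite inE.
  by move=> u v [] /eqP; rewrite eqr_nat => /eqP/val_inj/enum_rank_inj.
have ubP k : P k -> (k <= #|G|)%N.
  by move=> /asboolP[H [d [HG _ <-]]]; exact: subset_leq_card.
case: (ex_maxnP exP ubP) => k /asboolP[H [d [HG Hd Hk]]] kmax.
exists H, d; split=> // e; rewrite inE => /andP[eH eG] [d' [Hd' _ _]].
suff /kmax : P k.+1 by rewrite ltnn.
apply/asboolP; exists (e |: H)%SET, d'; split=> //.
  by rewrite finset.subUset finset.sub1set eG.
by rewrite cardsU1 eH Hk.
Qed.

Lemma lpsr_le (R : realType) (V : finType) (G H : {set {set V}})
    (d : drawing R V) :
  labeled_plane_saturated G H d -> lpsr R G <= #|H|%:R / #|G|%:R.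
Proof.
move=> GHd; apply: ge_inf; last by exists H, d.
by exists 0 => _ [H' [d' [_ ->]]]; rewrite divr_ge0.
Qed.

Lemma lpsr_attained (R : realType) (V : finType) (G : {set {set V}}) :
  exists (H : {set {set V}}) (d : drawing R V),
    labeled_plane_saturated G H d /\ lpsr R G = #|H|%:R / #|G|%:R.
Proof.
pose P (k : nat) := `[< exists (H : {set {set V}}) (d : drawing R V),
  labeled_plane_saturated G H d /\ #|H| = k >].
have exP : exists k, P k.
  have [H [d GHd]] := labeled_plane_saturated_ex R G.
  by exists #|H|; apply/asboolP; exists H, d.
case: (ex_minnP exP) => k /asboolP[H [d [GHd Hk]]] kmin.
exists H, d; split=> //; apply/eqP; rewrite eq_le (lpsr_le GHd)/=.
apply: lb_le_inf; first by exists (#|H|%:R / #|G|%:R), H, d.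
move=> _ [H' [d' [GHd' ->]]]; rewrite ler_wpM2r ?invr_ge0// ler_nat Hk.
by apply: kmin; apply/asboolP; exists H', d'.
Qed.

(* Main.v *)
Require Import Defs.
From HB Require Import structures.
From mathcomp Require Import all_boot all_order all_algebra.
From mathcomp Require Import all_classical all_reals all_analysis.
From mathcomp Require Import ring lra zify.
Import Order.TTheory GRing.Theory Num.Theory.
Import numFieldNormedType.Exports.

Set Implicit Arguments.
Unset Strict Implicit.
Unset Printing Implicit Defensive.
Local Open Scope classical_set_scope.
Local Open Scope ring_scope.

(* G is the join of a path on m = n - 2 vertices with an edge uv. It has
   3n - 6 edges, a straight-line plane drawing, and any further edge would
   complete a subdivision of K5, so G is maximal planar.

   Let H be plane-saturated in G. A point off the drawing sees a vertex if an arc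
   joins them that meets the drawing only at that vertex; two vertices seen from
   a common point and adjacent in G are adjacent in H. If a set of points and
   edges does not separate the plane, any point off the drawing sees something
   outside that set. Hence uv is in H, each component of the path part of H has an
   edge to u or v, and some path vertex w is adjacent to both. If H had at most
   n + 1 edges, at most one further edge to u or v would exist, and then either
   removing uv together with one path edge, or removing all edges at u, and all
   edges at v, leaves a nonseparating set. Then every path vertex is adjacent to
   both u and v, or both ends of that path edge are, which requires more edges.

   These sets are forests, and a drawn forest does not separate the plane by
   Eilenberg's criterion: p and q are not separated by a compact X if the angle
   from z - p to z - q has a continuous choice on X. *)

(** * Angle lifts *)

(** Edges are arbitrary topological arcs, so a point seeing the interior of an edge need not reach
    its ends along any tame curve. Visibility is carried along the edge by pushing a point towards
    the end through shrinking balls and joining the infinitely many pushes into one arc. All such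
    arcs are kept injective, since they become edges of drawings. The constant comes from a count:
    if H has r path edges, the path splits into m - r components; one edge from each to a hub, a
    second one at w, and uv make r + (m - r) + 1 + 1 = n edges. So n + 1 edges leave room for a
    single further one, and the cycle it closes is broken either at a hub or by cutting one path
    edge. The first case yields all 2m edges to the hubs, too many as soon as m >= 3, whence n >= 5;
    in the second case four edges would end in a component that has at most three. Separation and
    nonplanarity of K5 are both reduced to integers counting full turns: on a forest they can be
    made consistent, on K5 parity forbids it. *)

Lemma clopen_segment (R : realType) (P : set R) :
  (forall s : R, 0 <= s <= 1 -> \forall t \near s, 0 <= t <= 1 -> (P t <-> P s)) ->
  P 0 -> P 1.
Proof.
move=> HP P0.
pose A : set R := [set` `[0, 1]]; have AE s : A s = (0 <= s <= 1) :> Prop.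
  by rewrite /A /= in_itv.
suff E : A `&` P = A.
  have A1 : A 1 by rewrite AE lexx ler01.
  by have [] : (A `&` P) 1 by rewrite E.
apply: (@segment_connected R 0 1).
- by exists 0; split => //; rewrite AE lexx ler01.
- exists [set s : R | \forall t \near s, 0 <= t <= 1 -> P t].
    by rewrite openE => s /= Hs; apply: (near_join Hs).
  apply/seteqP; split=> s /= [].
    move=> As Ps; split=> //; have Is : 0 <= s <= 1 by rewrite -AE.
    near=> t => It; suff [_ h] : P t <-> P s by exact: h.
    by move: It; near: t; exact: HP.
  move=> As Ps; split=> //; apply: (nbhs_singleton Ps); by rewrite -AE.
- exists (~` [set s : R | \forall t \near s, 0 <= t <= 1 -> ~ P t]).
    apply: open_closedC.
    by rewrite openE => s /= Hs; apply: (near_join Hs).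
  apply/seteqP; split=> s /= [].
    move=> As Ps; split=> //.
    by move=> /nbhs_singleton N; apply: N => //; rewrite -AE.
  move=> As nP; split=> //; have Is : 0 <= s <= 1 by rewrite -AE.
  apply: contrapT => nPs; apply: nP.
  near=> t => It Pt; apply: nPs; suff [h _] : P t <-> P s by exact: h.
  by move: It {Pt}; near: t; exact: HP.
Unshelve. all: by end_near. Qed.

Section turn.
Variable R : realType.
Implicit Types (u v w : R * R) (s t : R).

Definition dot u v := u.1 * v.1 + u.2 * v.2.

(** With the plane read as the complex numbers, [t] is an argument of [u / v]. A positive factor and
    a rotation express this without choosing a branch. *)
Definition turn t u v := exists2 r : R, 0 < r &
  u = (r * (cos t * v.1 - sin t * v.2), r * (sin t * v.1 + cos t * v.2)).

Lemma turn0 u : turn 0 u u.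
Proof. by exists 1 => //; rewrite cos0 sin0; case: u => a b /=; congr pair; ring. Qed.

Lemma turnD s t u v w : turn s u v -> turn t v w -> turn (s + t) u w.
Proof.
move=> [r r0 ->] [q q0 ->]; exists (r * q); first exact: mulr_gt0.
by rewrite cosD sinD /=; congr pair; ring.
Qed.

Lemma turnN t u v : turn t u v -> turn (- t) v u.
Proof.
move=> [r r0 ->]; exists r^-1; first by rewrite invr_gt0.
have r1 : r != 0 by rewrite gt_eqF.
rewrite cosN sinN /=; have := cos2Dsin2 t; case: v => a b /= cs.
by congr pair; rewrite -{1}[LHS]mul1r -cs; field.
Qed.

(** A positive scalar product confines the angle to the open interval from -pi/2 to pi/2, where it
    is the arctangent of the cross product over the scalar product. This branch depends continuously
    on [u] and [v]. *)
Lemma turn_atan u v : 0 < dot u v ->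
  turn (atan ((u.2 * v.1 - u.1 * v.2) / dot u v)) u v.
Proof.
move=> d0; set x := _ / _; set d := dot u v in d0 *.
have s0 : 0 < Num.sqrt (1 + x ^+ 2) by rewrite sqrtr_gt0 ltr_wpDr ?sqr_ge0.
have n0 : 0 < v.1 ^+ 2 + v.2 ^+ 2.
  rewrite lt_neqAle addr_ge0 ?sqr_ge0// andbT eq_sym paddr_eq0 ?sqr_ge0//.
  rewrite !sqrf_eq0; apply/negP => /andP[/eqP v1 /eqP v2].
  by move: d0; rewrite /d /dot v1 v2 !mulr0 addr0 ltxx.
have sE : sin (atan x) = x / Num.sqrt (1 + x ^+ 2).
  have := atanK x; rewrite /tan => {2}<-; rewrite cos_atan; field.
  by rewrite gt_eqF.
exists (d * Num.sqrt (1 + x ^+ 2) / (v.1 ^+ 2 + v.2 ^+ 2)).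
  by rewrite divr_gt0// mulr_gt0.
rewrite cos_atan sE.
have [d1 s1 n1] : [/\ d != 0, Num.sqrt (1 + x ^+ 2) != 0
   & v.1 ^+ 2 + v.2 ^+ 2 != 0] by rewrite !gt_eqF.
move: (Num.sqrt _) s1 s0 => q q1 q0; rewrite /x /d /dot.
rewrite -/d; move: d1; rewrite /d /dot; clear -q1 n1; case: u v n1 => [a b] [a' b'] /= n1 d1.
by congr pair; field; rewrite q1 n1 d1.
Qed.

Lemma cosDint (k : int) t : cos (t + k%:~R * (2 * pi)) = cos t.
Proof.
have E n a : cos (a + n%:R * (2 * pi)) = cos a :> R.
  by rewrite -(periodicn (@cosD2pi R) n a); congr cos; ring.
case: k => n; first exact: E.
rewrite -(E n.+1 (t + _)); congr cos; rewrite NegzE mulrNz; ring.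
Qed.

Lemma sinDint (k : int) t : sin (t + k%:~R * (2 * pi)) = sin t.
Proof.
rewrite -!cosBpihalf -[RHS](cosDint k); congr cos; ring.
Qed.

Lemma cos_eq1 t : cos t = 1 -> exists k : int, t = k%:~R * (2 * pi).
Proof.
move=> t1; have p0 : 0 < 2 * pi :> R by rewrite mulr_gt0// pi_gt0.
pose k := Num.floor (t / (2 * pi)); exists k; pose x := t - k%:~R * (2 * pi).
have : k%:~R <= t / (2 * pi) < (k + 1)%:~R.
  by rewrite ge_floor/= floorD1_gt.
rewrite ler_pdivlMr// ltr_pdivrMr// intrD mulrDl mul1r => /andP[kt tk].
have cx : cos x = 1.
  by rewrite -t1 -[RHS](cosDint (- k)) /x mulrNz; congr cos; ring.
have pi0 := @pi_gt0 R.
have x0 : 0 <= x by rewrite /x; lra.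
have x2 : x < 2 * pi by rewrite /x; lra.
have cI (y : R) : 0 <= y -> y <= pi -> cos y = 1 -> y = 0.
  by move=> y0 y1; rewrite -cos0 => /cos_inj; apply; rewrite in_itv /= ?lexx ?y0 ?y1 ?ltW.
have [xp|px] := leP x pi.
  by have := cI x x0 xp cx; rewrite /x; lra.
have h0 : 0 <= 2 * pi - x by lra.
have h1 : 2 * pi - x <= pi by lra.
have := cI _ h0 h1; rewrite -[2 * pi - x]opprB cosN.
have -> : x - 2 * pi = x + (-1)%:~R * (2 * pi) by rewrite mulrNz; ring.
by rewrite cosDint cx mulrNz => /(_ erefl); lra.
Qed.

Lemma turn_uniq s t u v : u != 0 -> turn s u v -> turn t u v ->
  exists k : int, s = t + k%:~R * (2 * pi).
Proof.
move=> u0 su tu; have [r r0 E0] := turnD su (turnN tu).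
suff /cos_eq1[k E] : cos (s - t) = 1 by exists k; rewrite -E; ring.
move: u u0 E0 {su tu} => [a b] u0 /=; set c := cos (s - t); set d := sin (s - t).
move=> [Ea Eb]; have cd : c ^+ 2 + d ^+ 2 = 1 by exact: cos2Dsin2.
have ab : 0 < a ^+ 2 + b ^+ 2.
  rewrite lt_neqAle addr_ge0 ?sqr_ge0// andbT eq_sym paddr_eq0 ?sqr_ge0//.
  by rewrite !sqrf_eq0; apply: contra u0.
have E1 : (r * c - 1) * (a ^+ 2 + b ^+ 2) = 0.
  transitivity ((r * (c * a - d * b) - a) * a + (r * (d * a + c * b) - b) * b).
    by ring.
  by rewrite -Ea -Eb !subrr !mul0r addr0.
have E2 : (r * d) * (a ^+ 2 + b ^+ 2) = 0.
  transitivity ((r * (d * a + c * b)) * a - (r * (c * a - d * b)) * b).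
    by ring.
  by rewrite -Ea -Eb mulrC subrr.
move/eqP: E1; rewrite mulf_eq0 (gt_eqF ab) orbF subr_eq0 => /eqP rc.
move/eqP: E2; rewrite mulf_eq0 (gt_eqF ab) orbF mulf_eq0 (gt_eqF r0)/= => /eqP d0.
move: cd; rewrite d0 expr0n /= addr0 => /eqP; rewrite sqrf_eq1 => /orP[/eqP//|/eqP c1].
by exfalso; move: rc r0; rewrite c1; lra.
Qed.

Lemma turn_shift (k : int) t u v : turn t u v -> turn (t + k%:~R * (2 * pi)) u v.
Proof. by move=> [r r0 ->]; exists r => //; rewrite cosDint sinDint. Qed.

Lemma turn_neq0 t u v : turn t u v -> v != 0 -> u != 0.
Proof.
move=> tu; apply: contraNneq => u0; move: tu; rewrite u0 => /turnN[r r0 ->].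
by apply/eqP; congr pair; rewrite /=; ring.
Qed.

Lemma turn_e1 u : u != 0 -> exists t, turn t u (1, 0).
Proof.
case: u => [a b] u0.
have [a0|a0|a0] := ltgtP a 0.
- have d : 0 < dot (a, b) (-1, 0) by rewrite /dot /=; lra.
  have e : turn pi (-1, 0) ((1, 0) : R * R).
    by exists 1 => //; rewrite cospi sinpi /=; congr pair; ring.
  by eexists; apply: turnD e; exact: turn_atan d.
- have d : 0 < dot (a, b) (1, 0) by rewrite /dot /=; lra.
  by eexists; exact: turn_atan d.
have [b0|b0|b0] := ltgtP b 0.
- have d : 0 < dot (a, b) (0, -1) by rewrite /dot /=; lra.
  have e : turn (- (pi / 2)) (0, -1) ((1, 0) : R * R).
    by exists 1 => //; rewrite cosN sinN cos_pihalf sin_pihalf /=; congr pair; ring.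
  by eexists; apply: turnD e; exact: turn_atan d.
- have d : 0 < dot (a, b) (0, 1) by rewrite /dot /=; lra.
  have e : turn (pi / 2) (0, 1) ((1, 0) : R * R).
    by exists 1 => //; rewrite cos_pihalf sin_pihalf /=; congr pair; ring.
  by eexists; apply: turnD e; exact: turn_atan d.
by rewrite a0 b0 eqxx in u0.
Qed.

End turn.

(** * Continuity of maps into the plane *)

Section contpair.
Variables (R : realType) (T : topologicalType).
Local Notation P := (R * R)%type.

Lemma fst_cont : continuous (fst : P -> R).
Proof.
move=> [a b] A /= Aa; exists (A, setT) => /=; first by split => //; exact: filterT.
by move=> [c d] [].
Qed.

Lemma snd_cont : continuous (snd : P -> R).
Proof.
move=> [a b] A /= Aa; exists (setT, A) => /=; first by split => //; exact: filterT.
by move=> [c d] [].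
Qed.

Lemma cont_pairP (f : T -> P) x : {for x, continuous f} ->
  {for x, continuous (fun z => (f z).1)} /\ {for x, continuous (fun z => (f z).2)}.
Proof.
move=> fx; split.
  by apply: (cvg_comp _ _ fx); exact: fst_cont.
by apply: (cvg_comp _ _ fx); exact: snd_cont.
Qed.

Lemma cont_dot (f g : T -> P) x : {for x, continuous f} -> {for x, continuous g} ->
  {for x, continuous (fun z => dot (f z) (g z))}.
Proof.
move=> /cont_pairP[f1 f2] /cont_pairP[g1 g2].
by apply: (@continuousD _ R T); apply: continuousM.
Qed.

Lemma cont_pair (U V : topologicalType) (f : T -> U) (g : T -> V) x :
  {for x, continuous f} -> {for x, continuous g} ->
  {for x, continuous (fun z => (f z, g z))}.
Proof. by move=> fx gx; exact: cvg_pair. Qed.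

Lemma cont_addP (f g : T -> P) x : {for x, continuous f} -> {for x, continuous g} ->
  {for x, continuous (fun z => f z + g z)}.
Proof. by move=> fx gx; exact: cvgD. Qed.

Lemma cont_subP (f g : T -> P) x : {for x, continuous f} -> {for x, continuous g} ->
  {for x, continuous (fun z => f z - g z)}.
Proof. by move=> fx gx; exact: cvgB. Qed.

Lemma cont_scaleP (f : T -> R) (g : T -> P) x :
  {for x, continuous f} -> {for x, continuous g} ->
  {for x, continuous (fun z => f z *: g z)}.
Proof.
move=> fx /cont_pairP[g1 g2].
by apply: (@cont_pair _ _ (fun z => f z * (g z).1) (fun z => f z * (g z).2));
   apply: continuousM.
Qed.

End contpair.

(** * Continuous angles between two maps *)

Section rlift.
Variable R : realType.
Local Notation P := (R * R)%type.

Lemma within_comp (S T U : topologicalType) (A : set S) (B : set T)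
    (g : S -> T) (f : T -> U) :
  {within B, continuous f} -> continuous g -> (forall x, A x -> B (g x)) ->
  {within A, continuous (f \o g)}.
Proof.
move=> /subspace_continuousP fB gc gA; apply/subspace_continuousP => x Ax.
have fx := fB _ (gA _ Ax); apply: cvg_trans fx => W /=.
rewrite /nbhs /= /within /= => BW; rewrite /within/=.
have := gc x _ BW; rewrite /nbhs /=; apply: filterS => y /= h Ay; apply: h.
exact: gA.
Qed.

(** The quotient [u / v] has a continuous argument on [D]. As a relation between [u] and [v] this is
    an equivalence, so lifts can be composed through intermediate maps. *)
Definition rlift (T : topologicalType) (D : set T) (u v : T -> P) :=
  exists2 th : T -> R, {within D, continuous th} &
    forall z, D z -> turn (th z) (u z) (v z).

Variable T : topologicalType.
Implicit Types (D : set T) (u v w : T -> P).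

Lemma lift_refl D u : rlift D u u.
Proof.
exists (fun=> 0); last by move=> z _; exact: turn0.
by apply: continuous_subspaceT => x; exact: cvg_cst.
Qed.

Lemma lift_sym D u v : rlift D u v -> rlift D v u.
Proof.
move=> [th ct tu]; exists (fun z => - th z); last by move=> z /tu/turnN.
by move=> x; apply: continuousN; exact: ct.
Qed.

Lemma lift_trans D v u w : rlift D u v -> rlift D v w -> rlift D u w.
Proof.
move=> [th ct tu] [th' ct' tv]; exists (fun z => th z + th' z).
  by move=> x; apply: continuousD; [exact: ct|exact: ct'].
by move=> z Dz; apply: turnD (tu z Dz) (tv z Dz).
Qed.

Lemma within_addc D (f : T -> R) a :
  {within D, continuous f} -> {within D, continuous (fun z => f z + a)}.
Proof.
move=> /subspace_continuousP cf; apply/subspace_continuousP => x Dx.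
by apply: cvgD; [exact: cf|exact: cvg_cst].
Qed.

Lemma lift_dot D u v : continuous u -> continuous v ->
  (forall z, D z -> 0 < dot (u z) (v z)) -> rlift D u v.
Proof.
move=> cu cv d0.
pose q z := ((u z).2 * (v z).1 - (u z).1 * (v z).2) / dot (u z) (v z).
exists (fun z => atan (q z)).
  apply: continuous_in_subspaceT => z /set_mem Dz.
  have [u1 u2] := cont_pairP (cu z); have [v1 v2] := cont_pairP (cv z).
  apply: (@continuous_comp _ _ _ q (@atan R)); last exact: continuous_atan.
  apply: continuousM.
    by apply: (@continuousB _ R T); apply: continuousM.
  apply: continuousV; first by rewrite gt_eqF// d0.
  by apply: cont_dot; [exact: cu|exact: cv].
by move=> z /d0; exact: turn_atan.
Qed.

Lemma dotuu_gt0 (u : P) : u != 0 -> 0 < dot u u.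
Proof.
case: u => a b u0; rewrite /dot /= lt_neqAle -!expr2 addr_ge0 ?sqr_ge0// andbT.
by rewrite eq_sym paddr_eq0 ?sqr_ge0// !sqrf_eq0; apply: contra u0.
Qed.

(** By compactness, for [t] close to [s] the vectors [h (z, t)] and [h (z, s)] have positive scalar
    product for all [z] in [D] at once, so [lift_dot] relates the two stages. The set of times
    related to time 0 is then open and closed in [0, 1]. *)
Lemma lift_homotopy D (h : T * R -> P) : compact D -> continuous h ->
  (forall z s, D z -> 0 <= s <= 1 -> h (z, s) != 0) ->
  rlift D (fun z => h (z, 1)) (fun z => h (z, 0)).
Proof.
move=> cD ch h0.
have chs s : continuous (fun z => h (z, s)).
  move=> z; apply: (@continuous_comp _ _ _ (fun z => (z, s)) h); last exact: ch.
  by apply: cont_pair; [exact: cvg_id|exact: cvg_cst].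
apply: (@clopen_segment R (fun s => rlift D (fun z => h (z, s)) (fun z => h (z, 0))));
  last exact: lift_refl.
move=> s Is.
have N : \forall t \near s, D `<=` [set z | 0 < dot (h (z, t)) (h (z, s))].
  move: cD; rewrite compact_near_coveringP => nc.
  apply: (nc R (nbhs s) (fun t z => 0 < dot (h (z, t)) (h (z, s)))) => z Dz.
  have c1 : {for (z, s), continuous (fun x : T * R => dot (h x) (h (x.1, s)))}.
    apply: cont_dot; first exact: ch.
    by apply: (cvg_comp fst (fun z => h (z, s))); [exact: cvg_fst|exact: chs].
  have : \forall x \near (z, s), 0 < dot (h x) (h (x.1, s)).
    apply: (c1 [set y | 0 < y]); apply: (@open_nbhs_nbhs R); split; first exact: open_gt.
    by rewrite /=; apply: dotuu_gt0; exact: h0.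
  by case=> [[A B] [/= zA sB] AB]; exists (A, B) => // -[x y] /= xy; exact: (AB (x, y)).
near=> t => It.
have L : rlift D (fun z => h (z, t)) (fun z => h (z, s)).
  apply: lift_dot; [exact: chs|exact: chs|near: t; exact: N].
split=> H; last exact: lift_trans L H.
exact: lift_trans (lift_sym L) H.
Unshelve. all: by end_near. Qed.

Lemma lift_const D (a b : P) : a != 0 -> b != 0 -> rlift D (fun=> a) (fun=> b).
Proof.
move=> /turn_e1[s sa] /turn_e1[t tb]; exists (fun=> s - t).
  by apply: continuous_subspaceT => x; exact: cvg_cst.
by move=> z _; apply: turnD sa _; exact: turnN.
Qed.

Lemma within_glue A B (f g : T -> R) : closed A -> closed B ->
  {within A, continuous f} -> {within B, continuous g} ->
  (forall z, A z -> B z -> f z = g z) ->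
  exists h : T -> R, [/\ {within A `|` B, continuous h}, {in A, h =1 f} & {in B, h =1 g}].
Proof.
move=> cA cB fA gB fg; pose h z := if z \in A then f z else g z.
have hf : {in A, h =1 f} by move=> z zA; rewrite /h zA.
have hg : {in B, h =1 g}.
  by move=> z /set_mem zB; rewrite /h; case: ifPn => // /set_mem zA; exact: fg.
exists h; split=> //; apply: withinU_continuous => //.
  by apply: subspace_eq_continuous fA => z /hf.
by apply: subspace_eq_continuous gB => z /hg.
Qed.

(** Where the two choices meet they differ by a multiple of 2 pi; since the sets share at most the
    point [c], one constant shift of the second choice makes them agree. *)
Lemma lift_glue A B c u v : closed A -> closed B -> A `&` B `<=` [set c] ->
  u c != 0 -> rlift A u v -> rlift B u v -> rlift (A `|` B) u v.
Proof.
move=> cA cB AB uc [f cf tf] [g cg tg].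
have [k Hk] : exists k : int, A c -> B c -> f c = g c + k%:~R * (2 * pi).
  have [[Ac Bc]|N] := pselect (A c /\ B c); last by exists 0 => Ac Bc; case: N.
  by have [k kE] := turn_uniq uc (tf _ Ac) (tg _ Bc); exists k.
have [] := @within_glue A B f (fun z => g z + k%:~R * (2 * pi)) cA cB cf.
- exact: within_addc.
- move=> z Az Bz; have zc : z = c by exact: AB.
  by rewrite zc in Az Bz *; exact: Hk.
move=> h [ch hA hB]; exists h => // z [Az|Bz].
  by rewrite hA ?inE//; exact: tf.
by rewrite hB ?inE//; apply: turn_shift; exact: tg.
Qed.

End rlift.

(** * Angles along circles and arcs *)

Section plane.
Variable R : realType.
Local Notation P := (R * R)%type.
Implicit Types (p q : P) (g : R -> P).

Definition circle p (r t : R) : P := (p.1 + r * cos t, p.2 + r * sin t).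

(** Along one revolution the angle minus [t] would remain in 2 pi Z and yet end 2 pi lower than it
    began, since both ends of the revolution are the same point. *)
Lemma circle_no_lift (D : set P) p (r : R) : 0 < r -> (forall t, 0 <= t <= 2 * pi -> D (circle p r t)) ->
  ~ rlift D (fun z => z - p) (fun=> (1, 0)).
Proof.
move=> r0 Dc [th cth tth].
have cc : continuous (circle p r).
  move=> t; apply: (@cont_pair _ _ _ (fun t => p.1 + r * cos t) (fun t => p.2 + r * sin t)).
    apply: continuousD; first exact: cvg_cst.
    by apply: continuousM; [exact: cvg_cst|exact: continuous_cos].
  apply: continuousD; first exact: cvg_cst.
  by apply: continuousM; [exact: cvg_cst|exact: continuous_sin].
have cphi : {within `[0, 2 * pi], continuous (th \o circle p r)}.
  by apply: (within_comp cth cc) => t /=; rewrite in_itv /=; exact: Dc.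
pose psi t := th (circle p r t) - t.
have psiE t : 0 <= t <= 2 * pi -> exists k : int, psi t = k%:~R * (2 * pi).
  move=> t02; have u0 : (r * cos t, r * sin t) != 0 :> P.
    apply/negP => /eqP[/eqP]; rewrite mulf_eq0 (gt_eqF r0)/= => /eqP c0 /eqP.
    rewrite mulf_eq0 (gt_eqF r0)/= => /eqP s0; have := cos2Dsin2 t.
    by rewrite c0 s0; move/eqP; rewrite expr0n addr0 eq_sym oner_eq0.
  have := tth _ (Dc t t02); have -> : circle p r t - p = (r * cos t, r * sin t).
    by case: (p) => a b; rewrite /circle /=; congr pair; rewrite /=; ring.
  move=> h1; have h2 : turn t (r * cos t, r * sin t) ((1, 0) : P).
    by exists r => //=; congr pair; ring.
  by have [k E] := turn_uniq u0 h1 h2; exists k; rewrite /psi E; ring.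
have pi0 := @pi_gt0 R.
have psi2 : psi (2 * pi) = psi 0 - 2 * pi.
  rewrite /psi; have -> : circle p r (2 * pi) = circle p r 0.
    by have := cosDint 1 (0 : R); have := sinDint 1 (0 : R); rewrite mulr1z mul1r add0r /circle => -> ->.
  by rewrite subr0.
(* The intermediate value [psi 0 - pi] is attained although it is no multiple of 2 pi. *)
have [] := @IVT R psi 0 (2 * pi) (psi 0 - pi).
- by lra.
- move=> x; apply: continuousB; first exact: cphi.
  by move: x; apply: continuous_subspaceT => x; exact: cvg_id.
- rewrite psi2; have -> : Num.min (psi 0) (psi 0 - 2 * pi) = psi 0 - 2 * pi by apply/min_idPr; lra.
  have -> : Num.max (psi 0) (psi 0 - 2 * pi) = psi 0 by apply/max_idPl; lra.
  by apply/andP; split; lra.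
move=> t t02; have [k ->] := psiE t t02.
have [|l ->] := psiE 0; first by rewrite lexx /=; lra.
move=> E.
have : (2 * (l - k))%:~R = (1 : int)%:~R :> R.
  rewrite intrM intrB mulr1z; apply: (mulIf (lt0r_neq0 pi0)); move: E; lra.
by move/intr_inj; lia.
Qed.

(** A continuous injection of a compact set is a homeomorphism onto its image: closed subsets of [K]
    go to compact, hence closed, sets. *)
Lemma transport_within (K : set R) g (f : R -> R) :
  compact K -> continuous g -> {in K &, injective g} -> {within K, continuous f} ->
  exists2 h : P -> R, {within g @` K, continuous h} & forall t, K t -> h (g t) = f t.
Proof.
move=> cK cg ig cf.
have /choice[i iP] : forall z, exists t, (g @` K) z -> K t /\ g t = z.
  move=> z; have [[t Kt <-]|N] := pselect ((g @` K) z); first by exists t.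
  by exists 0 => /N.
have iK t : K t -> i (g t) = t.
  move=> Kt; have [|Ki gi] := iP (g t); first by exists t.
  by apply: ig => //; rewrite inE.
exists (f \o i); last by move=> t Kt /=; rewrite iK.
apply/continuous_closedP => C cC; apply/closed_subspaceP.
have [V cV VE] : exists2 V, closed (V : set R) & V `&` K = f @^-1` C `&` K.
  by apply/closed_subspaceP; move/continuous_closedP : cf; exact.
exists (g @` (V `&` K)).
  apply: compact_closed; first exact: (@norm_hausdorff R).
  apply: continuous_compact; first exact: continuous_subspaceT.
  by apply: (subclosed_compact _ cK) => //; apply: closedI => //; exact: compact_closed.
apply/seteqP; split=> [z [[t [Vt Kt] <-] _]|z [fz [t Kt tz]]].
  have : (f @^-1` C `&` K) t by rewrite -VE.
  by move=> [/= Ct _]; split; [change (C (f (i (g t)))); rewrite iK|exists t].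
split; exists t => //; have : (V `&` K) t; last by [].
rewrite VE; split=> //; move: fz; rewrite -tz => fz.
by move: (fz : C (f (i (g t)))); rewrite iK.
Qed.

Lemma lift_image (K : set R) g (u v : P -> P) :
  compact K -> continuous g -> {in K &, injective g} ->
  rlift K (u \o g) (v \o g) -> rlift (g @` K) u v.
Proof.
move=> cK cg ig [f cf tf]; have [h ch hg] := transport_within cK cg ig cf.
by exists h => // _ [t Kt <-]; rewrite hg//; exact: tf.
Qed.

Definition seg01 : set R := [set` `[0, 1]%R].

Lemma seg01E t : seg01 t = (0 <= t <= 1) :> Prop.
Proof. by rewrite /seg01 /= in_itv. Qed.

(* Only the values on [0, 1] matter; continuity on all of R makes arcs easy to
   reparametrize. *)
Definition jarc g := continuous g /\ {in seg01 &, injective g}.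

(** Shrinking the path to its starting point by [g (t * s)] is a homotopy that avoids [p], and two
    nonzero constants always lift against each other. *)
Lemma lift_arc1 g p : continuous g -> (forall t, 0 <= t <= 1 -> g t != p) ->
  rlift seg01 (fun t => g t - p) (fun=> (1, 0)).
Proof.
move=> cg gp.
have N t : 0 <= t <= 1 -> g t - p != 0.
  by move=> t01; rewrite subr_eq0; exact: gp.
have := @lift_homotopy R R seg01 (fun x => g (x.1 * x.2) - p) (@segment_compact R 0 1).
case=> [x|t s|f cf tf].
- apply: continuousB; last exact: cvg_cst.
  apply: (@continuous_comp _ _ _ (fun x : R * R => x.1 * x.2) g); last exact: cg.
  by apply: continuousM; [exact: fst_cont|exact: snd_cont].
- rewrite seg01E => /andP[t0 t1] /andP[s0 s1]; apply: N.
  by rewrite mulr_ge0//= mulr_ile1.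
apply: (@lift_trans R _ _ (fun=> g 0 - p)).
  by exists f => // t /tf /=; rewrite mulr1 mulr0.
apply: lift_const; first by apply: N; rewrite lexx ler01.
by apply/negP => /eqP[/eqP]; rewrite oner_eq0.
Qed.

Lemma lift_arc g p q : jarc g -> ~ (g @` seg01) p -> ~ (g @` seg01) q ->
  rlift (g @` seg01) (fun z => z - p) (fun z => z - q).
Proof.
move=> [cg ig] gp gq; apply: lift_image => //; first exact: segment_compact.
apply: (@lift_trans R _ _ (fun=> (1, 0))); last apply: lift_sym.
  by apply: lift_arc1 => // t t01; apply/eqP => E; apply: gp; exists t; rewrite ?seg01E.
by apply: lift_arc1 => // t t01; apply/eqP => E; apply: gq; exists t; rewrite ?seg01E.
Qed.

End plane.

(** * Arcs *)

Section arcs.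
Variable R : realType.
Local Notation P := (R * R)%type.
Implicit Types (p q z : P) (g h k : R -> P) (O X : set P).

Lemma openP O p : open O -> O p ->
  exists2 e : R, 0 < e & forall q, `|q - p| < e -> O q.
Proof.
move=> oO Op; have : nbhs p O by exact: open_nbhs_nbhs.
move=> /nbhs_normP[e /= e0 H]; exists e => // q qp; apply: H.
by rewrite /= distrC.
Qed.

Lemma open_ballP O :
  (forall p, O p -> exists2 e : R, 0 < e & forall q, `|q - p| < e -> O q) -> open O.
Proof.
move=> H; rewrite openE => p /H[e e0 Hq]; rewrite /interior /=.
  apply/nbhs_ballP; exists e => // q; rewrite ball_prod_normE /= distrC; exact: Hq.
Qed.

Lemma compact_closedP X : compact X -> closed X.
Proof. by apply: compact_closed; exact: norm_hausdorff. Qed.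

(** Retraction of the line onto [0, 1]; it turns maps continuous on [0, 1] into maps continuous
    everywhere. *)
Definition clamp (t : R) : R := Num.max 0 (Num.min 1 t).

Lemma clamp_cont : continuous clamp.
Proof.
move=> t; apply: (@continuous_max R R (fun=> 0) (fun t => Num.min 1 t)).
  exact: cvg_cst.
by apply: (@continuous_min R R (fun=> 1) id); [exact: cvg_cst|exact: cvg_id].
Qed.

Lemma clamp01 t : 0 <= clamp t <= 1.
Proof. by rewrite /clamp le_max lexx /= ge_max ler01 ge_min lexx. Qed.

Lemma clamp_id t : 0 <= t <= 1 -> clamp t = t.
Proof. by move=> /andP[t0 t1]; rewrite /clamp (min_idPr t1) (max_idPr t0). Qed.

Lemma clamp0 t : t <= 0 -> clamp t = 0.
Proof. by move=> t0; rewrite /clamp max_l// ge_min t0 orbT. Qed.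

Lemma clamp1 t : 1 <= t -> clamp t = 1.
Proof. by move=> t1; rewrite /clamp min_l// max_r. Qed.

Lemma simple_curveP p q (A : set P) : simple_curve p q A ->
  exists g, [/\ jarc g, g 0 = p, g 1 = q & A = g @` (@seg01 R)].
Proof.
move=> [g [cg ig g0 g1 ->]]; exists (g \o clamp).
have e t : 0 <= t <= 1 -> (g \o clamp) t = g t by move=> h /=; rewrite clamp_id.
split; rewrite ?e ?lexx ?ler01//; last first.
  by apply/seteqP; split=> _ [t t01 <-]; exists t => //; rewrite e// -seg01E.
split.
  apply/continuous_subspace_setT; apply: (within_comp cg clamp_cont) => t _ /=.
  by rewrite in_itv /=; exact: clamp01.
move=> s t; rewrite !inE !seg01E => hs ht; rewrite !e//.
by apply: ig; rewrite !in_itv.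
Qed.

Lemma arc_simple_curve g : jarc g -> simple_curve (g 0) (g 1) (g @` (@seg01 R)).
Proof.
move=> [cg ig]; exists g; split=> //; first exact: continuous_subspaceT.
by move=> s t hs ht; apply: ig; rewrite inE /seg01 /=.
Qed.

Lemma arc_inj g s t : jarc g -> 0 <= s <= 1 -> 0 <= t <= 1 -> g s = g t -> s = t.
Proof. by move=> [_ ig] s1 t1; apply: ig; rewrite inE seg01E. Qed.

Lemma aff_cont (s t : R) : continuous (fun x : R => s + (t - s) * x).
Proof.
move=> x; apply: continuousD; first exact: cvg_cst.
by apply: continuousM; [exact: cvg_cst|exact: cvg_id].
Qed.

Lemma arc_sub g (s t : R) : jarc g -> 0 <= s <= 1 -> 0 <= t <= 1 -> s != t ->
  jarc (fun x => g (s + (t - s) * x)).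
Proof.
move=> ag s01 t01 st; split.
  by move=> x; apply: (@continuous_comp _ _ _ (fun x => s + (t - s) * x) g);
    [exact: aff_cont|exact: ag.1].
move=> x y; rewrite !inE !seg01E => x01 y01 /(arc_inj ag) e.
have {e} : s + (t - s) * x = s + (t - s) * y by apply: e; nra.
by move/addrI/mulfI; apply; rewrite subr_eq0 eq_sym.
Qed.

Lemma arc_rev g : jarc g -> jarc (fun x => g (1 - x)).
Proof.
move=> ag; have := @arc_sub g 1 0 ag.
rewrite !lexx !ler01 oner_neq0 => /(_ isT isT isT).
by congr jarc; apply: funext => x; congr g; ring.
Qed.

Lemma arc_img_rev g : (fun x => g (1 - x)) @` (@seg01 R) = g @` (@seg01 R).
Proof.
apply/seteqP; split=> _ [t + <-]; rewrite seg01E => t01.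
  by exists (1 - t) => //; rewrite seg01E; lra.
by exists (1 - t); [rewrite seg01E; lra|congr g; ring].
Qed.

Lemma simple_curve_rev p q (A : set P) : simple_curve p q A -> simple_curve q p A.
Proof.
move=> /simple_curveP[g [ag <- <- ->]].
by have := arc_simple_curve (arc_rev ag); rewrite subr0 subrr arc_img_rev.
Qed.

Lemma arc_img g : jarc g -> compact (g @` (@seg01 R)).
Proof.
move=> [cg _]; apply: continuous_compact; last exact: segment_compact.
exact: continuous_subspaceT.
Qed.

Lemma path_cat g h : continuous g -> continuous h -> g 1 = h 0 ->
  exists k, [/\ continuous k, forall x, x <= 2^-1 -> k x = g (clamp (2 * x)) &
    forall x, 2^-1 <= x -> k x = h (clamp (2 * x - 1))].
Proof.
(* On each half one of the first two summands is constantly the joint value [g 1], which the last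
   term removes; continuity then needs no pasting. *)
move=> cg ch gh; exists (fun x => g (clamp (2 * x)) + h (clamp (2 * x - 1)) - g 1); split.
- move=> x; apply: (@cont_subP R R (fun x => g (clamp (2 * x)) + h (clamp (2 * x - 1))) (fun=> g 1)); last exact: cvg_cst.
  have c2 : continuous (fun x : R => clamp (2 * x)).
    move=> y; apply: (@continuous_comp _ _ _ (fun x : R => 2 * x) clamp); last exact: clamp_cont.
    by apply: continuousM; [exact: cvg_cst|exact: cvg_id].
  have c3 : continuous (fun x : R => clamp (2 * x - 1)).
    move=> y; apply: (@continuous_comp _ _ _ (fun x : R => 2 * x - 1) clamp); last exact: clamp_cont.
    apply: continuousB; last exact: cvg_cst.
    by apply: continuousM; [exact: cvg_cst|exact: cvg_id].
  apply: (@cont_addP R R (fun x => g (clamp (2 * x))) (fun x => h (clamp (2 * x - 1)))).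
    by apply: (continuous_comp (c2 x)); exact: cg.
  by apply: (continuous_comp (c3 x)); exact: ch.
- by move=> x x2; rewrite (@clamp0 (2 * x - 1)) -?gh ?addrK//; lra.
- by move=> x x2; rewrite (@clamp1 (2 * x)) 1?addrC ?addKr//; lra.
Qed.

Lemma arc_cat g h : jarc g -> jarc h -> g 1 = h 0 ->
  (forall s t, 0 <= s <= 1 -> 0 <= t <= 1 -> g s = h t -> s = 1 /\ t = 0) ->
  exists k, [/\ jarc k, k 0 = g 0, k 1 = h 1 &
    k @` (@seg01 R) `<=` g @` (@seg01 R) `|` h @` (@seg01 R)].
Proof.
move=> ag ah gh disj; have [k [ck k1 k2]] := path_cat ag.1 ah.1 gh.
exists k; split.
- split; first exact: ck.
  have main x y : 0 <= x <= 1 -> 0 <= y <= 1 -> x <= y -> k x = k y -> x = y.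
    move=> x01 y01 xy.
    have [y2|y2] := leP y 2^-1.
      rewrite !k1//; last by lra.
      by rewrite !clamp_id; [move/(arc_inj ag); lra|lra|lra].
    have [x2|x2] := leP 2^-1 x.
      rewrite !k2//; last by lra.
      by rewrite !clamp_id; [move/(arc_inj ah); lra|lra|lra].
    rewrite k1 ?k2 ?ltW// !clamp_id; [|lra|lra].
    by case/disj; lra.
  move=> x y; rewrite !inE !seg01E => x01 y01 kxy.
  have [xy|yx] := leP x y; first exact: main.
  by apply/esym/main => //; exact: ltW.
- by rewrite k1 ?mulr0 ?clamp0.
- by rewrite k2 ?mulr1; [congr h; rewrite clamp1; lra|lra].
- move=> _ [x _ <-]; have [x2|x2] := leP x 2^-1.
    by left; rewrite k1//; exists (clamp (2 * x)) => //; rewrite seg01E clamp01.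
  by right; rewrite k2 ?ltW//; exists (clamp (2 * x - 1)) => //; rewrite seg01E clamp01.
Qed.

Lemma first_hit (T : topologicalType) (g : R -> T) (C : set T) : continuous g -> closed C ->
  (exists2 t, 0 <= t <= 1 & C (g t)) ->
  exists t, [/\ 0 <= t <= 1, C (g t) & forall s, 0 <= s < t -> ~ C (g s)].
Proof.
move=> cg cC [t0 t01 Ct0].
pose A := @seg01 R `&` g @^-1` C.
have cA : compact A.
  apply: (subclosed_compact _ (@segment_compact R 0 1)); last by move=> ? [].
  apply: closedI; first exact: compact_closed (@Rhausdorff R) (@segment_compact R 0 1).
  by move/continuous_closedP : cg; apply.
have [|//||t] := @compact_EVT_min _ R id A; first by exists t0; rewrite /A /= seg01E.
  by apply: continuous_subspaceT => x; exact: cvg_id.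
rewrite inE => -[]; rewrite seg01E => t1 Ct tmin; exists t; split=> // s /andP[s0 st] Cs.
have : t <= s; last by rewrite leNgt st.
apply: tmin; rewrite inE; split=> //; rewrite seg01E s0 /=.
by rewrite (le_trans (ltW st))//; case/andP: t1.
Qed.

(** Leaving [g] at its first point on [h] and following [h] from there gives an injective arc. The
    point may be the start of [g] or the end of [h]; one piece is then degenerate, which makes these
    cases separate. *)
Lemma arc_in_cat g h : jarc g -> jarc h -> g 1 = h 0 -> g 0 != h 1 ->
  exists k, [/\ jarc k, k 0 = g 0, k 1 = h 1 &
    k @` (@seg01 R) `<=` g @` (@seg01 R) `|` h @` (@seg01 R)].
Proof.
move=> ag ah gh gh01.
have [|t [t01 [s +] st tmin]] := first_hit ag.1 (compact_closedP (arc_img ah)).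
  exists 1; rewrite ?lexx ?ler01//; exists 0; rewrite ?gh// seg01E; lra.
rewrite seg01E => s01.
have subh : s != 1 -> exists k, [/\ jarc k, k 0 = h s, k 1 = h 1 &
    (forall x, 0 <= x <= 1 -> exists2 y, s <= y <= 1 & k x = h y)].
  move=> s1; exists (fun x => h (s + (1 - s) * x)); split.
  - by apply: arc_sub => //; rewrite lexx ler01.
  - by rewrite mulr0 addr0.
  - by congr h; ring.
  - by move=> x x01; exists (s + (1 - s) * x) => //; nra.
have subg : t != 0 -> exists k, [/\ jarc k, k 0 = g 0, k 1 = g t &
    (forall x, 0 <= x <= 1 -> exists2 y, k x = g y & 0 <= y <= t /\ (y = t -> x = 1))].
  move=> t0; exists (fun x => g (0 + (t - 0) * x)); split.
  - by apply: arc_sub => //; rewrite ?lexx ?ler01// eq_sym.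
  - by rewrite mulr0 addr0.
  - by congr g; ring.
  - move=> x x01; exists (0 + (t - 0) * x) => //; split; first by nra.
    by rewrite subr0 add0r => /(canRL (mulKf t0)); rewrite mulVf.
have imgh k : (forall x, 0 <= x <= 1 -> exists2 y, s <= y <= 1 & k x = h y) ->
    k @` (@seg01 R) `<=` h @` (@seg01 R).
  move=> H _ [x + <-]; rewrite seg01E => /H[y ys ->]; exists y => //; rewrite seg01E; lra.
have imgg k : (forall x, 0 <= x <= 1 -> exists2 y, k x = g y & 0 <= y <= t /\ (y = t -> x = 1)) ->
    k @` (@seg01 R) `<=` g @` (@seg01 R).
  move=> H _ [x + <-]; rewrite seg01E => /H[y -> [yt _]]; exists y => //; rewrite seg01E; lra.
have [t0|t0] := eqVneq t 0.
  have [|k [ak k0 k1 kh]] := subh.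
    by apply: contraNneq gh01 => s1; rewrite -t0 -s1 st.
  exists k; split=> //; first by rewrite k0 st t0.
  by move=> z /(imgh _ kh); right.
have [s1|s1] := eqVneq s 1.
  have [k [ak k0 k1 kg]] := subg t0.
  exists k; split=> //; first by rewrite k1 -st s1.
  by move=> z /(imgg _ kg); left.
have [kg [akg kg0 kg1 kgP]] := subg t0; have [kh [akh kh0 kh1 khP]] := subh s1.
have [||k [ak k0 k1 kk]] := arc_cat akg akh.
- by rewrite kg1 kh0 st.
- move=> x y x01 y01; have [x' -> [x't x1]] := kgP x x01; have [y' y's kE] := khP y y01.
  move=> E; have x'tE : x' = t.
    apply/eqP/negPn/negP => x'n; apply: (tmin x').
      by rewrite lt_neqAle x'n; case/andP: x't => -> ->.
    by exists y'; rewrite ?seg01E -?kE ?E//; lra.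
  split; first exact: x1.
  apply: (arc_inj akh); rewrite ?lexx ?ler01//.
  by rewrite -E x'tE -st kh0.
exists k; split=> //; rewrite ?k0 ?k1//.
move=> z /kk[]; [by move/(imgg _ kgP); left|by move/(imgh _ khP); right].
Qed.

(** Path connectedness in [O] by injective arcs, since added edges have to be simple curves; the
    case [p = q] is separate because an injective arc is not constant. *)
Definition linked O p q := O p /\ (p = q \/
  exists g, [/\ jarc g, g 0 = p, g 1 = q & g @` (@seg01 R) `<=` O]).

Lemma linked_refl O p : O p -> linked O p p.
Proof. by move=> Op; split=> //; left. Qed.

Lemma arc_mem0 g : (g @` (@seg01 R)) (g 0).
Proof. by exists 0; rewrite // seg01E lexx ler01. Qed.

Lemma arc_mem1 g : (g @` (@seg01 R)) (g 1).
Proof. by exists 1; rewrite // seg01E lexx ler01. Qed.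

Lemma linked_sym O p q : linked O p q -> linked O q p.
Proof.
move=> [Op [<-|[g [ag g0 g1 gO]]]]; first by split=> //; left.
split; first by apply: gO; rewrite -g1; exact: arc_mem1.
right; exists (fun x => g (1 - x)); split; rewrite ?subr0 ?subrr ?arc_img_rev//.
exact: arc_rev.
Qed.

Lemma linked_trans O q p r : linked O p q -> linked O q r -> linked O p r.
Proof.
move=> [Op [<-//|[g [ag g0 g1 gO]]]] [Oq [<-|[h [ah h0 h1 hO]]]].
  by split=> //; right; exists g.
split=> //; have [->|pr] := eqVneq p r; first by left.
have [||k [ak k0 k1 kk]] := arc_in_cat ag ah; rewrite ?g0 ?g1 ?h0 ?h1//.
right; exists k; split; rewrite ?k0 ?k1//.
by move=> z /kk[/gO|/hO].
Qed.

Lemma linked_sub O O' p q : O `<=` O' -> linked O p q -> linked O' p q.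
Proof.
move=> OO' [Op h]; split; first exact: OO'.
case: h => [->|[g [ag g0 g1 gO]]]; [by left|right; exists g; split=> //].
by move=> z /gO/OO'.
Qed.

Lemma arc_segment p q : p != q -> jarc (fun t : R => p + t *: (q - p)).
Proof.
move=> pq; split.
  move=> t; apply: (@cont_addP R R (fun=> p) (fun t => t *: (q - p))); first exact: cvg_cst.
  by apply: (@cont_scaleP R R id (fun=> q - p)); [exact: cvg_id|exact: cvg_cst].
move=> s t _ _ /addrI/eqP; rewrite -subr_eq0 -scalerBl scaler_eq0.
by rewrite !subr_eq0 eq_sym [q == p]eq_sym (negbTE pq) orbF => /eqP.
Qed.

Lemma linked_segment O p q :
  (forall t, 0 <= t <= 1 -> O (p + t *: (q - p))) -> linked O p q.
Proof.
move=> H; split; first by have := H 0; rewrite scale0r addr0 lexx ler01; apply.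
have [->|pq] := eqVneq p q; [by left|right].
exists (fun t => p + t *: (q - p)); split.
- exact: arc_segment.
- by rewrite scale0r addr0.
- by rewrite scale1r addrC subrK.
- by move=> _ [t + <-]; rewrite seg01E; exact: H.
Qed.

Lemma linked_ball O p (e : R) q : (forall z, `|z - p| < e -> O z) -> `|q - p| < e ->
  linked O p q.
Proof.
move=> H qp; apply: linked_segment => t /andP[t0 t1]; apply: H.
by rewrite addrC addKr normrZ ger0_norm// (le_lt_trans _ qp)// ler_piMl.
Qed.

Lemma linked_open O p : open O -> open [set q | linked O p q].
Proof.
move=> oO; apply: open_ballP => q /= pq.
have Oq : O q by case: (linked_sym pq).
have [e e0 He] := openP oO Oq; exists e => // r rq.
by apply: linked_trans pq _; apply: linked_ball He rq.
Qed.

Lemma linked_outside (M : R) p q : M < `|p| -> M < `|q| ->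
  linked [set z | M < `|z|] p q.
Proof.
(* The norm of a pair is the larger absolute value of its entries. Keeping one entry large while the
   other moves to [N] stays outside, and two such moves reach the corner [c]. *)
move=> Mp Mq; pose N := Num.max (M + 1) 0; pose c : P := (N, N).
have MN : M < N by rewrite /N lt_max; apply/orP; left; lra.
have N0 : `|N| = N by rewrite ger0_norm// /N le_max lexx orbT.
suff H p' : M < `|p'| -> linked [set z | M < `|z|] p' c.
  by apply: linked_trans (H _ Mp) _; apply: linked_sym; exact: H.
case: p' => a b; rewrite prod_normE /= lt_max => /orP[Ma|Mb].
  apply: (@linked_trans _ (a, N)); apply: linked_segment => t _ /=;
    rewrite prod_normE lt_max /=; apply/orP.
    by left; rewrite subrr scaler0 addr0.
  by right; rewrite subrr scaler0 addr0 N0.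
apply: (@linked_trans _ (N, b)); apply: linked_segment => t _ /=;
  rewrite prod_normE lt_max /=; apply/orP.
  by right; rewrite subrr scaler0 addr0.
by left; rewrite subrr scaler0 addr0 N0.
Qed.

(** The easy half of Eilenberg's criterion: moving the base point from [p] to [q] along an arc off
    [X] is a homotopy that never vanishes on [X]. *)
Lemma linked_lift X p q : compact X -> linked (~` X) p q ->
  rlift X (fun z => z - p) (fun z => z - q).
Proof.
move=> cX [Xp [<-|[g [ag g0 g1 gX]]]]; first exact: lift_refl.
apply: lift_sym.
have := @lift_homotopy R _ X (fun x => x.1 - g x.2) cX.
case=> [x|z s Xz s01|f cf tf].
- apply: cont_subP; first by apply: cvg_fst.
  by apply: (cvg_comp snd g); [exact: cvg_snd|exact: ag.1].
- rewrite /= subr_eq0; apply/eqP => E; apply: (gX z) => //.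
  by exists s; rewrite ?seg01E.
- by exists f => // z /tf /=; rewrite g1 g0.
Qed.

End arcs.

(** * Eilenberg's criterion and Janiszewski's theorem *)

Section eilenberg.
Variable R : realType.
Local Notation P := (R * R)%type.
Implicit Types (p q z : P) (X : set P).

Definition rot (t : R) (v : P) : P :=
  (cos t * v.1 - sin t * v.2, sin t * v.1 + cos t * v.2).

Definition dir (v : P) : P := ((Num.sqrt (dot v v))^-1 * v.1, (Num.sqrt (dot v v))^-1 * v.2).

Lemma sqrt_dot_gt0 (v : P) : v != 0 -> 0 < Num.sqrt (dot v v).
Proof. by move=> v0; rewrite sqrtr_gt0 dotuu_gt0. Qed.

Lemma dir_turn (v : P) : v != 0 -> turn 0 v (dir v).
Proof.
move=> v0; exists (Num.sqrt (dot v v)); first exact: sqrt_dot_gt0.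
have := lt0r_neq0 (sqrt_dot_gt0 v0); rewrite cos0 sin0 /dir /=.
by move: (Num.sqrt _) => d d0; case: v {v0} => a b /=; congr pair; field.
Qed.

Lemma rot_dir t (u v : P) : v != 0 -> turn t u v -> dir u = rot t (dir v).
Proof.
move=> v0 [r r0 uE].
have duE : Num.sqrt (dot u u) = r * Num.sqrt (dot v v).
  transitivity (Num.sqrt (r ^+ 2 * dot v v)); last first.
    by rewrite sqrtrM ?sqr_ge0// sqrtr_sqr gtr0_norm.
  congr Num.sqrt; transitivity (r ^+ 2 * ((cos t ^+ 2 + sin t ^+ 2) * dot v v)).
    by rewrite uE /dot /=; ring.
  by rewrite cos2Dsin2 mul1r.
have := lt0r_neq0 (sqrt_dot_gt0 v0); have := lt0r_neq0 r0.
rewrite /dir /rot duE uE /=; move: (Num.sqrt _) => d r1 d0.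
by congr pair; field; rewrite r1 d0.
Qed.

Lemma rot_neq0 t (v : P) : v != 0 -> rot t v != 0.
Proof.
apply: turn_neq0; exists 1 => //.
by rewrite /rot !mul1r.
Qed.

Lemma dir_neq0 (v : P) : v != 0 -> dir v != 0.
Proof. by move=> v0; exact: turn_neq0 (turnN (dir_turn v0)) v0. Qed.

Lemma cont_dir (v : P) : v != 0 -> {for v, continuous dir}.
Proof.
move=> v0.
have cV : {for v, continuous (fun u : P => (Num.sqrt (dot u u))^-1)}.
  apply: continuousV; first exact: lt0r_neq0 (sqrt_dot_gt0 v0).
  apply: (@continuous_comp _ _ _ (fun u : P => dot u u) (@Num.sqrt R)); last exact: sqrt_continuous.
  by apply: cont_dot; exact: cvg_id.
apply: (@cont_pair P R R (fun u : P => (Num.sqrt (dot u u))^-1 * u.1) (fun u : P => (Num.sqrt (dot u u))^-1 * u.2)).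
  exact: (continuousM cV (@fst_cont R v)).
exact: (continuousM cV (@snd_cont R v)).
Qed.

Lemma cont_rot (T : topologicalType) (f : T -> R) (g : T -> P) x :
  {for x, continuous f} -> {for x, continuous g} ->
  {for x, continuous (fun y : T => rot (f y) (g y))}.
Proof.
move=> cf /cont_pairP[c1 c2].
have cc : {for x, continuous (fun y : T => cos (f y))}.
  by apply: (@continuous_comp _ _ _ f (@cos R)) => //; exact: continuous_cos.
have cs : {for x, continuous (fun y : T => sin (f y))}.
  by apply: (@continuous_comp _ _ _ f (@sin R)) => //; exact: continuous_sin.
apply: (@cont_pair T R R (fun y : T => cos (f y) * (g y).1 - sin (f y) * (g y).2)
  (fun y : T => sin (f y) * (g y).1 + cos (f y) * (g y).2)).
  by apply: (@continuousB _ R T); apply: continuousM.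
by apply: (@continuousD _ R T); apply: continuousM.
Qed.

Lemma tietze X (f : P -> R) : compact X -> {within X, continuous f} ->
  exists2 F : P -> R, continuous F & {in X, f =1 F}.
Proof.
move=> cX cf.
have [M [M0 HM]] : exists M : R, 0 < M /\ forall z, X z -> `|f z| <= M.
  have := compact_bounded (continuous_compact cf cX).
  case=> N [_ HN]; exists (`|N| + 1); split; first by rewrite ltr_wpDl.
  move=> z Xz; apply: (HN (`|N| + 1)); last by exists z.
  by rewrite (le_lt_trans (ler_norm _))// ltrDl.
have [||g [gf cg _]] := @continuous_bounded_extension P R _ X _ f M M0 cf HM; last by exists g.
  exact: pseudometric_normal.
exact: compact_closedP.
Qed.

(** The component [U] of [p] is bounded. Given a lift, rotating the direction of [z - q] by the
    extended angle on [U], and taking the direction of [z - p] elsewhere, defines a nonvanishing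
    continuous field on the whole plane. It is the direction of [z - p] on a large circle, so
    contracting the circle to the origin contradicts [circle_no_lift]. *)
Lemma eilenberg_half X p q (M : R) : compact X -> ~ X p -> ~ X q -> ~ linked (~` X) p q ->
  (forall z, linked (~` X) p z -> `|z| <= M) ->
  ~ rlift X (fun z => z - p) (fun z => z - q).
Proof.
move=> cX Xp Xq npq UM [th cth tth].
have clX : closed X by exact: compact_closedP.
have oX : open (~` X) by exact: closed_openC.
have [Th cTh thE] := tietze cX cth.
pose U : set P := [set z | linked (~` X) p z].
have oU : open U by exact: linked_open.
have cUX : closed (U `|` X).
  rewrite -[_ `|` _]setCK; apply: open_closedC; apply: open_ballP => z nz.
  have Xz : ~ X z by move=> Xz; apply: nz; right.
  have [e e0 He] := openP oX Xz; exists e => // y yz [Uy|Xy]; last exact: (He y yz Xy).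
  by apply: nz; left; apply: linked_trans Uy _; apply: linked_sym; apply: linked_ball He yz.
pose k1 z := rot (Th z) (dir (z - q)); pose k2 z := dir (z - p).
pose k z := if z \in U then k1 z else k2 z.
have sub_cont a : continuous (fun z : P => z - a).
  by move=> z; apply: (@cont_subP R P id (fun=> a)); [exact: cvg_id|exact: cvg_cst].
have ck1 z : (U `|` X) z -> {for z, continuous k1}.
  move=> UXz; apply: cont_rot; first exact: cTh.
  apply: (@continuous_comp _ _ _ (fun z : P => z - q) dir); first exact: sub_cont.
  apply: cont_dir; rewrite subr_eq0; apply/eqP => zq; case: UXz; rewrite zq //.
have ck2 z : ~ U z -> {for z, continuous k2}.
  move=> Uz; apply: (@continuous_comp _ _ _ (fun z : P => z - p) dir); first exact: sub_cont.
  apply: cont_dir; rewrite subr_eq0; apply/eqP => zp; apply: Uz; rewrite zp.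
  exact: linked_refl.
have kX z : X z -> k1 z = k2 z.
  move=> Xz; rewrite /k1 /k2 -thE ?inE//; apply/esym/rot_dir; last exact: tth.
  by rewrite subr_eq0; apply/eqP => E; apply: Xq; rewrite -E.
have kE1 : {in U `|` X, k =1 k1}.
  move=> z /set_mem; rewrite /k; case: ifPn => // /negP Uz [/mem_set//|/kX//].
have kE2 : {in ~` U, k =1 k2} by move=> z; rewrite in_setC /k => /negbTE ->.
have ck : continuous k.
  apply/continuous_subspace_setT.
  have -> : [set: P] = (U `|` X) `|` ~` U.
    apply/seteqP; split=> // z _; have [Uz|Uz] := pselect (U z); [by left; left|by right].
  apply: withinU_continuous => //; first exact: open_closedC.
    apply: (@subspace_eq_continuous _ _ _ k1); first by move=> z zA; apply/esym; exact: kE1.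
    by apply: continuous_in_subspaceT => z /set_mem; exact: ck1.
  apply: (@subspace_eq_continuous _ _ _ k2); first by move=> z zA; apply/esym; exact: kE2.
  by apply: continuous_in_subspaceT => z /set_mem; exact: ck2.
have k0 z : k z != 0.
  have [Uz|Uz] := pselect (U z).
    rewrite kE1 ?inE; last by left.
    apply/rot_neq0/dir_neq0; rewrite subr_eq0; apply/eqP => zq; apply: npq.
    by rewrite -zq.
  rewrite kE2 ?inE//; apply/dir_neq0; rewrite subr_eq0; apply/eqP => zp; apply: Uz.
  by rewrite zp; exact: linked_refl.
have M0 : 0 <= M by apply: le_trans (UM p _); [exact: normr_ge0|exact: linked_refl].
(* A point of the circle lying in [U] would have both coordinates within M + |p| of those of [p], so
   r^2 would be at most 2 (M + |p|)^2; this [r] is larger. *)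
pose r := 2 * (M + `|p|) + 1; have p0 := normr_ge0 p.
have r0 : 0 < r by rewrite /r; lra.
have circU t : ~ U (circle p r t).
  move=> /UM; rewrite prod_normE /circle /= ge_max => /andP[h1 h2].
  have : `|r * cos t| <= M + `|p|.
    have -> : r * cos t = (p.1 + r * cos t) - p.1 by ring.
    by rewrite (le_trans (ler_normB _ _))// lerD// prod_normE le_max lexx.
  have : `|r * sin t| <= M + `|p|.
    have -> : r * sin t = (p.2 + r * sin t) - p.2 by ring.
    by rewrite (le_trans (ler_normB _ _))// lerD// prod_normE le_max lexx orbT.
  rewrite !ler_norml => /andP[a1 a2] /andP[b1 b2].
  have : r ^+ 2 <= (M + `|p|) ^+ 2 + (M + `|p|) ^+ 2.
    have -> : r ^+ 2 = (r * cos t) ^+ 2 + (r * sin t) ^+ 2.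
      by rewrite !exprMn -mulrDr cos2Dsin2 mulr1.
    by apply: lerD; rewrite -real_normK ?num_real// lerXn2r ?nnegrE ?normr_ge0 ?addr_ge0// ler_norml; apply/andP.
  rewrite /r; set m := M + `|p|; have : 0 <= m by rewrite addr_ge0.
  nra.
pose D := circle p r @` [set` `[0, 2 * pi]%R].
have cc : continuous (circle p r).
  move=> t; apply: (@cont_pair _ _ _ (fun t => p.1 + r * cos t) (fun t => p.2 + r * sin t)).
    apply: continuousD; first exact: cvg_cst.
    by apply: continuousM; [exact: cvg_cst|exact: continuous_cos].
  apply: continuousD; first exact: cvg_cst.
  by apply: continuousM; [exact: cvg_cst|exact: continuous_sin].
have cD : compact D.
  by apply: continuous_compact; [exact: continuous_subspaceT|exact: segment_compact].
apply: (@circle_no_lift R D p r r0).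
  by move=> t t02; exists t => //=; rewrite in_itv.
apply: (@lift_trans R P D k).
  exists (fun=> 0); first by apply: continuous_subspaceT => x; exact: cvg_cst.
  move=> _ [t _ <-]; have cU : circle p r t \in ~` U by rewrite inE; exact: circU.
  rewrite kE2// /k2; apply: dir_turn.
  rewrite subr_eq0; apply/eqP => zp; apply: (circU t); rewrite zp; exact: linked_refl.
(* Scaling the argument shrinks [k] on the circle to the constant [k 0]. *)
have := @lift_homotopy R P D (fun x => k (x.2 *: x.1)) cD.
case=> [x|z s _ _|f cf tf]; first last.
- apply: (@lift_trans R P D (fun=> k 0)).
    by exists f => // z /tf /=; rewrite scale1r scale0r.
  by apply: lift_const => //; apply/negP => /eqP[/eqP]; rewrite oner_eq0.
- exact: k0.
apply: (@continuous_comp _ _ _ (fun x : P * R => x.2 *: x.1) k); last exact: ck.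
by apply: (@cont_scaleP R _ snd fst); [exact: cvg_snd|exact: cvg_fst].
Qed.

Lemma compact_normle X : compact X -> exists M : R, forall z, X z -> `|z| <= M.
Proof.
move=> /compact_bounded[N [_ HN]]; exists (`|N| + 1) => z; apply: (HN (`|N| + 1)).
by rewrite (le_lt_trans (ler_norm _))// ltrDl.
Qed.

(** One of the two components is bounded, because two points outside a ball containing [X] are
    linked outside it; [eilenberg_half] applies to that component. *)
Lemma eilenberg X p q : compact X -> ~ X p -> ~ X q ->
  rlift X (fun z => z - p) (fun z => z - q) -> linked (~` X) p q.
Proof.
move=> cX Xp Xq L; apply: contrapT => npq.
have [M HM] := compact_normle cX.
have [Up|/existsNP[z /not_implyP[pz zM]]] :=
  pselect (forall z, linked (~` X) p z -> `|z| <= M).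
  exact: (eilenberg_half cX Xp Xq npq Up L).
apply: (@eilenberg_half X q p M) => //; [by move/linked_sym| |exact: lift_sym].
move=> y qy; rewrite leNgt; apply/negP => yM; apply: npq.
apply: (linked_trans pz); apply: linked_sym; apply: (linked_trans qy).
move/negP : zM; rewrite -ltNge => zM.
by apply: linked_sub (linked_outside yM zM) => w /= Mw /HM; rewrite leNgt Mw.
Qed.

(** Lifts on [X] and on [Y] glue because the sets share at most one point; Eilenberg's criterion
    translates between lifts and arcs in both directions. *)
Lemma janiszewski X Y c p q : compact X -> compact Y -> X `&` Y `<=` [set c] ->
  linked (~` X) p q -> linked (~` Y) p q -> linked (~` (X `|` Y)) p q.
Proof.
move=> cX cY XY Xpq Ypq.
have [Xp _] := Xpq; have [Yp _] := Ypq.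
have [Xq _] := linked_sym Xpq; have [Yq _] := linked_sym Ypq.
(* If [c] is [p], then [X] and [Y] are disjoint, and a point other than [p] has to serve as the
   gluing point. *)
have [cXY|cXY] := pselect (c = p).
  apply: eilenberg; first exact: compactU; [by case|by case|].
  apply: (@lift_glue _ _ _ _ (p + (1, 0))) => //; try exact: compact_closedP;
    try exact: linked_lift.
    by move=> z /[dup] /XY zc [Xz _]; case: Xp; rewrite -cXY -zc.
  by rewrite addrC addKr; apply/negP => /eqP[/eqP]; rewrite oner_eq0.
apply: eilenberg; first exact: compactU; [by case|by case|].
apply: (lift_glue _ _ XY) => //; try exact: compact_closedP; try exact: linked_lift.
by rewrite subr_eq0; apply/eqP.
Qed.

Lemma arc_not_separate (g : R -> P) p q : jarc g -> ~ (g @` (@seg01 R)) p ->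
  ~ (g @` (@seg01 R)) q -> linked (~` (g @` (@seg01 R))) p q.
Proof. by move=> ag gp gq; apply: eilenberg => //; [exact: arc_img|exact: lift_arc]. Qed.

End eilenberg.

(** * Points visible from an edge *)

Section access.
Variable R : realType.
Local Notation P := (R * R)%type.
Implicit Types (p q y z a : P) (X : set P) (g k : R -> P).

Lemma segment_IVT (f : R -> R) (s t v : R) : s <= t -> continuous f ->
  f s <= v <= f t \/ f t <= v <= f s -> exists2 x, s <= x <= t & f x = v.
Proof.
move=> st cf H; have [||x + xv] := @IVT R f s t v st.
- exact: continuous_subspaceT.
- by case: H => /andP[h1 h2]; rewrite ge_min le_max ?h1 ?h2 ?orbT.
by rewrite in_itv /=; exists x.
Qed.

Lemma first_level (f : R -> R) c : continuous f -> c <= f 0 -> f 1 <= c ->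
  exists2 t, 0 <= t <= 1 & f t = c /\ forall s, 0 <= s <= t -> c <= f s.
Proof.
move=> cf f0 f1.
have [|x x01 xc] := @segment_IVT f 0 1 c ler01 cf; first by right; apply/andP.
have [|t [t01 ft tmin]] := first_hit cf (@closed_eq R c); first by exists x.
exists t => //; split=> // s /andP[s0 st]; rewrite leNgt; apply/negP => fsc.
have [|w ws wc] := @segment_IVT f 0 s c s0 cf; first by right; rewrite f0 ltW.
apply: (tmin w _ wc); have : w != s by apply: contraTneq fsc => <-; rewrite wc ltxx.
by move=> ws'; case/andP: ws => -> ws /=; rewrite (lt_le_trans _ st)// lt_neqAle ws' ws.
Qed.

Lemma cont_dist g a : continuous g -> continuous (fun s => `|g s - a|).
Proof.
move=> cg s; apply: (@continuous_comp _ _ _ (fun s => g s - a) Num.norm).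
  by apply: (@cont_subP R R g (fun=> a)); [exact: cg|exact: cvg_cst].
exact: norm_continuous.
Qed.

Definition sphere a (r : R) : set P := [set z | `|z - a| = r].

Lemma closed_sphere a r : closed (sphere a r).
Proof.
have : continuous (fun z : P => `|z - a|).
  move=> z; apply: (@continuous_comp _ _ _ (fun z : P => z - a) Num.norm).
    by apply: (@cont_subP R P id (fun=> a)); [exact: cvg_id|exact: cvg_cst].
  exact: norm_continuous.
by move/continuous_closedP => /(_ _ (@closed_eq R r)).
Qed.

Lemma compact_sphere a r : compact (sphere a r).
Proof.
pose B : set P := [set` `[a.1 - r, a.1 + r]%R] `*` [set` `[a.2 - r, a.2 + r]%R].
have cB : compact B by apply: compact_setX; exact: segment_compact.
apply: (subclosed_compact _ cB); first exact: closed_sphere.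
move=> z /= zr.
have : `|z - a| <= r by rewrite zr.
by rewrite prod_normE ge_max /= !ler_distl => /andP[h1 h2]; split; rewrite /= in_itv.
Qed.

Lemma linked_inball X a (r : R) y z :
  linked (~` (X `|` sphere a r)) y z -> `|y - a| < r ->
  linked (~` X `&` [set w | `|w - a| < r]) y z.
Proof.
move=> [XSy h] yr; have Xy : ~ X y by move=> Xy; apply: XSy; left.
split; first by split.
case: h => [|[g [ag g0 g1 gX]]]; [by left|right].
exists g; split=> // _ [s + <-]; rewrite seg01E => s01; split.
  by move=> Xg; apply: (gX (g s)); [exists s; rewrite ?seg01E|left].
rewrite /= ltNge; apply/negP => rs.
have [|||w ws wr] := @segment_IVT (fun s => `|g s - a|) 0 s r.
- by case/andP: s01.
- exact: cont_dist ag.1.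
- by left; rewrite g0 rs (ltW yr).
apply: (gX (g w)); first by exists w => //; rewrite seg01E; move: ws s01; lra.
by right.
Qed.

Lemma linked_sub_arc (O : set P) g (s t : R) : jarc g -> 0 <= s <= 1 -> 0 <= t <= 1 ->
  (forall x, s <= x <= t \/ t <= x <= s -> O (g x)) -> linked O (g s) (g t).
Proof.
move=> ag s01 t01 H; split.
  by apply: H; have [st|/ltW ts] := leP s t; [left|right]; lra.
have [->|st] := eqVneq s t; [by left|right].
exists (fun x => g (s + (t - s) * x)); split.
- exact: arc_sub.
- by rewrite mulr0 addr0.
- by congr g; ring.
- move=> _ [x + <-]; rewrite seg01E => x01; apply: H.
  by have [/ltW h|h] := ltP s t; [left|right]; nra.
Qed.

Lemma compact_away X a : closed X -> ~ X a ->
  exists2 e : R, 0 < e & forall z, `|z - a| < e -> ~ X z.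
Proof. by move=> cX Xa; have [e e0 H] := openP (closed_openC cX) Xa; exists e. Qed.

Lemma sub_arc_img g (s t : R) : s <= t ->
  (fun x => g (s + (t - s) * x)) @` (@seg01 R) = g @` [set x | s <= x <= t].
Proof.
move=> st; apply/seteqP; split=> _ [x + <-].
  by rewrite seg01E => x01; exists (s + (t - s) * x) => //=; nra.
move=> /= xst; have [E|n] := eqVneq s t.
  exists 0; first by rewrite seg01E lexx ler01.
  by congr g; rewrite E; move: xst; rewrite E; lra.
have ts : 0 < t - s by rewrite subr_gt0 lt_neqAle n.
exists ((x - s) / (t - s)).
  rewrite seg01E divr_ge0 ?subr_ge0 ?(ltW ts)//=; last by case/andP: xst.
  by rewrite ler_pdivrMr// mul1r lerD2r; case/andP: xst.
by congr g; rewrite mulrC divfK ?gt_eqF//; ring.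
Qed.

Lemma compact_sub_arc g (s t : R) : continuous g -> compact (g @` [set x | s <= x <= t]).
Proof.
move=> cg; apply: continuous_compact; first exact: continuous_subspaceT.
have := @segment_compact R s t; by congr compact.
Qed.

Section track.
Variables (g : R -> P) (X' : set P).
Hypotheses (ag : jarc g) (cX' : compact X') (gX' : forall t, 0 < t < 1 -> ~ X' (g t)).
Let X := g @` (@seg01 R) `|` X'.
Let a := g 0.

(** The ball of radius [r] around [g t] misses [X'] and all of [g] except the piece between [t0] and
    [t2]; these are the data from which [track] starts. *)
Lemma track_radius (rho t0 t : R) : 0 <= t0 < t -> t < 1 -> `|g t - a| < rho ->
  exists r t2, [/\ 0 < r, t < t2 < 1, forall s, t <= s <= t2 -> `|g s - a| < rho &
    forall z, `|z - g t| < r -> [/\ `|z - a| < rho, ~ X' z &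
      forall s, 0 <= s <= t0 \/ t2 <= s <= 1 -> g s <> z]].
Proof.
move=> /andP[t00 t0t] t1 gt_rho.
have tt : 0 < t < 1 by lra.
have oB : open [set s | `|g s - a| < rho].
  by move: (@cont_dist g a ag.1) => /continuousP /(_ _ (@open_lt R rho)).
have [e e0 He] : exists2 e : R, 0 < e & forall s, `|s - t| < e -> `|g s - a| < rho.
  have : nbhs t [set s | `|g s - a| < rho] by exact: open_nbhs_nbhs.
  by move=> /nbhs_normP[e /= e0 H]; exists e => // s st; apply: H; rewrite /= distrC.
pose t2 := t + Num.min (e / 2) ((1 - t) / 2).
have t2P : t < t2 < 1 /\ t2 < t + e.
  rewrite /t2; have [h|h] := leP (e / 2) ((1 - t) / 2); lra.
have [t21 t2e] := t2P.
have [r1 r10 H1] := compact_away (compact_closedP cX') (gX' tt).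
have K2 : ~ (g @` [set x | 0 <= x <= t0]) (g t).
  by move=> [s /= st /(arc_inj ag)]; lra.
have [r2 r20 H2] := compact_away (compact_closedP (compact_sub_arc ag.1)) K2.
have K3 : ~ (g @` [set x | t2 <= x <= 1]) (g t).
  by move=> [s /= st /(arc_inj ag)]; lra.
have [r3 r30 H3] := compact_away (compact_closedP (compact_sub_arc ag.1)) K3.
exists (Num.min (Num.min r1 r2) (Num.min r3 (rho - `|g t - a|))), t2; split.
- by rewrite !lt_min r10 r20 r30 subr_gt0.
- exact: t21.
- by move=> s st; apply: He; rewrite ger0_norm; lra.
- move=> z; rewrite !lt_min => /andP[/andP[z1 z2] /andP[z3 z4]]; split.
  + have -> : z - a = (z - g t) + (g t - a) by rewrite addrA subrK.
    by rewrite (le_lt_trans (ler_normD _ _))//; move: z4; lra.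
  + exact: H1.
  + move=> s [st|st] E; [apply: (H2 z) => //|apply: (H3 z) => //]; by exists s.
Qed.

(* Janiszewski's theorem, applied to an arc of g and to the rest of X together
   with a sphere, moves y along g without crossing X or leaving the ball. *)
Lemma track (rho t0 t t' r t2 delta : R) y : 0 < t' <= t0 -> t0 < t ->
  t < t2 < 1 -> (forall s, t' <= s <= t2 -> `|g s - a| < rho) -> 0 < r ->
  (forall z, `|z - g t| < r -> [/\ `|z - a| < rho, ~ X' z &
      forall s, 0 <= s <= t0 \/ t2 <= s <= 1 -> g s <> z]) ->
  0 < delta -> `|y - g t| < r -> ~ X y ->
  exists2 y', `|y' - g t'| < delta &
    linked (~` X `&` [set w | `|w - a| < rho]) y y'.
Proof.
move=> t'0 t0t t2t Hrho r0 Hr delta0 yr Xy.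
pose be := delta / 2; have be0 : 0 < be by rewrite /be; lra.
have [ya X'y gy] := Hr _ yr.
have [yb|yb] := leP `|y - g t'| be.
  by exists y; [rewrite (le_lt_trans yb)// /be; lra|exact: linked_refl].
pose B : set P := [set z | `|z - g t'| < be].
have oB : open B.
  apply: open_ballP => p /= pb; exists (be - `|p - g t'|); first by rewrite subr_gt0.
  move=> q qp; rewrite /B /=.
  have -> : q - g t' = (q - p) + (p - g t') by rewrite addrA subrK.
  by rewrite (le_lt_trans (ler_normD _ _))//; move: qp; lra.
have [tau [taut Htau]] : exists tau, t' < tau < t /\ forall s, t' <= s <= tau -> B (g s).
  have : nbhs t' (g @^-1` B).
    by apply: ag.1; apply: open_nbhs_nbhs; split=> //; rewrite /B /= subrr normr0.
  move=> /nbhs_normP[e /= e0 H].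
  exists (t' + Num.min (e / 2) ((t - t') / 2)).
  have [h|h] := leP (e / 2) ((t - t') / 2); (split; first by lra);
    move=> s st; apply: H; rewrite /= ltr_distlC; lra.
pose G1 := g @` [set x | 0 <= x <= t'].
pose G2 := g @` [set x | t2 <= x <= 1].
(* The target [g t'] lies on [G1], so the ball [B] around it is cut out of [Z]. The piece of [g]
   from [t'] to [tau] lies in [B] and is left out; the arc [l] below covers the piece from [tau] to
   [t2] and meets [Z] at most in [g t2]. *)
pose Z := (sphere a rho `|` (X' `|` (G1 `|` G2))) `&` ~` B.
have cZ : compact Z.
  have c1 : compact (sphere a rho `|` (X' `|` (G1 `|` G2))).
    by apply: compactU; [exact: compact_sphere|apply: compactU => //; apply: compactU;
      apply: compact_sub_arc; exact: ag.1].
  apply: (subclosed_compact _ c1); last by move=> ? [].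
  by apply: closedI; [exact: compact_closedP|exact: open_closedC].
pose l x := g (tau + (t2 - tau) * x).
have al : jarc l by apply: arc_sub => //; lra.
have lE : l @` (@seg01 R) = g @` [set x | tau <= x <= t2] by apply: sub_arc_img; lra.
have nS s : t' <= s <= t2 -> ~ sphere a rho (g s).
  by move=> h; rewrite /sphere /= => E; have := Hrho s h; rewrite E ltxx.
have ZL : Z `&` l @` (@seg01 R) `<=` [set g t2].
  rewrite lE => z [[h _] [s /= st E0]]; rewrite -E0 in h *; clear z E0.
  have s01 : 0 <= s <= 1 by lra.
  case: h => [|[|[[x /= xt /(arc_inj ag) E]|[x /= xt /(arc_inj ag) E]]]].
  - by move/nS; case; lra.
  - by move/gX'; case; lra.
  - exfalso; have xs : x = s by (apply: E => //; lra). lra.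
  - have xs : x = s by apply: E => //; lra.
    by congr g; lra.
have Z1 : linked (~` Z) y (g t').
  have Zball z : `|z - g t| < r -> ~ Z z.
    move=> /Hr[za X'z gz] [h _]; case: h => [|[//|[[s /= st]|[s /= st]]]].
    - by rewrite /sphere /= => E; rewrite E ltxx in za.
    - by apply: gz; left; lra.
    - by apply: gz; right; lra.
  apply: (@linked_trans _ _ (g t)).
    by apply: linked_sym; apply: linked_ball yr; exact: Zball.
  apply: linked_sub_arc => //; [lra|lra|] => s [|st]; first by lra.
  have s01 : 0 <= s <= 1 by lra.
  move=> [h nB]; case: h => [|[|[[x /= xt /(arc_inj ag) E]|[x /= xt /(arc_inj ag) E]]]].
  - by move/nS; case; lra.
  - by apply: gX'; lra.
  - apply: nB; have xs : x = s by (apply: E => //; lra).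
    have -> : s = t' by lra.
    by apply: Htau; lra.
  - have xs : x = s by (apply: E => //; lra). lra.
have L1 : linked (~` (l @` (@seg01 R))) y (g t').
  apply: arc_not_separate => //; rewrite lE => -[s /= st].
    by move=> E; apply: Xy; left; exists s; rewrite ?seg01E//; lra.
  by move/(arc_inj ag); lra.
have [_ [E|[al' [aal al0 al1 alZ]]]] := janiszewski cZ (arc_img al) ZL Z1 L1.
  by move: yb; rewrite E subrr normr0; lra.
(* The path is stopped when it first comes within distance [be] of [g t']. Up to then it is outside
   [B], where avoiding [Z] and [l] means avoiding [X] and the sphere. *)
have [|||s s01 [sb sless]] := @first_level (fun s => `|al' s - g t'|) be.
- exact: cont_dist aal.1.
- by rewrite al0 ltW.
- by rewrite al1 subrr normr0 ltW.
exists (al' s); first by rewrite sb /be; lra.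
apply: linked_inball => //.
rewrite -al0; apply: linked_sub_arc => //; rewrite ?lexx ?ler01//.
have xB x : 0 <= x <= s -> ~ B (al' x) by move=> /sless; rewrite /B /= leNgt => /negP.
have xZ x : 0 <= x <= s -> (~` (Z `|` l @` (@seg01 R))) (al' x).
  by move=> xs; apply: alZ; exists x => //; rewrite seg01E; move: xs s01; lra.
move=> x xs; have {xs} x0s : 0 <= x <= s by move: xs s01; lra.
have nB := xB _ x0s; have nZ := xZ _ x0s.
have {}nZ : (sphere a rho `|` (X' `|` (G1 `|` G2))) (al' x) -> False.
  by move=> h; apply: nZ; left.
move=> [[[w + wE]|h]|h]; last by apply: nZ; left.
  rewrite seg01E => w01.
  have [w1|w1] := leP w t'.
    by apply: nZ; right; right; left; exists w => //=; lra.
  have [w2|w2] := leP t2 w.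
    by apply: nZ; right; right; right; exists w => //=; lra.
  have [w3|w3] := leP w tau.
    by apply: nB; rewrite -wE; apply: Htau; lra.
  by apply: (xZ _ x0s); right; rewrite lE; exists w => //=; lra.
by apply: nZ; right; left.
Qed.

End track.
End access.

(** * Arcs converging to a point of the drawing *)

Section inf.
Variable R : realType.
Local Notation P := (R * R)%type.
Implicit Types (p q y z a : P) (X : set P) (g k : R -> P).

Definition visible X p y := exists k, [/\ jarc k, k 0 = p, k 1 = y &
  forall t, 0 < t <= 1 -> ~ X (k t)].

Section trim.
Variables (beta : nat -> R -> P).
Hypotheses (ab : forall n, jarc (beta n))
  (bE : forall n, beta n 1 = beta n.+1 0)
  (bdisj : forall n m s t, (n.+1 < m)%N -> 0 <= s <= 1 -> 0 <= t <= 1 ->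
     beta n s <> beta m t)
  (b0 : forall t, 0 <= t <= 1 -> beta 0%N 0 <> beta 1%N t).

(* Cutting consecutive arcs at their first meeting point makes the infinite
   concatenation injective. *)
Lemma trim_ex : exists sg tau : nat -> R, [/\ sg 0%N = 0,
  forall n, [/\ 0 <= sg n, sg n < tau n & tau n <= 1],
  forall n, beta n (tau n) = beta n.+1 (sg n.+1) &
  forall n s t, sg n <= s < tau n -> 0 <= t <= 1 -> beta n s <> beta n.+1 t].
Proof.
pose good (n : nat) (s : R) := 0 <= s <= 1 /\ forall t, 0 <= t <= 1 -> beta n s <> beta n.+1 t.
have step n (s : R) : exists ts : R * R, good n s -> [/\ s < ts.1, ts.1 <= 1, 0 <= ts.2 <= 1,
    beta n ts.1 = beta n.+1 ts.2 &
    forall x t, s <= x < ts.1 -> 0 <= t <= 1 -> beta n x <> beta n.+1 t].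
  have [[s01 gs]|N] := pselect (good n s); last by exists (0, 0).
  have s1 : s != 1.
    apply/eqP => s1; apply: (gs 0); first by rewrite lexx ler01.
    by rewrite s1.
  have asub : jarc (fun x => beta n (s + (1 - s) * x)).
    by apply: arc_sub => //; lra.
  have [|x [x01 [t + tx] xmin]] := first_hit asub.1 (compact_closedP (arc_img (ab n.+1))).
    exists 1; first by lra.
    by exists 0; [rewrite seg01E; lra|rewrite -bE; congr beta; ring].
  rewrite seg01E => t01.
  have x0 : x != 0.
    apply/eqP => x0; apply: (gs t t01); rewrite tx x0; congr beta; ring.
  have ss : 0 < 1 - s by move/eqP: s1; lra.
  have x00 : 0 < x by rewrite lt_neqAle eq_sym x0; case/andP: x01.
  exists (s + (1 - s) * x, t) => _; split => //=; try nra.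
  move=> y u ys u01 E; apply: (xmin ((y - s) / (1 - s))).
    rewrite divr_ge0 ?(ltW ss) ?subr_ge0//=; last by case/andP: ys.
    by rewrite ltr_pdivrMr//; nra.
  by exists u; rewrite ?seg01E// -E; congr beta; rewrite mulrC divfK ?gt_eqF//; ring.
have /choice[f fP] : forall ns : nat * R, exists ts : R * R, good ns.1 ns.2 ->
    [/\ ns.2 < ts.1, ts.1 <= 1, 0 <= ts.2 <= 1, beta ns.1 ts.1 = beta ns.1.+1 ts.2 &
    forall x t, ns.2 <= x < ts.1 -> 0 <= t <= 1 -> beta ns.1 x <> beta ns.1.+1 t].
  by move=> [n s]; exact: step.
pose sg := fix sg n : R := if n is m.+1 then (f (m, sg m)).2 else 0.
have goodsg n : good n (sg n).
  elim: n => [|n IH]; first by split; rewrite /= ?lexx ?ler01.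
  have [h1 h2 h3 h4 h5] := fP (n, sg n) IH; split=> // t t01.
  rewrite -[beta _ _]h4; apply: bdisj => //.
  by move: IH => [/andP[i0 i1] _] /=; rewrite h2 andbT (le_trans i0)// ltW.
exists sg, (fun n => (f (n, sg n)).1); split=> //.
- move=> n; have [h1 h2 h3 h4 h5] := fP (n, sg n) (goodsg n); split=> //.
  by have [/andP[]] := goodsg n.
- by move=> n; have [h1 h2 h3 h4 h5] := fP (n, sg n) (goodsg n).
- by move=> n; have [h1 h2 h3 h4 h5] := fP (n, sg n) (goodsg n).
Qed.

Lemma infinite_arc a (rho : nat -> R) :
  (forall n s, 0 <= s <= 1 -> `|beta n s - a| < rho n) ->
  (forall n, rho n.+1 <= rho n) -> (forall e, 0 < e -> exists n, rho n < e) ->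
  (forall n s, 0 <= s <= 1 -> beta n s <> a) ->
  exists k, [/\ jarc k, k 0 = a, k 1 = beta 0%N 0 &
    forall t, 0 < t <= 1 -> exists n s, 0 <= s <= 1 /\ k t = beta n s].
Proof.
move=> brho rhoD rho0 ba.
have [sg [tau [sg0 st stE stmin]]] := trim_ex.
pose piece n (u : R) := beta n (sg n + (tau n - sg n) * clamp u).
have piece0 n u : u <= 0 -> piece n u = beta n (sg n).
  by move=> u0; rewrite /piece clamp0// mulr0 addr0.
have piece1 n u : 1 <= u -> piece n u = beta n (tau n).
  by move=> u1; rewrite /piece clamp1// mulr1 addrC subrK.
(* Each summand is the displacement along one piece, constant outside the unit interval allotted to
   that piece; so [F N] is continuous and follows the first [N] pieces. *)
pose F (N : nat) (u : R) : P := beta 0%N 0 + \sum_(i < N) (piece i (u - i%:R) - beta i (sg i)).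
have FS N u : u <= N%:R -> F N.+1 u = F N u.
  by move=> uN; rewrite /F big_ord_recr /= piece0 ?subrr ?addr0// subr_le0.
have FE N M u : u <= N%:R -> (N <= M)%N -> F M u = F N u.
  move=> uN; elim: M => [|M IH]; first by rewrite leqn0 => /eqP ->.
  rewrite leq_eqVlt => /orP[/eqP <-//|]; rewrite ltnS => NM.
  by rewrite FS ?IH// (le_trans uN)// ler_nat.
have Fpiece n u : n%:R <= u <= n.+1%:R -> F n.+1 u = piece n (u - n%:R).
  move=> /andP[nu un]; rewrite /F big_ord_recr /=.
  suff -> : \sum_(i < n) (piece i (u - i%:R) - beta i (sg i)) = beta n (sg n) - beta 0%N 0.
    by rewrite addrA [beta 0%N 0 + _]addrC subrK addrC subrK.
  have : forall m, (m <= n)%N ->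
    \sum_(i < m) (piece i (u - i%:R) - beta i (sg i)) = beta m (sg m) - beta 0%N 0.
    elim=> [|m IH] mn; first by rewrite big_ord0 sg0 subrr.
    have h1 : 1 <= u - m%:R.
      by have : m.+1%:R <= n%:R :> R; [rewrite ler_nat|rewrite -natr1; lra].
    by rewrite big_ord_recr /= IH 1?ltnW// piece1// stE addrC addrA subrK.
  by apply.
have cN (N : nat) : continuous (fun u : R => clamp (u - N%:R)).
  move=> v; apply: (@continuous_comp _ _ _ (fun u : R => u - N%:R) (@clamp R)); last exact: clamp_cont.
  by apply: continuousB; [exact: cvg_id|exact: cvg_cst].
have contF N : continuous (F N).
  rewrite /F; elim: N => [|N IH] u.
    under eq_fun do rewrite big_ord0 addr0; exact: cvg_cst.
  under eq_fun do rewrite big_ord_recr /= addrA.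
  apply: (@cont_addP R R (F N)); first exact: IH.
  apply: (@cont_subP R R (fun u : R => piece N (u - N%:R)) (fun=> beta N (sg N))); last exact: cvg_cst.
  apply: (@continuous_comp _ _ _ (fun u : R => sg N + (tau N - sg N) * clamp (u - N%:R)) (beta N)); last exact: (ab N).1.
  apply: continuousD; first exact: cvg_cst.
  apply: continuousM; first exact: cvg_cst.
  exact: cN.
pose f (u : R) := F (Num.truncn u).+1 u.
have fF N u : 0 <= u -> u <= N%:R -> f u = F N u.
  move=> u0 uN; have h := truncnS_gt u; rewrite /f.
  have [NM|MN] := leqP N (Num.truncn u).+1; first by rewrite (FE N).
  by rewrite -(FE _ N)// ?ltW// ltnW.
have fpiece u : 0 <= u -> exists n s, [/\ n%:R <= u < n.+1%:R, sg n <= s < tau n,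
    s = sg n + (tau n - sg n) * (u - n%:R) & f u = beta n s].
  move=> u0; pose n := Num.truncn u; have /andP[nu un] : n%:R <= u < n.+1%:R by exact: truncn_itv.
  exists n, (sg n + (tau n - sg n) * (u - n%:R)); have [s0 s1 s2] := st n.
  have un1 : u - n%:R < 1 by move: un; rewrite -natr1; lra.
  have un0 : 0 <= u - n%:R by rewrite subr_ge0.
  split=> //; first by rewrite nu.
    by nra.
  have un2 : u <= n.+1%:R by exact: ltW.
  have nu2 : n%:R <= u <= n.+1%:R by apply/andP.
  have c01 : 0 <= u - n%:R <= 1 by rewrite un0 ltW.
  by rewrite (fF _ _ u0 un2) (Fpiece _ _ nu2) /piece clamp_id.
have sg01 n s : sg n <= s < tau n -> 0 <= s <= 1 by have [] := st n; lra.
have finj u v : 0 <= u -> u <= v -> f u = f v -> u = v.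
  move=> u0 uv; have v0 := le_trans u0 uv.
  have [n [s [nu ss sE ->]]] := fpiece u u0; have [m [t [mv tt tE ->]]] := fpiece v v0.
  have s01 := sg01 _ _ ss; have t01 := sg01 _ _ tt.
  have nm : (n <= m)%N.
    by rewrite -ltnS -(ltr_nat R); move: nu mv; lra.
  move: nm; rewrite leq_eqVlt => /orP[/eqP nm|].
    rewrite -nm in tE mv tt * => /(arc_inj (ab n) s01 t01); rewrite sE tE => /addrI.
    have [_ s1 _] := st n.
    by move/(mulfI (x := tau n - sg n)); rewrite subr_eq0 gt_eqF// => /(_ isT); lra.
  rewrite leq_eqVlt => /orP[/eqP nm|nm]; last by move/bdisj; case.
  by rewrite -nm in t01 * => E; case: (stmin n s t ss t01 E).
pose k (t : R) : P := if t <= 0 then a else f (Num.max 0 (t^-1 - 1)).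
have k0 : k 0 = a by rewrite /k lexx.
have kpos t : 0 < t -> k t = f (Num.max 0 (t^-1 - 1)) by move=> t0; rewrite /k leNgt t0.
have inv1 (t : R) : 0 < t <= 1 -> 0 <= t^-1 - 1.
  by move=> /andP[t0 t1]; rewrite subr_ge0 invf_ge1.
have kpos1 t : 0 < t <= 1 -> k t = f (t^-1 - 1).
  by move=> t01; rewrite kpos ?(max_idPr _)//; [exact: inv1|case/andP: t01].
have rho_le n m : (n <= m)%N -> rho m <= rho n.
  elim: m => [|m IH]; first by rewrite leqn0 => /eqP ->.
  by rewrite leq_eqVlt => /orP[/eqP ->//|]; rewrite ltnS => /IH; apply: le_trans.
have fa u : 0 <= u -> f u <> a.
  by move=> u0; have [n [s [_ ss _ ->]]] := fpiece u u0; apply: ba; exact: sg01 ss.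
suff kc : forall t : R, 0 <= t <= 1 -> {for t, continuous k}.
  have sk : simple_curve a (beta 0%N 0) (k @` (@seg01 R)).
    exists k; split=> //.
    - by apply: continuous_in_subspaceT => t /set_mem; rewrite /= in_itv /=; exact: kc.
    - have main (x y : R) : 0 <= x -> x < y -> y <= 1 -> k x <> k y.
        move=> x0 xy y1; have y0 : 0 < y by lra.
        rewrite (kpos1 y) ?y0//; move: x0; rewrite le_eqVlt => /orP[/eqP <-|x0].
          by rewrite k0 => /esym; apply: fa; apply: inv1; lra.
        rewrite kpos1 ?x0/=; last by lra.
        move=> /esym/finj E; have : y^-1 - 1 = x^-1 - 1.
          apply: E; first by apply: inv1; lra.
          by rewrite lerD2r lef_pV2 ?posrE// ltW.
        by move/addIr/invr_inj; lra.
      move=> x y; rewrite !in_itv /= => x01 y01 E.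
      have [xy|yx|//] := ltgtP x y; exfalso.
        by apply: (main x y) => //; lra.
      by apply: (main y x) => //; lra.
    - by rewrite kpos1 ?ltr01 ?lexx// invr1 subrr (fF 0%N)// /F big_ord0 addr0.
  have [k' [ak' k'0 k'1 kk']] := simple_curveP sk.
  exists k'; split=> // t t01.
  have : (k @` (@seg01 R)) (k' t) by rewrite kk'; exists t => //; rewrite seg01E; lra.
  move=> [x]; rewrite seg01E => x01 xE.
  have x0 : x != 0.
    apply/eqP => x0; move: xE; rewrite x0 k0 -k'0 => /(arc_inj ak'); lra.
  have xp : 0 < x <= 1 by rewrite lt_neqAle eq_sym x0.
  have [n [s [_ ss _ E]]] := fpiece _ (inv1 _ xp).
  by exists n, s; split; [exact: sg01 ss|rewrite -xE kpos1].
move=> t /andP[]; rewrite le_eqVlt => /orP[/eqP <- _|t0 t1].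
  apply/cvgrPdist_lt => e e0; have [n rn] := rho0 e e0.
  have near0 (c : R) : 0 < c -> \forall x \near (0 : R), x < c.
    by move=> c0; apply: open_nbhs_nbhs; split=> //; exact: open_lt.
  near=> x; rewrite k0; have [x0|x0] := leP x 0; first by rewrite /k x0 subrr normr0.
  have xn : x < n.+1%:R^-1 by near: x; apply: near0; rewrite invr_gt0 ltr0n.
  have x1 : x < 1 by near: x; apply: near0; exact: ltr01.
  have x01 : 0 < x <= 1 by rewrite x0 ltW.
  rewrite kpos1// distrC; have [m [s [mu ss _ ->]]] := fpiece _ (inv1 _ x01).
  apply: lt_trans rn; apply: lt_le_trans (brho m s (sg01 _ _ ss)) _; apply: rho_le.
  rewrite -ltnS -(ltr_nat R); apply: le_lt_trans (_ : x^-1 - 1 < _); last by case/andP: mu.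
  rewrite lerBrDr natr1 -[n.+1%:R]invrK lef_pV2 ?posrE ?invr_gt0 ?ltr0n//; exact: ltW.
have [N HN] : exists N : nat, t^-1 < N%:R by exists (Num.truncn t^-1).+1; exact: truncnS_gt.
have cg : {for t, continuous (fun x : R => F N (Num.max 0 (x^-1 - 1)))}.
  apply: (@continuous_comp _ _ _ (fun x : R => Num.max 0 (x^-1 - 1)) (F N)); last exact: contF.
  apply: (@continuous_max R R (fun=> 0) (fun x => x^-1 - 1)); first exact: cvg_cst.
  apply: continuousB; last exact: cvg_cst.
  by apply: inv_continuous; rewrite gt_eqF.
have E : k t = F N (Num.max 0 (t^-1 - 1)).
  rewrite kpos//; apply: fF; first by rewrite le_max lexx.
  by rewrite ge_max ler0n; lra.
rewrite /prop_for /continuous_at E.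
apply: cvg_trans cg; apply: near_eq_cvg; near=> x.
have x0 : 0 < x by near: x; exact: lt_nbhsr.
rewrite kpos//; apply/esym/fF; first by rewrite le_max lexx.
rewrite ge_max ler0n /= lerBlDr; apply: ltW; apply: lt_trans (_ : _ < N%:R) _; last by lra.
near: x; have : {for t, continuous (@GRing.inv R)} by apply: inv_continuous; rewrite gt_eqF.
by move=> /(_ [set y | y < N%:R]); apply; apply: open_nbhs_nbhs; split=> //; exact: open_lt.
Unshelve. all: by end_near. Qed.

End trim.

Lemma linked_arc (O : set P) p q : linked O p q -> p != q ->
  exists g, [/\ jarc g, g 0 = p, g 1 = q & forall t, 0 <= t <= 1 -> O (g t)].
Proof.
move=> [_ [->|[g [ag g0 g1 gO]]]]; first by rewrite eqxx.
by move=> _; exists g; split=> // t t01; apply: gO; exists t; rewrite ?seg01E.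
Qed.

(* G rho y expresses that y can be pushed towards a inside the ball of radius
   rho; the successive pushes concatenate to an arc ending at a. *)
Lemma access_limit X a (G : R -> P -> Prop) : X a ->
  (forall rho y, G rho y -> ~ X y /\ `|y - a| < rho) ->
  (forall rho y, G rho y -> forall rho', 0 < rho' ->
     exists2 y', G rho' y' & linked (~` X `&` [set w | `|w - a| < rho]) y y') ->
  forall rho y, G rho y -> visible X a y.
Proof.
move=> Xa GX Gstep rho0 y0 G0.
pose S := (R * P * R)%type.
pose good (s : S) := G s.1.1 s.1.2 /\ 0 < s.2.
pose step (s s' : S) := good s -> [/\ good s', s'.1.1 <= s.1.1 / 2, s'.1.1 <= s.2,
  s'.1.1 <= `|s.1.2 - a| &
  exists b, [/\ jarc b, b 0 = s.1.2, b 1 = s'.1.2,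
    (forall t, 0 <= t <= 1 -> ~ X (b t) /\ `|b t - a| < s.1.1) &
    (forall t, 0 <= t <= 1 -> s'.2 <= `|b t - a|)]].
have stepP s : exists s', step s s'.
  case: s => -[rho y] ka.
  have [[/= Gs ka0]|N] := pselect (good (rho, y, ka)); last by exists (rho, y, ka).
  have [Xy ya] := GX _ _ Gs.
  have ya0 : 0 < `|y - a| by rewrite normr_gt0 subr_eq0; apply/eqP => E; apply: Xy; rewrite E.
  (* Halving makes the radii tend to 0. The bound by [ka], a lower bound for the distance of the
     previous arc from [a], makes nonconsecutive arcs disjoint. The bound by the distance of [y]
     keeps the next arc off the current starting point [y]. *)
  pose rho' := Num.min (rho / 2) (Num.min ka `|y - a|).
  have rho'0 : 0 < rho' by rewrite !lt_min ka0 ya0 andbT; lra.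
  have [y' Gy' yy'] := Gstep _ _ Gs _ rho'0.
  have [Xy' y'a] := GX _ _ Gy'.
  have [|b [ab b0 b1 bO]] := linked_arc yy'.
    apply: contraTneq y'a => <-; rewrite -leNgt /rho'.
    by rewrite !ge_min lexx !orbT.
  have Ka : ~ (b @` (@seg01 R)) a.
    by move=> [t]; rewrite seg01E => /bO[Xb _] E; apply: Xb; rewrite E.
  have [e e0 He] := compact_away (compact_closedP (arc_img ab)) Ka.
  exists (rho', y', e) => _; split=> //=.
  - by rewrite /rho' ge_min lexx.
  - by rewrite /rho' !ge_min lexx orbT.
  - by rewrite /rho' !ge_min lexx !orbT.
  - exists b; split; [exact: ab|exact: b0|exact: b1|by move=> t t01; have [] := bO t t01|].
    by move=> t t01; rewrite leNgt; apply/negP => /He; apply; exists t; rewrite ?seg01E.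
have [s [s0 sS]] := @dependent_choice S step (fun s => cid (stepP s)) (rho0, y0, 1 : R).
have gs n : good (s n).
  by elim: n => [|n IH]; [rewrite s0; split|have [] := sS n IH].
have /choice[b bP] : forall n, exists b, [/\ jarc b, b 0 = (s n).1.2, b 1 = (s n.+1).1.2,
    (forall t, 0 <= t <= 1 -> ~ X (b t) /\ `|b t - a| < (s n).1.1) &
    (forall t, 0 <= t <= 1 -> (s n.+1).2 <= `|b t - a|)].
  by move=> n; have [] := sS n (gs n).
pose rho n := (s n).1.1.
have rho_gt0 n : 0 < rho n.
  by have [/GX[_ h] _] := gs n; rewrite (le_lt_trans _ h).
have rhoS n : rho n.+1 <= rho n / 2 by have [] := sS n (gs n).
have rhoD n : rho n.+1 <= rho n by have := rho_gt0 n; have := rhoS n; lra.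
have rho_le n m : (n <= m)%N -> rho m <= rho n.
  elim: m => [|m IH]; first by rewrite leqn0 => /eqP ->.
  by rewrite leq_eqVlt => /orP[/eqP ->//|]; rewrite ltnS => /IH; apply: le_trans.
have bX n t : 0 <= t <= 1 -> ~ X (b n t).
  by move=> t01; have [_ _ _ h _] := bP n; case: (h t t01).
have [||||||||k [ak k0 k1 kb]] := @infinite_arc b _ _ _ _ a rho.
- by move=> n; have [] := bP n.
- by move=> n; have [_ _ -> _ _] := bP n; have [_ -> _ _ _] := bP n.+1.
- move=> n m u t nm u01 t01 E.
  have [_ _ _ _ h] := bP n; have {h} := h u u01.
  have [_ _ _ h _] := bP m; have [_ {h}] := h t t01; rewrite -E => h1 h2.
  have : rho m <= (s n.+1).2.
    by apply: le_trans (rho_le _ _ nm) _; have [] := sS n.+1 (gs n.+1).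
  by rewrite /rho; lra.
- move=> t t01 E; have [_ _ _ h _] := bP 1%N; have [_ {h}] := h t t01.
  rewrite -E; have [_ -> _ _ _] := bP 0%N; have [_ _ _ h _] := sS 0%N (gs 0%N).
  by rewrite ltNge h.
- by move=> n u u01; have [_ _ _ h _] := bP n; case: (h u u01).
- exact: rhoD.
- move=> e e0.
  have rho2 n : rho n <= rho 0%N / 2 ^+ n.
    elim: n => [|n IH]; first by rewrite expr0 divr1.
    by rewrite (le_trans (rhoS n))// exprSr invfM mulrA ler_pM2r.
  have [n Hn] : exists n : nat, rho 0%N / e < n%:R.
    by exists (Num.truncn (rho 0%N / e)).+1; exact: truncnS_gt.
  exists n; apply: le_lt_trans (rho2 n) _.
  rewrite ltr_pdivrMr ?exprn_gt0// -ltr_pdivrMl// mulrC (lt_le_trans Hn)//.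
  by rewrite -natrX ler_nat; exact: ltnW (ltn_expl n _).
- by move=> n u u01 E; apply: (bX n u u01); rewrite E.
exists k; split=> //; first by rewrite k1; have [_ -> _ _ _] := bP 0%N; rewrite s0.
by move=> t /kb[n [u [u01 ->]]]; exact: bX.
Qed.

Lemma visible_linked X p y z : X p -> visible X p y -> linked (~` X) y z -> visible X p z.
Proof.
move=> Xp [k [ak k0 k1 kX]] /[dup] yz.
have [<-|yz'] := eqVneq y z; first by exists k.
move=> /linked_arc/(_ yz')[g [ag g0 g1 gX]].
have gz : ~ X z by rewrite -g1; apply: gX; rewrite lexx ler01.
have [||h [ah h0 h1 hh]] := arc_in_cat ak ag; first by rewrite k1 g0.
  by rewrite k0 g1; apply/eqP => E; apply: gz; rewrite -E.
exists h; split; rewrite ?h0 ?h1// => t t01 Xh.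
have t01' : 0 <= t <= 1 by lra.
have : (h @` (@seg01 R)) (h t) by exists t; rewrite ?seg01E.
move=> /hh[[x + xE]|[x + xE]]; rewrite seg01E => x01; last first.
  by apply: (gX x x01); rewrite xE.
have [x0|x0] := eqVneq x 0; last first.
  by apply: (kX x); [lra|rewrite xE].
by move: xE; rewrite x0 k0 -k0 -h0 => /(arc_inj ah); lra.
Qed.

Lemma visible_start X p y : visible X p y -> ~ X y.
Proof. by move=> [k [ak k0 <- kX]]; apply: kX; lra. Qed.

(** [G rho z] says that, inside the ball of radius [rho] around [a], [z] can be pushed next to every
    point of [g] close enough to [a]. By [track] this holds for points off [X] near [g], so the
    condition reproduces itself in smaller balls, and [access_limit] yields an arc ending at [a]. *)
Lemma slide (g : R -> P) (X' : set P) y (t : R) : jarc g -> compact X' ->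
  (forall t, 0 < t < 1 -> ~ X' (g t)) -> 0 < t < 1 ->
  visible (g @` (@seg01 R) `|` X') (g t) y -> visible (g @` (@seg01 R) `|` X') (g 0) y.
Proof.
move=> ag cX' gX' t01 [k [ak k0 k1 kX]].
set X := _ `|` X'; pose a := g 0.
pose G rho z := [/\ ~ X z, `|z - a| < rho & exists2 t0, 0 < t0 < 1 &
  forall t' delta, 0 < t' <= t0 -> 0 < delta -> exists2 z', `|z' - g t'| < delta &
    linked (~` X `&` [set w | `|w - a| < rho]) z z'].
have Gtrack rho (x : R) : 0 < x < 1 -> (forall s, 0 <= s <= x -> `|g s - a| < rho) ->
    exists2 r, 0 < r & forall z, `|z - g x| < r -> ~ X z -> G rho z.
  move=> x01 Hs; have [|||r [t2 [r0 xt2 Ht2 Hr]]] := track_radius ag cX' gX' (rho := rho) (t0 := x / 2) (t := x).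
  - by lra.
  - by lra.
  - by apply: Hs; lra.
  exists r => // z zr Xz; have [za _ _] := Hr z zr.
  split=> //; exists (x / 2); first by lra.
  move=> t' delta t'0 d0; apply: (track ag cX' gX' _ _ xt2 _ r0 Hr d0 zr Xz); [lra|lra|].
  by move=> s st; have [sx|xs] := leP s x; [apply: Hs; lra|apply: Ht2; lra].
have Xa : X a by left; exact: arc_mem0.
have near_a rho : 0 < rho -> exists2 e : R, 0 < e & forall s, 0 <= s <= e -> `|g s - a| < rho.
  move=> rho0; have : nbhs (0 : R) [set s | `|g s - a| < rho].
    have /(_ (0 : R) [set x | x < rho]) := @cont_dist R g a ag.1; apply.
    by apply: open_nbhs_nbhs; split; [exact: open_lt|rewrite /= subrr normr0].
  move=> /nbhs_normP[e /= e0 H]; exists (e / 2); first by lra.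
  by move=> s se; apply: H; rewrite /= sub0r normrN ger0_norm; lra.
have Glim : forall rho z, G rho z -> visible X a z.
  apply: access_limit => // [rho z []//|rho z [Xz za [t0 t001 Ht0]] rho' rho'0].
  have [e e0 He] := near_a rho' rho'0.
  pose x := Num.min t0 e.
  have x0 : 0 < x <= t0 /\ x <= e by rewrite /x; have [h|h] := leP t0 e; lra.
  have [x1 x2] := x0.
  have [||r r0 Hr] := Gtrack rho' x; [lra|by move=> s sx; apply: He; lra|].
  have [z' z'r zz'] := Ht0 x r x1 r0.
  exists z' => //; apply: Hr => //.
  by have [[]] := linked_sym zz'.
have [M HM] := compact_normle (arc_img ag).
(* The ball of this radius around [a] contains the whole arc, so the first push can start from any
   interior [t]. *)
have [||r r0 Hr] := Gtrack (M + M + 1) t; [exact: t01| |].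
  move=> s st; have h1 : `|g s| <= M by apply: HM; exists s; rewrite ?seg01E//; lra.
  have h2 : `|a| <= M by apply: HM; exact: arc_mem0.
  by rewrite (le_lt_trans (ler_normB _ _))//; lra.
have [s s01 ks] : exists2 s, 0 < s < 1 & `|k s - g t| < r.
  have : nbhs (0 : R) [set s | `|k s - g t| < r].
    have /(_ (0 : R) [set x | x < r]) := @cont_dist R k (g t) ak.1; apply.
    by apply: open_nbhs_nbhs; split; [exact: open_lt|rewrite /= k0 subrr normr0].
  move=> /nbhs_normP[e /= e0 H]; exists (Num.min (e / 2) 2^-1).
    by have [h|h] := leP (e / 2) 2^-1; lra.
  apply: H; rewrite /= sub0r normrN ger0_norm; first by rewrite gt_min; apply/orP; left; lra.
  by rewrite le_min; lra.
have Xks : ~ X (k s) by apply: kX; lra.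
apply: (visible_linked Xa (Glim _ _ (Hr _ ks Xks))).
rewrite -k1; apply: linked_sub_arc => //; [lra|lra|].
by move=> x xs; apply: kX; lra.
Qed.

End inf.

(** * Plane drawings *)

Section finite_unions.
Variables (R : realType) (I : eqType).
Local Notation P := (R * R)%type.

Definition fcup (s : seq I) (F : I -> set P) : set P :=
  [set z | exists2 i, i \in s & F i z].

Lemma fcup_cons i s F : fcup (i :: s) F = F i `|` fcup s F.
Proof.
apply/seteqP; split=> z.
  by move=> [j]; rewrite inE => /orP[/eqP ->|js] Fz; [left|right; exists j].
move=> [Fz|[j js Fz]]; first by exists i; rewrite // mem_head.
by exists j; rewrite // inE js orbT.
Qed.

Lemma fcup_nil F : fcup [::] F = set0.
Proof. by apply/seteqP; split=> z // -[]. Qed.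

Lemma compact_fcup s F : (forall i, i \in s -> compact (F i)) -> compact (fcup s F).
Proof.
elim: s => [|i s IH] H; first by rewrite fcup_nil; exact: compact0.
rewrite fcup_cons; apply: compactU; first by apply: H; rewrite mem_head.
by apply: IH => j js; apply: H; rewrite inE js orbT.
Qed.

Lemma within_fcup s F (f : P -> R) : (forall i, i \in s -> compact (F i)) ->
  (forall i, i \in s -> {within F i, continuous f}) -> {within fcup s F, continuous f}.
Proof.
elim: s => [|i s IH] H C; first by rewrite fcup_nil; exact: continuous_subspace0.
have H' j : j \in s -> compact (F j) by move=> js; apply: H; rewrite inE js orbT.
rewrite fcup_cons; apply: withinU_continuous.
- by apply: compact_closedP; apply: H; rewrite mem_head.
- by apply: compact_closedP; exact: compact_fcup.
- by apply: C; rewrite mem_head.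
- by apply: IH => // j js; apply: C; rewrite inE js orbT.
Qed.

End finite_unions.

(** * Points that see two parts of a set *)

Section between.
Variable R : realType.
Local Notation P := (R * R)%type.
Implicit Types (p q y z a : P) (X Y A B : set P) (g k : R -> P).

Lemma visible_sub_arc X g (s t : R) : jarc g -> 0 <= s <= 1 -> 0 <= t <= 1 -> s != t ->
  (forall x, (s < x <= t \/ t <= x < s) -> ~ X (g x)) -> visible X (g s) (g t).
Proof.
move=> ag s01 t01 st H; exists (fun x => g (s + (t - s) * x)); split.
- exact: arc_sub.
- by rewrite mulr0 addr0.
- by congr g; ring.
- move=> x x01; apply: H; move: st; rewrite neq_lt => /orP[st|ts]; [left|right]; nra.
Qed.

Lemma hit X Y y q : closed X -> ~ X y -> linked (~` Y) y q -> X q ->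
  exists p, [/\ X p, ~ Y p & visible X p y].
Proof.
move=> cX Xy yq Xq; have yq' : y != q by apply/eqP => E; apply: Xy; rewrite E.
have [g [ag g0 g1 gY]] := linked_arc yq yq'.
have [|t [t01 Xt tmin]] := first_hit ag.1 cX; first by exists 1; rewrite ?g1 ?lexx ?ler01.
have t0 : t != 0 by apply/eqP => t0; apply: Xy; rewrite -g0 -t0.
exists (g t); split=> //; first exact: gY.
rewrite -g0; apply: visible_sub_arc => //; first by rewrite lexx ler01.
by move=> x [|xt]; [lra|apply: tmin].
Qed.

(** On a path from [A] to [B] off [Y], the stretch between the first point on [B] and the last point
    on [A] before it is free of [X], so its interior points see both of its ends. *)
Lemma between X Y A B p q : closed A -> closed B -> A `<=` X -> B `<=` X ->
  A `&` B `<=` Y -> X `<=` A `|` (B `|` Y) -> linked (~` Y) p q -> A p -> B q ->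
  exists y a b, [/\ A a /\ ~ Y a, B b /\ ~ Y b, visible X a y & visible X b y].
Proof.
move=> cA cB AX BX AB XABY pq Ap Bq.
have pq' : p != q by apply/eqP => E; case: pq => + _; apply; apply: AB; split=> //; rewrite E.
have [g [ag g0 g1 gY]] := linked_arc pq pq'.
have [|t [t01 Bt tmin]] := first_hit ag.1 cB; first by exists 1; rewrite ?g1 ?lexx ?ler01.
have At x : 0 <= x <= 1 -> A (g x) -> B (g x) -> False.
  by move=> x01 Ax Bx; apply: (gY x x01); exact: AB.
have t0 : t != 0.
  by apply/eqP => t0; apply: (At 0); rewrite ?lexx ?ler01 ?g0// -g0 -t0.
have t00 : 0 < t by rewrite lt_neqAle eq_sym t0; case/andP: t01.
(* The path is reversed, so that the last point on [A] becomes a first hit. *)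
pose h x := g (t + (0 - t) * x).
have ah : jarc h by apply: arc_sub => //; rewrite lexx ler01.
have [|s [s01 As smin]] := first_hit ah.1 cA.
  exists 1; first by rewrite lexx ler01.
  by rewrite /h mulr1 addrCA subrr addr0 g0.
have s0 : s != 0.
  apply/eqP => s0; apply: (At t t01) => //; move: As; rewrite s0 /h mulr0 addr0 //.
have s00 : 0 < s by rewrite lt_neqAle eq_sym s0; case/andP: s01.
have free x : 0 < x < s -> ~ X (h x).
  move=> xs Xh; have tx : 0 <= t + (0 - t) * x < t by nra.
  case: (XABY _ Xh) => [|[|]].
  - by apply: smin; lra.
  - by apply: tmin.
  - by apply: gY; move: tx t01; lra.
have h0 : h 0 = g t by rewrite /h mulr0 addr0.
exists (h (s / 2)), (h s), (h 0); split.
- by split=> //; apply: gY; nra.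
- by rewrite h0; split=> //; exact: gY.
- apply: visible_sub_arc => //; [lra|by rewrite gt_eqF//; lra|].
  by move=> x [|xs]; [lra|apply: free; lra].
- apply: visible_sub_arc => //; [by rewrite lexx ler01|lra|by rewrite lt_eqF//; lra|].
  by move=> x [xs|]; [apply: free; lra|lra].
Qed.

End between.

(** * Separation and visibility in a drawing *)

Section drawings.
Variables (R : realType) (V : finType).
Local Notation P := (R * R)%type.
Implicit Types (E H : {set {set V}}) (W : {set V}) (d : drawing R V) (e : {set V}).

Definition pts W E d : set P :=
  [set z | (exists2 w, w \in W & z = pos d w) \/ (exists2 e, e \in E & curve d e z)].

(* The integer discrepancies f e a between angles chosen at the vertices and
   along the edges can be absorbed by full turns, h at the vertices and k on the
   edges; angle lifts on the edges then glue, so the drawing does not separate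
   the plane. *)
Definition solvable E := forall f : {set V} -> V -> int,
  exists (h : V -> int) (k : {set V} -> int),
    forall e a, e \in E -> a \in e -> h a = f e a + k e.

Lemma edge_endsP E e a : simple_graph E -> e \in E -> a \in e ->
  exists2 b, a != b & e = [set a; b]%SET.
Proof.
move=> sE eE ae; have /eqP := sE e eE; move=> /cards2P[x [y [xy E0]]].
by move: ae; rewrite E0 !inE => /orP[/eqP ->|/eqP ->];
  [exists y|exists x; rewrite 1?eq_sym// finset.setUC].
Qed.

Lemma edge_arc E d e a : simple_graph E -> plane_drawing E d -> e \in E -> a \in e ->
  exists b g, [/\ a != b, e = [set a; b]%SET, jarc g, g 0 = pos d a /\ g 1 = pos d b &
    curve d e = g @` (@seg01 R)].
Proof.
move=> sE [_ dc _ _] eE ae; have [b ab E0] := edge_endsP sE eE ae.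
have /simple_curveP[g [ag g0 g1 gE]] := dc a b (eq_rect _ (fun s => is_true (s \in E)) eE _ E0).
by exists b, g; split=> //; rewrite {1}E0.
Qed.

Lemma compact_curve E d e : simple_graph E -> plane_drawing E d -> e \in E ->
  compact (curve d e).
Proof.
move=> sE dE eE; have : e != finset.set0 by rewrite -card_gt0 (sE e eE).
move=> /set0Pn[a ae]; have [b [g [_ _ ag _ ->]]] := edge_arc sE dE eE ae.
exact: arc_img.
Qed.

Lemma ptsE W E d : pts W E d =
  fcup (enum W) (fun w => [set pos d w]) `|` fcup (enum E) (curve d).
Proof.
apply/seteqP; split=> z.
  by move=> [[w wW ->]|[e eE ez]]; [left; exists w|right; exists e]; rewrite // mem_enum.
by move=> [[w + ->]|[e + ez]]; rewrite mem_enum => h; [left; exists w|right; exists e].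
Qed.

Lemma compact_pts W E d : simple_graph E -> plane_drawing E d -> compact (pts W E d).
Proof.
move=> sE dE; rewrite ptsE; apply: compactU; apply: compact_fcup.
  by move=> w _; exact: compact_set1.
by move=> e; rewrite mem_enum => eE; exact: compact_curve sE dE eE.
Qed.

Lemma curve_end E d e a : simple_graph E -> plane_drawing E d -> e \in E -> a \in e ->
  curve d e (pos d a).
Proof.
move=> sE dE eE ae; have [b [g [_ _ ag [<- _] ->]]] := edge_arc sE dE eE ae.
exact: arc_mem0.
Qed.

Lemma plane_drawingS E E' d : E \subset E' -> plane_drawing E' d -> plane_drawing E d.
Proof.
move=> /fintype.subsetP EE' [d1 d2 d3 d4]; split=> //.
- by move=> u v /EE'; exact: d2.
- by move=> e w /EE'; exact: d3.
- by move=> e f /EE' eE /EE'; exact: d4.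
Qed.

Lemma simple_graphS E E' : E \subset E' -> simple_graph E' -> simple_graph E.
Proof. by move=> /fintype.subsetP EE' sE e /EE'; exact: sE. Qed.

Lemma nonsep W E d p q : simple_graph E -> plane_drawing E d -> solvable E ->
  (forall e, e \in E -> e \subset W) -> ~ pts W E d p -> ~ pts W E d q ->
  linked (~` (pts W E d)) p q.
Proof.
move=> sE dE solE EW Xp Xq; apply: eilenberg => //; first exact: compact_pts.
have [d1 d2 d3 d4] := dE.
have Wp w : w \in W -> pos d w - p != 0 /\ pos d w - q != 0.
  by move=> wW; split; rewrite subr_eq0; apply/eqP => E0; [apply: Xp|apply: Xq]; left; exists w.
have e10 : (1, 0) != 0 :> P by apply/negP => /eqP[/eqP]; rewrite oner_eq0.
have /choice[th0 th0P] : forall w, exists t : R, w \in W -> turn t (pos d w - p) (pos d w - q).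
  move=> w; have [wW|] := boolP (w \in W); last by exists 0.
  have [h1 h2] := Wp w wW; have [s sP] := turn_e1 h1; have [t tP] := turn_e1 h2.
  by exists (s - t) => _; apply: turnD sP (turnN tP).
have Le e : e \in E -> rlift (curve d e) (fun z => z - p) (fun z => z - q).
  move=> eE; have : e != finset.set0 by rewrite -card_gt0 (sE e eE).
  move=> /set0Pn[a ae]; have [b [g [_ _ ag _ gE]]] := edge_arc sE dE eE ae.
  by rewrite gE; apply: lift_arc => //; rewrite -gE => h; [apply: Xp|apply: Xq]; right; exists e.
have /choice[th thP] : forall e, exists t : P -> R, e \in E ->
    {within curve d e, continuous t} /\ forall z, curve d e z -> turn (t z) (z - p) (z - q).
  by move=> e; have [/Le[t t1 t2]|] := boolP (e \in E); [exists t|exists (fun=> 0)].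
have /choice[f fP] : forall ea : {set V} * V, exists k : int, ea.1 \in E -> ea.2 \in ea.1 ->
    th ea.1 (pos d ea.2) = th0 ea.2 + k%:~R * (2 * pi).
  move=> [e a] /=; have [eE|] := boolP (e \in E); last by exists 0.
  have [ae|] := boolP (a \in e); last by exists 0.
  have aW : a \in W by apply: (fintype.subsetP (EW e eE)).
  have [h1 _] := Wp a aW; have [_ /(_ _ (curve_end sE dE eE ae)) h2] := thP e eE.
  by have [k kE] := turn_uniq h1 h2 (th0P a aW); exists k.
have [h [k hk]] := solE (fun e a => f (e, a)).
(* After the corrections by [h] and [k] the angles at vertices and along edges agree wherever they
   overlap; distinct edges meet only in vertices, so [T] is well defined. *)
have /choice[T TP] : forall z, exists t : R,
    (forall w, w \in W -> z = pos d w -> t = th0 w + (h w)%:~R * (2 * pi)) /\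
    (forall e, e \in E -> curve d e z -> t = th e z + (k e)%:~R * (2 * pi)).
  have we w e : w \in W -> e \in E -> curve d e (pos d w) ->
      th e (pos d w) + (k e)%:~R * (2 * pi) = th0 w + (h w)%:~R * (2 * pi).
    move=> wW eE /(d3 _ _ eE) wE; rewrite (fP (e, w) eE wE) (hk e w eE wE) /= intrD; ring.
  move=> z; have [[w wW zw]|nw] := pselect (exists2 w, w \in W & z = pos d w).
    exists (th0 w + (h w)%:~R * (2 * pi)); split.
      by move=> w' _; rewrite zw => /d1 ->.
    by move=> e eE; rewrite zw => ez; rewrite we.
  have [[e eE ez]|ne] := pselect (exists2 e, e \in E & curve d e z).
    exists (th e z + (k e)%:~R * (2 * pi)); split.
      by move=> w wW zw; case: nw; exists w.
    move=> e' e'E e'z; have [->//|ee'] := eqVneq e' e.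
    have := d4 _ _ e'E eE ee' z (conj e'z ez); move=> [w /= ]; rewrite inE => /andP[we' _] zw.
    by case: nw; exists w => //; apply: (fintype.subsetP (EW e' e'E)).
  exists 0; split; first by move=> w wW zw; case: nw; exists w.
  by move=> e eE ez; case: ne; exists e.
exists T; last first.
  move=> z [[w wW ->]|[e eE ez]].
    by have [/(_ _ wW erefl) -> _] := TP (pos d w); apply/turn_shift/th0P.
  by have [_ /(_ _ eE ez) ->] := TP z; apply: turn_shift; have [_ ] := thP e eE; apply.
rewrite ptsE; have cc e : e \in enum E -> compact (curve d e).
  by rewrite mem_enum => eE; exact: compact_curve sE dE eE.
have c1 w : w \in enum W -> compact [set pos d w] by move=> _; exact: compact_set1.
apply: withinU_continuous.
- by apply: compact_closedP; exact: compact_fcup.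
- by apply: compact_closedP; exact: compact_fcup.
- by apply: within_fcup => // w _; exact: continuous_subspace1.
- apply: within_fcup => // e; rewrite mem_enum => eE.
  apply: (@subspace_eq_continuous _ _ _ (fun z => th e z + (k e)%:~R * (2 * pi))).
    by move=> z /set_mem ez; apply/esym; have [_ h0] := TP z; exact: h0.
  by apply: within_addc; have [] := thP e eE.
Qed.

Section one_drawing.
Variables (H : {set {set V}}) (d : drawing R V).
Hypotheses (sH : simple_graph H) (dH : plane_drawing H d).
Let X := pts [set: V]%SET H d.

Lemma closed_X : closed X.
Proof. by apply: compact_closedP; exact: compact_pts. Qed.

(** The vertices and the other edges form a compact set missed by the interior of [e]; with this set
    as [X'], [slide] moves an interior point to the end. *)
Lemma slide_edge e a p y : e \in H -> a \in e -> curve d e p ->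
  (forall w, p = pos d w -> w = a) -> visible X p y -> visible X (pos d a) y.
Proof.
move=> eH ae ep pa Apy; have [d1 d2 d3 d4] := dH.
have [b [g [ab eE ag [g0 g1] gE]]] := edge_arc sH dH eH ae.
have [E0|np] := eqVneq p (pos d a); first by rewrite -E0.
have := ep; rewrite gE => -[t]; rewrite seg01E => t01 tp.
have t0 : t != 0 by apply: contra_neq np => t0; rewrite -tp t0.
have t1 : t != 1.
  apply/eqP => t1; move/eqP : np; apply; rewrite -tp t1 g1.
  by have /pa -> : p = pos d b by rewrite -tp t1.
have XE : X = g @` (@seg01 R) `|` pts [set: V]%SET (H :\ e) d.
  rewrite -gE; apply/seteqP; split=> z.
    move=> [hw|[f fH fz]]; first by right; left.
    by have [E0|fe] := eqVneq f e; [left; rewrite -E0|right; right; exists f; rewrite // !inE fe].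
  move=> [ez|[hw|[f]]]; [by right; exists e|by left|].
  by rewrite !inE => /andP[_ fH] fz; right; exists f.
have interior_ (x : R) w : 0 < x < 1 -> g x <> pos d w.
  move=> x01 gw; have : w \in e.
    by apply: d3 => //; rewrite -gw gE; exists x => //; rewrite seg01E; lra.
  rewrite eE !inE => /orP[/eqP wE|/eqP wE]; move: gw; rewrite wE.
    by rewrite -g0 => /(arc_inj ag); lra.
  by rewrite -g1 => /(arc_inj ag); lra.
move: Apy; rewrite XE -tp -g0; apply: slide => //.
- apply: compact_pts; first by apply: simple_graphS sH; exact: subD1set.
  by apply: plane_drawingS dH; exact: subD1set.
- move=> x x01 [[w _]|[f]]; first exact: interior_.
  rewrite !inE => /andP[fe fH] fx.
  have ex : curve d e (g x) by rewrite gE; exists x => //; rewrite seg01E; lra.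
  have [w _ /esym] := d4 f e fH eH fe (g x) (conj fx ex).
  exact: interior_.
- by move: t01; rewrite lt_neqAle eq_sym t0 lt_neqAle t1.
Qed.

Lemma slide_edge2 e p y : e \in H -> curve d e p -> (forall w, p <> pos d w) ->
  visible X p y -> forall a, a \in e -> visible X (pos d a) y.
Proof. by move=> eH ep np Ap a ae; apply: (slide_edge eH ae ep _ Ap) => w /np. Qed.

(** The outer thirds of the edge are disjoint arcs and together do not separate the plane, so a path
    avoiding them leads from the middle third to the vertex [w]. It provides a point seeing the
    middle third and something off the outer thirds, hence different from both ends. *)
Lemma edge_face e : e \in H -> (exists w, w \notin e) ->
  exists y p, [/\ forall a, a \in e -> visible X (pos d a) y, pts [set: V]%SET (H :\ e) d p,
    (forall a, a \in e -> p <> pos d a) & visible X p y].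
Proof.
move=> eH [w we]; have [d1 d2 d3 d4] := dH.
have : e != finset.set0 by rewrite -card_gt0 (sH eH).
move=> /set0Pn[a ae].
have [b [g [ab eE ag [g0 g1] gE]]] := edge_arc sH dH eH ae.
pose A := g @` [set x : R | 3^-1 <= x <= 2 * 3^-1].
pose l1 x := g (0 + (3^-1 - 0) * x); pose l2 x := g (2 * 3^-1 + (1 - 2 * 3^-1) * x).
have al1 : jarc l1.
  by apply: arc_sub => //; [lra|lra|rewrite lt_eqF// invr_gt0 ltr0n].
have al2 : jarc l2.
  have l23 : 2 * 3^-1 < 1 :> R by lra.
  by apply: arc_sub => //; [lra|lra|rewrite lt_eqF].
have l1E : l1 @` (@seg01 R) = g @` [set x | 0 <= x <= 3^-1] by apply: sub_arc_img; lra.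
have l2E : l2 @` (@seg01 R) = g @` [set x | 2 * 3^-1 <= x <= 1] by apply: sub_arc_img; lra.
have mid (x : R) : 0 < x < 1 -> forall v, g x <> pos d v.
  move=> x01 v gv; have : v \in e.
    by apply: d3 => //; rewrite -gv gE; exists x => //; rewrite seg01E; lra.
  rewrite eE !inE => /orP[/eqP vE|/eqP vE]; move: gv; rewrite vE.
    by rewrite -g0 => /(arc_inj ag); lra.
  by rewrite -g1 => /(arc_inj ag); lra.
have ewpos : ~ curve d e (pos d w) by move=> /(d3 _ _ eH); rewrite (negbTE we).
pose B := pts [set: V]%SET (H :\ e) d.
pose Y := l1 @` (@seg01 R) `|` l2 @` (@seg01 R).
have Ye z : Y z -> curve d e z.
  rewrite gE /Y l1E l2E => -[[x /= xs <-]|[x /= xs <-]]; exists x => //; rewrite seg01E; lra.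
have lnk : linked (~` Y) (g 2^-1) (pos d w).
  apply: (janiszewski (arc_img al1) (arc_img al2) (c := g 0)).
  - rewrite l1E l2E => z [[x /= xs <-] [x' /= xs' /(arc_inj ag) E0]].
    by exfalso; move: E0; lra.
  - apply: arc_not_separate => //; rewrite ?l1E.
      by move=> [x /= xs /(arc_inj ag)]; lra.
    by rewrite -l1E => h; apply: ewpos; apply: Ye; left.
  - apply: arc_not_separate => //; rewrite ?l2E.
      by move=> [x /= xs /(arc_inj ag)]; lra.
    by rewrite -l2E => h; apply: ewpos; apply: Ye; right.
have [|||||||||y [p [q [[Ap Yp] [Bq Yq] accp accq]]]] := @between R X Y A B (g 2^-1) (pos d w).
- by apply: compact_closedP; apply: compact_sub_arc; exact: ag.1.
- apply: compact_closedP; apply: compact_pts; first by apply: simple_graphS sH; exact: subD1set.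
  by apply: plane_drawingS dH; exact: subD1set.
- move=> _ [x /= xs <-]; right; exists e => //; rewrite gE; exists x => //; rewrite seg01E; lra.
- by move=> z [hw|[f]]; [left|rewrite !inE => /andP[_ fH] fz; right; exists f].
- move=> z [[x /= xs xz]]; have x01 : 0 < x < 1 by lra.
  move=> [[v _ zv]|[f]]; first by case: (mid x x01 v); rewrite xz.
  rewrite !inE => /andP[fe fH] fz.
  have ez : curve d e z by rewrite gE; exists x => //; rewrite seg01E; lra.
  by have [v _ /esym] := d4 f e fH eH fe z (conj fz ez); rewrite -xz => /(mid x x01).
- move=> z [hw|[f fH fz]]; first by right; left; left.
  have [fe|fe] := eqVneq f e; last by right; left; right; exists f; rewrite // !inE fe.
  move: fz; rewrite fe gE => -[x]; rewrite seg01E => x01 xz.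
  have [h1|h1] := leP x 3^-1; first by right; right; left; rewrite l1E; exists x => //=; lra.
  have [h2|h2] := leP (2 * 3^-1) x; first by right; right; right; rewrite l2E; exists x => //=; lra.
  by left; exists x => //=; lra.
- exact: lnk.
- by exists 2^-1 => //=; lra.
- by left; exists w; rewrite // inE.
exists y, q; split=> //.
  move: Ap => [x /= xs xp]; apply: slide_edge2 accp => //.
    by rewrite gE; exists x => //; rewrite seg01E; lra.
  by rewrite -xp; apply: mid; lra.
move=> c; rewrite eE !inE => /orP[/eqP ->|/eqP ->] qc; apply: Yq; rewrite qc.
  by left; rewrite -g0 l1E; exists 0 => //=; lra.
by right; rewrite -g1 l2E; exists 1 => //=; lra.
Qed.

End one_drawing.

(** The two visibility arcs combine to an injective arc meeting the drawing only at its ends; the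
    missing edge could be drawn along it. *)
Lemma saturated_see G H d a b y : simple_graph G -> labeled_plane_saturated G H d ->
  [set a; b]%SET \in G -> visible (pts [set: V]%SET H d) (pos d a) y ->
  visible (pts [set: V]%SET H d) (pos d b) y -> [set a; b]%SET \in H.
Proof.
move=> sG [HG dH sat] eG [ka [aka ka0 ka1 kaX]] [kb [akb kb0 kb1 kbX]].
apply/negPn/negP => eH; set e := [set a; b]%SET in eG eH.
have [d1 d2 d3 d4] := dH.
have ab : a != b by have := sG e eG; rewrite cards2; case: eqP.
set X := pts _ _ _ in kaX kbX.
have Xpos w : X (pos d w) by left; exists w; rewrite // inE.
have [||g [ag g0 g1 gsub]] := arc_in_cat aka (arc_rev akb).
- by rewrite ka1 subr0 kb1.
- by rewrite ka0 subrr kb0 (inj_eq d1).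
rewrite ka0 in g0; rewrite subrr kb0 in g1.
have gX t : 0 <= t <= 1 -> X (g t) -> g t = pos d a \/ g t = pos d b.
  move=> t01 Xg; have : (g @` (@seg01 R)) (g t) by exists t; rewrite ?seg01E.
  rewrite arc_img_rev in gsub.
  move=> /gsub[[s + sE]|[s + sE]]; rewrite seg01E => s01.
    have [s0|s0] := eqVneq s 0; first by left; rewrite -sE s0.
    by case: (kaX s); [lra|rewrite sE].
  have [s0|s0] := eqVneq s 0; first by right; rewrite -sE s0.
  by case: (kbX s); [lra|rewrite sE].
pose A := g @` (@seg01 R).
have AX z : A z -> X z -> z = pos d a \/ z = pos d b.
  by move=> [t + <-]; rewrite seg01E => t01; exact: gX.
have Acur : simple_curve (pos d a) (pos d b) A by rewrite -g0 -g1; exact: arc_simple_curve.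
pose d' := Drawing (pos d) (fun f => if f == e then A else curve d f).
apply: (sat e); first by rewrite inE eH.
exists d'; split=> //; last first.
  by move=> f fH /=; rewrite ifN//; apply: contraNneq eH => <-.
have Aw w : A (pos d w) -> w \in e.
  by move=> /AX/(_ (Xpos w))[/d1 ->|/d1 ->]; rewrite !inE eqxx ?orbT.
have Af f z : f \in H -> A z -> curve d f z -> [set pos d w | w in [set` e :&: f]%SET] z.
  move=> fH Az fz; have [|zE|zE] := AX z Az; first by right; exists f.
    exists a => //=; rewrite !inE eqxx /=; apply: d3 => //; by rewrite -zE.
  exists b => //=; rewrite !inE eqxx orbT /=; apply: d3 => //; by rewrite -zE.
split=> /=.
- exact: d1.
- move=> x y' xy; case: ifPn => [/eqP E0|ne]; last first.
    by apply: d2; move: xy; rewrite !inE (negbTE ne).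
  have : x \in e by rewrite -E0 !inE eqxx.
  have : y' \in e by rewrite -E0 !inE eqxx orbT.
  have xny : x != y' by have := sG e eG; rewrite -E0 cards2; case: eqP.
  rewrite !inE => /orP[/eqP y1|/eqP y1] /orP[/eqP x1|/eqP x1]; move: xny; rewrite x1 y1 ?eqxx// => _.
  exact: simple_curve_rev.
- move=> f w; rewrite !inE; case: ifPn => [/eqP -> _|_ /= fH]; [exact: Aw|exact: d3].
- move=> f f'; rewrite !inE; case: (eqVneq f e) => [->|_]; case: (eqVneq f' e) => [->|_] /=.
  + by move=> _ _.
  + by move=> _ fH _ z [Az fz]; exact: Af.
  + by move=> fH _ _ z [fz Az]; rewrite finset.setIC; exact: Af.
  + exact: d4.
Qed.

End drawings.

(** * The path joined to two hubs *)

Section components.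
Implicit Types (q : pred nat) (i j l : nat).

(* Index of the component of i in the path 0 - 1 - 2 - ... with edges {l, l + 1}
   for q l. *)
Definition component q i := (\sum_(l < i) (~~ q l : nat))%N.

Lemma componentS q i : component q i.+1 = (component q i + ~~ q i)%N.
Proof. by rewrite /component big_ord_recr. Qed.

Lemma component_le q i j : (i <= j)%N -> (component q i <= component q j)%N.
Proof.
elim: j => [|j IH]; first by rewrite leqn0 => /eqP ->.
rewrite leq_eqVlt => /orP[/eqP ->//|]; rewrite ltnS => /IH ij.
by rewrite componentS (leq_trans ij)// leq_addr.
Qed.

Lemma component_eq q i j : (i <= j)%N -> component q i = component q j ->
  forall l, (i <= l < j)%N -> q l.
Proof.
move=> ij E l /andP[il lj]; have := component_le q il; have := component_le q lj.
by rewrite componentS -E; case: (q l) => //=; lia.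
Qed.

Lemma eq_component q i j : (i <= j)%N -> (forall l, (i <= l < j)%N -> q l) ->
  component q i = component q j.
Proof.
elim: j => [|j IH]; first by rewrite leqn0 => /eqP ->.
rewrite leq_eqVlt => /orP[/eqP ->//|]; rewrite ltnS => ij H.
rewrite componentS H ?ij ?leqnn// addn0; apply: IH => // l /andP[il lj].
by apply: H; rewrite il ltnW.
Qed.

Definition rem_edge q l : pred nat := fun k => q k && (k != l).

Lemma component_rem q l i j : component (rem_edge q l) i = component (rem_edge q l) j ->
  component q i = component q j.
Proof.
wlog ij : i j / (i <= j)%N.
  by move=> H E; case: (leqP i j) => [|/ltnW] h; [exact: H|apply/esym/H].
by move=> E; apply: eq_component => // k /(component_eq ij E)/andP[].
Qed.

Lemma component_rem_sep q i j : (i < j)%N -> component (rem_edge q i) i <> component (rem_edge q i) j.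
Proof.
move=> ij /(component_eq (ltnW ij))/(_ i); rewrite leqnn ij => /(_ isT).
by rewrite /rem_edge eqxx andbF.
Qed.

End components.

(** * Counting path edges and cross edges *)

Section count.
Variables (m : nat) (q : pred nat) (C : pred (bool * nat)) (w1 : nat).
Hypotheses (m3 : (3 <= m)%N) (w1m : (w1 < m)%N).
Hypothesis cover : forall i, (i < m)%N ->
  exists z j, [/\ (j < m)%N, C (z, j) & component q i = component q j].
Hypothesis Cw : C (true, w1) && C (false, w1).

(* Two cross edges ending in the same component must be the two at w. *)
Definition good (q' : pred nat) (C' : pred (bool * nat)) w :=
  forall c1 c2, C' c1 -> C' c2 -> c1 != c2 -> (c1.2 < m)%N -> (c2.2 < m)%N ->
    component q' c1.2 = component q' c2.2 -> c1.2 = w /\ c2.2 = w.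

Hypothesis cut_edge : forall l, q l -> good (rem_edge q l) C w1 ->
  (forall i, (i < m)%N -> C (true, i) && C (false, i)) \/
  [/\ C (true, l), C (false, l), C (true, l.+1) & C (false, l.+1)].
(** Since [m] is not the index of a path vertex, [good] with last argument [m] forbids two cross
    edges ending in the same component. *)
Hypothesis cut_hub :
  (forall z, good q (fun c => C c && (c.1 != z)) m) ->
  forall i, (i < m)%N -> C (true, i) && C (false, i).
Hypothesis qm : forall l, q l -> (l.+1 < m)%N.

(** The set [K] takes one cross edge per component and a second one at [w1]; at most one cross edge
    lies outside it. If there is none, or if it shares its path vertex with the edge chosen in its
    component, all cross edges of a component end in one vertex, and [cut_hub] applies. Otherwise a
    path edge separates the two vertices, and [cut_edge] applies. *)
Lemma count_contra :
  (#|[set i : 'I_m | q i]%SET| + #|[set c : bool * 'I_m | C (c.1, val c.2)]%SET| <= m + 2)%N ->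
  False.
Proof.
set Q := [set i : 'I_m | _]%SET; set Cr := [set c : bool * 'I_m | _]%SET => le2.
(* All [2 * m] cross edges exceed [m + 2] because [m] is at least 3. *)
have all_contra : (forall i, (i < m)%N -> C (true, i) && C (false, i)) -> False.
  move=> allC; have : Cr = [set: bool * 'I_m]%SET.
    apply/finset.setP => -[z i]; rewrite !inE /=.
    by have /andP[] := allC i (ltn_ord i); case: z.
  by move=> E; move: le2; rewrite E cardsT card_prod card_bool card_ord; lia.
(* First vertices of the components; every other vertex is the right end of a path edge. *)
pose L := [set i : 'I_m | (i == 0 :> nat) || ~~ q i.-1]%SET.
have mLQ : (m <= #|L| + #|Q|)%N.
  rewrite -[X in (X <= _)%N](card_ord m) -(cardsC L) leq_add2l.
  have predlt (i : 'I_m) : (i.-1 < m)%N by rewrite (leq_ltn_trans (leq_pred i)).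
  pose f i := Ordinal (predlt i).
  have inj : {in ~: L &, injective f}%SET.
    move=> i j; rewrite !inE !negb_or => /andP[i0 _] /andP[j0 _] /(congr1 val) /= E.
    by apply: val_inj => /=; move: i0 j0 E; lia.
  rewrite -(card_in_imset inj); apply: subset_leq_card; apply/fintype.subsetP => j.
  by move=> /imsetP[i]; rewrite !inE negb_or negbK => /andP[_ qi] ->.
have Linj (i j : 'I_m) : i \in L -> j \in L -> component q i = component q j -> i = j.
  have main (a b : 'I_m) : (a < b)%N -> b \in L -> component q a <> component q b.
    move=> ab; rewrite inE => /orP[/eqP b0|qb E]; first by rewrite b0 in ab.
    by move/negP: qb; apply; apply: (component_eq (ltnW ab) E); lia.
  move=> iL jL E; apply/eqP; rewrite -val_eqE /=; case: ltngtP => // h; exfalso.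
    exact: main h jL E.
  exact: main h iL (esym E).
have Lex (i : 'I_m) : exists2 j, j \in L & component q j = component q i.
  have [j /eqP jE jmin] := ex_minnP (ex_intro (fun k => component q k == component q i) _ (eqxx _)).
  have ji : (j <= i)%N by apply: jmin.
  have jm : (j < m)%N by rewrite (leq_ltn_trans ji).
  exists (Ordinal jm) => //; rewrite inE /=.
  case: j jE jmin {ji jm} => // j jE jmin; rewrite /=; apply/negP => qj.
  by have := jmin j; rewrite -jE componentS qj addn0 eqxx => /(_ isT); rewrite ltnn.
have /choice[c cP] : forall i : 'I_m, exists c : bool * 'I_m,
    [/\ C (c.1, val c.2), component q c.2 = component q i & component q i = component q w1 -> c = (true, Ordinal w1m)].
  move=> i; have [E|nE] := eqVneq (component q i) (component q w1).
    by exists (true, Ordinal w1m); split=> //=; case/andP: Cw.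
  have [z [j [jm Cj E]]] := cover (ltn_ord i).
  by exists (z, Ordinal jm); split=> // E'; rewrite E' eqxx in nE.
pose x1 : bool * 'I_m := (false, Ordinal w1m).
pose K := (x1 |: c @: L)%SET.
have cinj : {in L &, injective c}.
  move=> i j iL jL E; apply: Linj => //.
  by have [_ <- _] := cP i; have [_ <- _] := cP j; rewrite E.
have x1K : x1 \notin (c @: L)%SET.
  apply/negP => /imsetP[i iL E]; have [_ ci h] := cP i.
  by have := h _; rewrite -E -ci -E /= => /(_ erefl).
have KC : K \subset Cr.
  apply/fintype.subsetP => x; rewrite !inE => /orP[/eqP ->|/imsetP[i iL ->]] /=.
    by case/andP: Cw.
  by have [] := cP i.
have cardK : #|K| = #|L|.+1 by rewrite cardsU1 x1K (card_in_imset cinj) add1n.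
have Kgood x y : x \in K -> y \in K -> x != y -> component q x.2 = component q y.2 ->
    val x.2 = w1 /\ val y.2 = w1.
  rewrite !inE => /orP[/eqP ->|/imsetP[i iL ->]] /orP[/eqP ->|/imsetP[j jL ->]].
  - by rewrite eqxx.
  - by have [_ cj h] := cP j; move=> _ /= E; rewrite h// -cj -E.
  - by have [_ ci h] := cP i; move=> _ /= E; rewrite h// -ci E.
  - have [_ ci _] := cP i; have [_ cj _] := cP j; rewrite ci cj => ne /(Linj _ _ iL jL) E.
    by rewrite E eqxx in ne.
have ordC (x : bool * nat) : C x -> (x.2 < m)%N -> exists2 y, y \in Cr & x = (y.1, val y.2).
  by case: x => z i Cx im; exists (z, Ordinal im); rewrite ?inE.
have : (#|Cr :\: K| <= 1)%N.
  have ar (a b k : nat) : (m <= a + b)%N -> (b + (a.+1 + k) <= m + 2)%N -> (k <= 1)%N by lia.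
  have H2 : Cr :&: K = K by apply/finset.setIidPr.
  have H1 := cardsID K Cr; rewrite H2 cardK in H1.
  by apply: (ar #|L| #|Q|) => //; rewrite H1.
rewrite leq_eqVlt ltnS leqn0 => /orP[/cards1P[[z0 p] CrK]|/eqP/cards0_eq CrK]; last first.
  apply: all_contra; apply: cut_hub => z x y /andP[Cx xz] /andP[Cy yz] xy xm ym E.
  have CrsubK u : u \in Cr -> u \in K.
    move=> uC; apply: contraT => uK; have : u \in (Cr :\: K)%SET.
      by rewrite finset.in_setD uK uC.
    by rewrite CrK inE.
  have [x' /CrsubK x'K xE] := ordC _ Cx xm; have [y' /CrsubK y'K yE] := ordC _ Cy ym.
  have x'y' : x' != y' by apply: contraNneq xy => E'; rewrite xE yE E'.
  exfalso; have [|h1 h2] := Kgood x' y' x'K y'K x'y'; first by move: E; rewrite xE yE.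
  move: x'y' xz yz; rewrite xE yE /=; case: (x') h1 => a b /= h1; case: (y') h2 => a' b' /= h2.
  have -> : b = b' by apply: val_inj; rewrite /= h1 h2.
  by case: a; case: a'; case: z; rewrite ?eqxx.
have /setDP[e0C e0K] : (z0, p) \in (Cr :\: K)%SET by rewrite CrK set11.
have CrE u : u \in Cr -> u = (z0, p) \/ u \in K.
  move=> uC; have [uK|uK] := boolP (u \in K); first by right.
  by left; apply/set1P; rewrite -CrK finset.in_setD uK.
have [i0 i0L i0E] := Lex p.
case cE0 : (c i0) (cP i0) => [z' p'] [/= Cc0 cE cw].
have KD u : u \in K -> component q u.2 = component q p -> u.2 = p' /\ (u = (z', p') \/ u = x1).
  rewrite !inE => /orP[/eqP ->|/imsetP[i iL ->]] /= E.
    split; last by right.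
    have := cw _; rewrite i0E -E => /(_ erefl) [_ ->] //.
  have [_ ci _] := cP i; rewrite ci in E.
  have -> : i = i0 by apply: Linj => //; rewrite E i0E.
  by rewrite cE0; split=> //; left.
have [pp|pp] := eqVneq p p'.
  have zz : z0 != z'.
    apply: contraNneq e0K => E; rewrite E pp -cE0 !inE; apply/orP; right.
    exact: imset_f.
  apply: all_contra; apply: cut_hub => z x y /andP[Cx xz] /andP[Cy yz] xy xm ym E.
  have [x' x'C xE] := ordC _ Cx xm; have [y' y'C yE] := ordC _ Cy ym.
  have x'y' : x' != y' by apply: contraNneq xy => E'; rewrite xE yE E'.
  have {}E : component q x'.2 = component q y'.2 by move: E; rewrite xE yE.
  have same (u v : bool * 'I_m) : u.1 != z -> v.1 != z -> u != v -> val u.2 = val v.2 -> False.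
    case: u => a b; case: v => a' b' /= az a'z ne bb; move: ne.
    have -> : b = b' by exact: val_inj.
    by case: a az; case: a' a'z; case: z {xz yz} => //=; rewrite ?eqxx.
  rewrite xE /= in xz; rewrite yE /= in yz; exfalso.
  have [x'E|x'K] := CrE _ x'C; have [y'E|y'K] := CrE _ y'C.
  - by rewrite x'E y'E eqxx in x'y'.
  - have [|h _] := KD _ y'K; first by rewrite -E x'E.
    by apply: (same x' y') => //; rewrite h x'E /= pp.
  - have [|h _] := KD _ x'K; first by rewrite E y'E.
    by apply: (same x' y') => //; rewrite h y'E /= pp.
  - by have [h1 h2] := Kgood _ _ x'K y'K x'y' E; apply: (same x' y') => //; rewrite h1 h2.
(* The path edge leaving the smaller of [p] and [p'] lies between them; removing it separates the
   extra cross edge from those of [K] in its component. *)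
pose l := minn p p'.
have lp : (l < maxn p p')%N.
  by rewrite /l; move: pp; rewrite -val_eqE /=; lia.
have compl : component q l = component q (maxn p p').
  rewrite /l; have E : component q p = component q p' by rewrite -i0E -cE.
  by rewrite /minn /maxn; case: ltnP.
have ql : q l by apply: (component_eq (ltnW lp) compl); rewrite leqnn lp.
have lcomp : component q l = component q p.
  by rewrite /l /minn; case: ifP => // _; rewrite cE i0E.
have sep : component (rem_edge q l) p <> component (rem_edge q l) p'.
  have := component_rem_sep (q := q) lp; rewrite /l /minn /maxn.
  by case: ltnP => _ // h1 h2; apply: h1.
have [|all|[h1 h2 h3 h4]] := cut_edge ql; last 2 first.
- exact: all_contra.
- have lm := qm ql; have lm' := ltnW lm.
  have compl1 : component q l.+1 = component q p by rewrite componentS ql addn0.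
  (* Four cross edges in a component that has at most three: the extra one, the chosen one and
     [x1]. *)
  pose S : seq (bool * 'I_m) :=
    [:: (true, Ordinal lm'); (false, Ordinal lm'); (true, Ordinal lm); (false, Ordinal lm)].
  have uS : uniq S.
    rewrite /S /= !inE !xpair_eqE /= -!val_eqE /=.
    by rewrite (ltn_eqF (ltnSn l)).
  have : {subset S <= [:: (z0, p); (z', p'); x1]}.
    move=> u uS'; have [uC uE] : u \in Cr /\ component q u.2 = component q p.
      by move: uS'; rewrite !inE => /orP[|/orP[|/orP[]]] /eqP -> /=.
    have [->|uK] := CrE _ uC; first by rewrite !inE eqxx.
    by have [_ [->|->]] := KD _ uK uE; rewrite !inE eqxx ?orbT.
  by move/(uniq_leq_size uS).
move=> x y Cx Cy xy xm ym E.
have [x' x'C xE] := ordC _ Cx xm; have [y' y'C yE] := ordC _ Cy ym.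
have x'y' : x' != y' by apply: contraNneq xy => E'; rewrite xE yE E'.
rewrite xE yE /= in E *; have qE := component_rem E.
have [x'E|x'K] := CrE _ x'C; have [y'E|y'K] := CrE _ y'C.
- by rewrite x'E y'E eqxx in x'y'.
- have [|h _] := KD _ y'K; first by rewrite -qE x'E.
  by case: sep; move: E; rewrite h x'E.
- have [|h _] := KD _ x'K; first by rewrite qE y'E.
  by case: sep; move: E; rewrite h y'E.
- exact: Kgood.
Qed.

End count.

(** * Potentials on forests *)

Section solver.
Variables (m : nat) (q : pred nat) (C : pred (bool * nat)) (w : nat).

Definition pv (i : nat) : 'I_m.+2 := inord i.
Definition hub (z : bool) : 'I_m.+2 := if z then pv m else pv m.+1.

Lemma pvE i : (i < m.+2)%N -> (pv i : nat) = i.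
Proof. by move=> im; rewrite /pv inordK. Qed.

Lemma pv_val (x : 'I_m.+2) : pv x = x.
Proof. exact: inord_val. Qed.

Lemma hubE z : (hub z : nat) = if z then m else m.+1.
Proof. by case: z; rewrite /hub pvE. Qed.

(** Under [good] the edges form a forest: a path component carries at most one cross edge, except
    that of [w], which may be attached once to each hub. A potential is therefore built from sums
    along the path, a constant per component and a constant per hub. *)
Lemma solver (E : {set {set 'I_m.+2}}) :
  (forall e, e \in E ->
    (exists l, [/\ (l.+1 < m)%N, q l & e = [set pv l; pv l.+1]%SET]) \/
    (exists z i, [/\ (i < m)%N, C (z, i) & e = [set hub z; pv i]%SET])) ->
  good m q C w -> solvable E.
Proof.
move=> EP gd f.
(* Sums along the whole path serve inside every component; a jump across an absent edge is absorbed
   by [ka]. *)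
pose s i : int := \sum_(l < i) (f [set pv l; pv l.+1]%SET (pv l.+1) - f [set pv l; pv l.+1]%SET (pv l)).
pose ve (c : bool * nat) : int :=
  f [set hub c.1; pv c.2]%SET (pv c.2) - f [set hub c.1; pv c.2]%SET (hub c.1).
(* If both cross edges at [w] are present, they force the difference between the hubs; otherwise it
   is free, and 0 is taken. *)
pose hv (z : bool) : int :=
  if z then 0 else if C (true, w) && C (false, w) then ve (true, w) - ve (false, w) else 0.
have /choice[ka kaP] : forall k, exists ka : int, forall c, C c -> (c.2 < m)%N -> component q c.2 = k ->
    ka = ve c + hv c.1 - s c.2.
  move=> k; have [[c0 [C0 m0 k0]]|N] := pselect (exists c, [/\ C c, (c.2 < m)%N & component q c.2 = k]);
    last by exists 0 => c Cc cm ck; case: N; exists c.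
  exists (ve c0 + hv c0.1 - s c0.2) => c Cc cm ck.
  have [->//|ne] := eqVneq c0 c.
  have [] := gd c0 c C0 Cc ne m0 cm; first by rewrite k0 ck.
  case: c0 C0 {m0 k0} ne => a b C0 ne /= b0; case: c Cc {cm ck} ne => a' b' Cc ne /= b'0.
  move: C0 Cc ne; rewrite b0 b'0 /hv => C0 Cc.
  by case: a C0; case: a' Cc => C1 C2; rewrite ?eqxx// C1 C2 /= => _; ring.
pose h (x : 'I_m.+2) : int :=
  if (x < m)%N then s x + ka (component q x) else hv (x == m :> nat).
have hp i : (i < m)%N -> h (pv i) = s i + ka (component q i).
  by move=> im; rewrite /h !pvE ?im//; lia.
have hh z : h (hub z) = hv z.
  rewrite /h hubE; case: z; first by rewrite ltnn eqxx.
  have -> : (m.+1 < m)%N = false by lia.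
  by have -> : (m.+1 == m) = false by lia.
exists h.
have /choice[k kP] : forall e, exists k : int, e \in E -> forall a, a \in e -> h a = f e a + k.
  move=> e; have [eE|] := boolP (e \in E); last by exists 0.
  have [[l [lm ql eE']]|[z [i [im Cz eE']]]] := EP e eE.
    exists (h (pv l) - f e (pv l)) => _ a; rewrite {1}eE' !inE => /orP[/eqP ->|/eqP ->].
      by rewrite addrC subrK.
    rewrite !hp ?(ltnW lm)// componentS ql addn0 eE' /s big_ord_recr /=; ring.
  exists (h (hub z) - f e (hub z)) => _ a; rewrite {1}eE' !inE => /orP[/eqP ->|/eqP ->].
    by rewrite addrC subrK.
  by rewrite hp// hh (kaP _ (z, i) Cz im erefl) eE' /ve /=; ring.
by exists k => e a eE; exact: kP.
Qed.

End solver.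

Arguments hub : simpl never.

(** * The extremal graph *)

Section graph.
Variable m : nat.
Local Notation pv := (pv m).
Local Notation hub := (hub m).

Definition uv : {set 'I_m.+2} := [set hub true; hub false]%SET.

(* The path pv 0 - ... - pv (m - 1) joined to the two adjacent hubs. *)
Definition double_fan : {set {set 'I_m.+2}} :=
  [set e : {set 'I_m.+2} | [exists i : 'I_m.+2, exists j : 'I_m.+2,
     [&& (i < j)%N, (j == i.+1 :> nat) || (m <= j)%N & e == [set i; j]%SET]]]%SET.

Lemma double_fanP e : reflect (exists i j : 'I_m.+2,
   [/\ (i < j)%N, (j == i.+1 :> nat) || (m <= j)%N & e = [set i; j]%SET]) (e \in double_fan).
Proof.
rewrite inE; apply: (iffP existsP) => [[i /existsP[j /and3P[h1 h2 /eqP h3]]]|[i [j [h1 h2 h3]]]].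
  by exists i, j.
by exists i; apply/existsP; exists j; rewrite h1 h2 h3 eqxx.
Qed.

Lemma simple_double_fan : simple_graph double_fan.
Proof.
move=> e /double_fanP[i [j [ij _ ->]]]; rewrite cards2.
by case: eqP => // E; rewrite E ltnn in ij.
Qed.

Lemma hub_neq : hub true != hub false.
Proof.
by apply/eqP => /(congr1 (@nat_of_ord _)); rewrite !hubE; lia.
Qed.

Lemma hub_ge z : (m <= hub z)%N.
Proof. by rewrite hubE; case: z. Qed.

Lemma vertexP (x : 'I_m.+2) : (x < m)%N \/ exists z, x = hub z.
Proof.
have [|mx] := ltnP x m; [by left|right].
have := ltn_ord x; rewrite ltnS leq_eqVlt => /orP[/eqP xE|xm].
  by exists false; apply: ord_inj; rewrite hubE xE.
by exists true; apply: ord_inj; rewrite hubE; apply/eqP; rewrite eqn_leq mx andbT -ltnS.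
Qed.

Lemma hub_path z i : (i < m)%N -> hub z != pv i.
Proof.
by move=> im; apply/eqP => /(congr1 (@nat_of_ord _)); rewrite hubE pvE; case: z; lia.
Qed.

Lemma double_fan_cases e : e \in double_fan -> [\/ e = uv,
  exists z i, (i < m)%N /\ e = [set hub z; pv i]%SET |
  exists l, (l.+1 < m)%N /\ e = [set pv l; pv l.+1]%SET].
Proof.
move=> /double_fanP[i [j [ij adj ->]]].
have [im|[z iz]] := vertexP i; have [jm|[z' jz]] := vertexP j.
- apply: Or33; exists i; move: adj; rewrite leqNgt jm orbF => /eqP jE.
  by rewrite -jE !pv_val jm.
- by apply: Or32; exists z', i; rewrite jz pv_val finset.setUC.
- by have := hub_ge z; rewrite -iz; lia.
- apply: Or31; move: ij; rewrite iz jz /uv !hubE.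
  by case: z {iz}; case: z' {jz}; rewrite ?ltnn// ltnNge leqnSn.
Qed.

Lemma uv_double_fan : uv \in double_fan.
Proof. by apply/double_fanP; exists (hub true), (hub false); rewrite !hubE leqnSn orbT ltnSn. Qed.

Lemma cross_double_fan z i : (i < m)%N -> [set hub z; pv i]%SET \in double_fan.
Proof.
move=> im; apply/double_fanP; exists (pv i), (hub z); rewrite pvE; last by lia.
by rewrite hub_ge orbT finset.setUC (leq_trans im (hub_ge z)).
Qed.

Lemma path_double_fan l : (l.+1 < m)%N -> [set pv l; pv l.+1]%SET \in double_fan.
Proof. by move=> lm; apply/double_fanP; exists (pv l), (pv l.+1); rewrite !pvE ?eqxx ?ltnSn //; lia. Qed.

Lemma hub_notin_path z l : (l.+1 < m)%N -> hub z \notin [set pv l; pv l.+1]%SET.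
Proof. by move=> lm; rewrite !inE negb_or !hub_path// ltnW. Qed.

Lemma path_notin_uv i : (i < m)%N -> pv i \notin uv.
Proof. by move=> im; rewrite !inE negb_or ![pv i == _]eq_sym !hub_path. Qed.

End graph.

(** * Visibility past a nonseparating part *)

Section seeing.
Variables (R : realType) (V : finType) (H : {set {set V}}) (d : drawing R V).
Hypotheses (sH : simple_graph H) (dH : plane_drawing H d).
Local Notation P := (R * R)%type.
Let X := pts [set: V]%SET H d.

Lemma closed_pts (W : {set V}) (E : {set {set V}}) : E \subset H -> closed (pts W E d).
Proof.
move=> EH; apply: compact_closedP; apply: compact_pts; first exact: simple_graphS sH.
exact: plane_drawingS dH.
Qed.

Lemma pts_sub (W : {set V}) (E : {set {set V}}) : E \subset H -> pts W E d `<=` X.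
Proof.
move=> /fintype.subsetP EH z [[w _ ->]|[e /EH eH ez]]; first by left; exists w; rewrite ?inE.
by right; exists e.
Qed.

Definition vin (W : {set V}) (E : {set {set V}}) (w : V) :=
  w \in W \/ exists2 e, e \in E & w \in e.

(** An edge is seen through its ends, because visibility of an inner point slides to them. The
    vertices in [U] belong to the nonseparating part and do not count. *)
Definition seen (U W : {set V}) (E : {set {set V}}) (y : P) :=
  (exists w, [/\ w \notin U, vin W E w & visible X (pos d w) y]) \/
  (exists2 e, e \in E & forall w, w \in e -> visible X (pos d w) y).

Lemma pts_vertex (W : {set V}) (E : {set {set V}}) w : E \subset H ->
  pts W E d (pos d w) -> vin W E w.
Proof.
have [d1 _ d3 _] := dH.
move=> /fintype.subsetP EH [[w' w'W /d1 ->]|[e eE ew]]; [by left|right].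
by exists e => //; apply: d3 ew; exact: EH.
Qed.

Lemma seenP (U W : {set V}) (E F : {set {set V}}) p y : E \subset H ->
  pts W E d p -> ~ pts U F d p -> visible X p y -> seen U W E y.
Proof.
move=> EH Ap Up acc; have [[w pw]|nv] := pselect (exists w, p = pos d w).
  left; exists w; split; last by rewrite -pw.
    by apply/negP => wU; apply: Up; left; exists w.
  by apply: (pts_vertex EH); rewrite -pw.
case: Ap => [[w _ pw]|[e eE ep]]; first by case: nv; exists w.
right; exists e => //; apply: slide_edge2 acc => //; first exact: (fintype.subsetP EH).
by move=> w pw; apply: nv; exists w.
Qed.

(** The drawing is divided into a nonseparating part, given by [W] and [E], and two parts that meet
    only inside it; [between] then yields a point seeing both parts away from it. *)
Lemma split_see (W WA WB : {set V}) (E EA EB : {set {set V}}) p q :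
  E \subset H -> EA \subset H -> EB \subset H -> solvable E ->
  (forall e, e \in E -> e \subset W) ->
  (forall w, [|| w \in W, w \in WA | w \in WB]) ->
  (forall e, e \in H -> [|| e \in E, e \in EA | e \in EB]) ->
  (forall e, e \in EA -> e \notin EB) ->
  (forall w, vin WA EA w -> vin WB EB w -> w \in W) ->
  pts WA EA d p -> ~ pts W E d p -> pts WB EB d q -> ~ pts W E d q ->
  exists y, seen W WA EA y /\ seen W WB EB y.
Proof.
move=> EH EAH EBH solE EW Wc Ec EAB WAB Ap Yp Bq Yq.
have [_ _ d3 d4] := dH.
have [|||||||||y [a [b [[Aa Ya] [Bb Yb] acca accb]]]] :=
  @between R X (pts W E d) (pts WA EA d) (pts WB EB d) p q.
- exact: closed_pts.
- exact: closed_pts.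
- exact: pts_sub.
- exact: pts_sub.
- move=> z [Az Bz]; have vert w : z = pos d w -> pts W E d z.
    move=> zw; left; exists w => //; rewrite zw in Az Bz.
    by apply: WAB; [exact: pts_vertex Az|exact: pts_vertex Bz].
  case: Az Bz => [[w _ /vert //]|[e eA ez]] [[w _ /vert //]|[f fB fz]].
  have ef : e != f by apply: contraTneq fB => <-; exact: EAB.
  have [] := d4 _ _ (fintype.subsetP EAH e eA) (fintype.subsetP EBH f fB) ef z (conj ez fz).
  by move=> w _ /esym/vert.
- move=> z [[w _ zw]|[e eH ez]].
    have /or3P[wW|wA|wB] := Wc w; [right; right|left|right; left]; left; exists w => //.
  have /or3P[wW|wA|wB] := Ec e eH; [right; right|left|right; left]; right; exists e => //.
- apply: nonsep => //; [exact: simple_graphS sH|exact: plane_drawingS dH].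
- by [].
- by [].
by exists y; split; [exact: (seenP EAH Aa Ya acca)|exact: (seenP EBH Bb Yb accb)].
Qed.

(** A path off the nonseparating part leads from [y] to [q]; the first point of the drawing on it is
    visible from [y] and lies outside that part. *)
Lemma hit_see (W : {set V}) (E : {set {set V}}) y q : E \subset H -> solvable E ->
  (forall e, e \in E -> e \subset W) -> X q -> ~ pts W E d q -> ~ X y ->
  (exists2 w, w \notin W & visible X (pos d w) y) \/
  (exists e, [/\ e \in H, e \notin E & forall w, w \in e -> visible X (pos d w) y]).
Proof.
move=> EH solE EW Xq Yq Xy.
have [||p [Xp Yp acc]] := @hit R X (pts W E d) y q (closed_X sH dH) Xy.
- apply: nonsep => //; [exact: simple_graphS sH|exact: plane_drawingS dH|].
  by move=> /(pts_sub EH).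
- by [].
have [[w pw]|nv] := pselect (exists w, p = pos d w).
  left; exists w; last by rewrite -pw.
  by apply/negP => wW; apply: Yp; left; exists w.
case: Xp => [[w _ pw]|[e eH ep]]; first by case: nv; exists w.
right; exists e; split=> //; first by apply/negP => eE; apply: Yp; right; exists e.
by apply: slide_edge2 acc => // w pw; apply: nv; exists w.
Qed.

Lemma inner_point e : e \in H ->
  exists p, curve d e p /\ forall (W : {set V}) (E : {set {set V}}), E \subset H -> e \notin E -> ~ pts W E d p.
Proof.
move=> eH; have [_ _ d3 d4] := dH.
have : e != finset.set0 by rewrite -card_gt0 (sH eH).
move=> /set0Pn[a ae].
have [b [g [ab eE ag [g0 g1] gE]]] := edge_arc sH dH eH ae.
have s2 : seg01 (2^-1 : R) by rewrite seg01E; lra.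
have ep : curve d e (g 2^-1) by rewrite gE; exists 2^-1.
have nv w : g 2^-1 <> pos d w.
  move=> gw; have : w \in e by apply: d3 => //; rewrite -gw.
  rewrite eE !inE => /orP[/eqP wE|/eqP wE]; move: gw; rewrite wE.
    by rewrite -g0 => /(arc_inj ag); lra.
  by rewrite -g1 => /(arc_inj ag); lra.
exists (g 2^-1); split=> // W E EH eE' [[w _ /nv //]|[f fE fp]].
have ef : e != f by apply: contraNneq eE' => ->.
have [w _ /esym/nv //] := d4 _ _ eH (fintype.subsetP EH f fE) ef _ (conj ep fp).
Qed.

End seeing.

(** * Saturated drawings *)

Section lower.
Variables (R : realType) (m : nat).
Hypothesis m3 : (3 <= m)%N.
Local Notation P := (R * R)%type.
Local Notation pv := (pv m).
Local Notation hub := (hub m).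
Local Notation uv := (uv m).
Variables (H : {set {set 'I_m.+2}}) (d : drawing R 'I_m.+2).
Hypothesis sat : labeled_plane_saturated (double_fan m) H d.
Let X := pts [set: 'I_m.+2]%SET H d.

Let HG : H \subset double_fan m. Proof. by case: sat. Qed.
Let dH : plane_drawing H d. Proof. by case: sat. Qed.
Let sH : simple_graph H. Proof. exact: simple_graphS HG (@simple_double_fan m). Qed.

Let see a b y : [set a; b]%SET \in double_fan m -> visible X (pos d a) y -> visible X (pos d b) y ->
  [set a; b]%SET \in H.
Proof. by move=> eG Aa Ab; apply: saturated_see sat eG Aa Ab; exact: simple_double_fan. Qed.

Let Hcases e : e \in H -> [\/ e = uv,
  exists z i, (i < m)%N /\ e = [set hub z; pv i]%SET |
  exists l, (l.+1 < m)%N /\ e = [set pv l; pv l.+1]%SET].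
Proof. by move=> eH; apply: double_fan_cases; exact: (fintype.subsetP HG). Qed.

Definition pedge (l : nat) : bool := (l.+1 < m)%N && ([set pv l; pv l.+1]%SET \in H).
Definition cross (c : bool * nat) : bool := [set hub c.1; pv c.2]%SET \in H.

Let subH (p : pred {set 'I_m.+2}) : [set e in H | p e]%SET \subset H.
Proof. by apply/fintype.subsetP => e; rewrite inE => /andP[]. Qed.

Let solvable_paths (E : {set {set 'I_m.+2}}) : E \subset H ->
  (forall e z, e \in E -> hub z \notin e) -> solvable E.
Proof.
move=> /fintype.subsetP EH noh; apply: (@solver m predT pred0 0) => // e eE; left.
have [eu|[z [i [im ee]]]|[l [lm ->]]] := Hcases (EH e eE).
- by have := noh e true eE; rewrite eu !inE eqxx.
- by have := noh e z eE; rewrite ee !inE eqxx.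
- by exists l.
Qed.

Let sub_path (e : {set 'I_m.+2}) : e \in H -> (forall z, hub z \notin e) ->
  exists l, [/\ pedge l, (l.+1 < m)%N & e = [set pv l; pv l.+1]%SET].
Proof.
move=> eH he; have [eu|[z [i [im ee]]]|[l [lm ee]]] := Hcases eH.
- by have := he true; rewrite eu !inE eqxx.
- by have := he z; rewrite ee !inE eqxx.
- by exists l; rewrite /pedge lm -ee.
Qed.

(** Without the hub edge no edge contains both hubs, so their stars meet only in path vertices, and
    the remaining path edges form a forest. Some point then sees both hubs. *)
Lemma uv_in : uv \in H.
Proof.
apply/negPn/negP => nuv.
pose W := [set x : 'I_m.+2 | (x < m)%N]%SET.
pose E := [set e in H | [forall z, hub z \notin e]]%SET.
pose Eh z := [set e in H | hub z \in e]%SET.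
have EP e z : e \in E -> hub z \notin e by rewrite inE => /andP[_ /forallP].
have EH : E \subset H by exact: subH.
have one_hub e z : e \in H -> hub z \in e -> hub (~~ z) \in e -> False.
  move=> eH he he'; case/negP: nuv; suff -> : uv = e by [].
  apply/eqP; rewrite eqEcard (sH eH) /uv cards2 hub_neq andbT.
  by apply/fintype.subsetP => x; rewrite !inE => /orP[/eqP ->|/eqP ->]; case: z he he'.
have hubW z : hub z \notin W by rewrite inE -leqNgt hub_ge.
have hubY z : ~ pts W E d (pos d (hub z)).
  move=> /(pts_vertex dH EH)[|[e /EP h]]; [exact/negP/hubW|exact/negP/h].
have hseen z y : seen H d W [set hub z]%SET (Eh z) y -> visible X (pos d (hub z)) y.
  move=> [[w [wW vw acc]]|[e]]; last by rewrite inE => /andP[_ he]; apply.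
  have [wm|[z' wz]] := vertexP w; first by rewrite inE wm in wW.
  have [<-|zz] := eqVneq z' z; first by rewrite -wz.
  have z'E : z' = ~~ z by case: z' z zz {vw wz} => [] [].
  case: vw => [|[e]]; rewrite !inE wz; first by move=> /eqP <-; rewrite -wz.
  by move=> /andP[eH he]; rewrite z'E => /(one_hub e z eH he).
have [||||||||y [/hseen s1 /hseen s2]] := @split_see R _ H d sH dH W [set hub true]%SET
  [set hub false]%SET E (Eh true) (Eh false) (pos d (hub true)) (pos d (hub false)) EH
  (subH _) (subH _) _ _ _ _ _ _ _ (hubY true) _ (hubY false); last first.
- by case/negP: nuv; apply: see s1 s2; exact: uv_double_fan.
- by left; exists (hub false); rewrite ?inE.
- by left; exists (hub true); rewrite ?inE.
- move=> w v1 v2; have [wm|[z wz]] := vertexP w; first by rewrite inE.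
  have [] : False; move: v1 v2; rewrite wz.
  have hE z1 : vin [set hub z1]%SET (Eh z1) (hub z) -> z1 = z.
    move=> [/set1P/(congr1 (@nat_of_ord _))|[e /setIdP[eH he] ze]].
      by rewrite !hubE; case: z {wz}; case: z1; lia.
    have [//|zz] := eqVneq z1 z; have zE : z = ~~ z1 by case: z z1 zz {wz he ze} => [] [].
    by move: ze; rewrite zE => /(one_hub e z1 eH he).
  by move=> /hE E1 /hE; rewrite -E1.
- by move=> e; rewrite !inE => /andP[eH he]; apply/negP => /andP[_ hf]; apply: (one_hub e true).
- move=> e eH; rewrite !inE eH /=; case: (boolP (hub true \in e)) => ht; first by rewrite orbT.
  case: (boolP (hub false \in e)) => hf; first by rewrite !orbT.
  by rewrite !orbF; apply/forallP; case.
- by move=> w; have [wm|[[] ->]] := vertexP w; rewrite !inE ?wm ?eqxx ?orbT.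
- move=> e eE; apply/fintype.subsetP => x xe; rewrite inE.
  by have [//|[z xz]] := vertexP x; have := EP e z eE; rewrite -xz xe.
- by apply: solvable_paths EH _ => e z; exact: EP.
Qed.

Lemma path_comp (e : {set 'I_m.+2}) (i : nat) : e \in H -> (forall z, hub z \notin e) ->
  forall x y, x \in e -> y \in e -> component pedge x = component pedge i -> component pedge y = component pedge i.
Proof.
move=> eH he; have [l [pl lm ->]] := sub_path eH he; have lm' := ltnW lm.
move=> x y; rewrite !inE => /orP[/eqP ->|/eqP ->] /orP[/eqP ->|/eqP ->];
  rewrite !pvE ?componentS ?pl ?addn0 //; lia.
Qed.

(** Otherwise the hubs with all their edges and the component [D] of [i] are two parts that do not
    touch, and the other path components, a forest, do not separate them. A point seeing a hub and a
    vertex of [D] forces the excluded edge. *)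
Lemma cover i : (i < m)%N -> exists z j, [/\ (j < m)%N, cross (z, j) & component pedge i = component pedge j].
Proof.
move=> im; apply: contrapT => none.
pose D := [set x : 'I_m.+2 | (x < m)%N && (component pedge x == component pedge i)]%SET.
pose W := [set x : 'I_m.+2 | (x < m)%N & x \notin D]%SET.
pose Hb := [set x : 'I_m.+2 | (m <= x)%N]%SET.
pose EA := [set e in H | [exists z, hub z \in e]]%SET.
pose E := [set e in H | (e \notin EA) && (e \subset W)]%SET.
pose EB := [set e in H | (e \notin EA) && (e \subset D)]%SET.
have EH : E \subset H by exact: subH.
have EAH : EA \subset H by exact: subH.
have EBH : EB \subset H by exact: subH.
have noEA e : e \in H -> e \notin EA -> forall z, hub z \notin e.
  by move=> eH; rewrite inE eH /= negb_exists => /forallP.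
have EAD e x : e \in EA -> x \in e -> x \in D -> False.
  rewrite inE => /andP[eH /existsP[z he]] xe; rewrite inE => /andP[xm /eqP xi].
  apply: none; exists z, x; split=> //; rewrite /cross /= pv_val.
  suff -> : [set hub z; x]%SET = e by [].
  apply/eqP; rewrite eqEcard (sH eH) cards2 -(pv_val x) hub_path// andbT.
  by apply/fintype.subsetP => w; rewrite !inE => /orP[/eqP ->|/eqP ->] //; rewrite pv_val.
have hubD z : hub z \notin D by rewrite inE negb_and -leqNgt hub_ge.
have iD : pv i \in D by rewrite inE pvE ?im ?eqxx//; lia.
have sA y : seen H d W Hb EA y -> exists z, visible X (pos d (hub z)) y.
  move=> [[w [wW vw acc]]|[e]]; last by rewrite inE => /andP[_ /existsP[z he]] h; exists z; apply: h.
  have [wm|[z wz]] := vertexP w; last by exists z; rewrite -wz.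
  move: wW; rewrite inE wm /= negbK => wD.
  by case: vw => [|[e eA we]]; [rewrite inE leqNgt wm|case: (EAD e w)].
have sB y : seen H d W D EB y -> exists2 w, w \in D & visible X (pos d w) y.
  move=> [[w [wW vw acc]]|[e]].
    exists w => //; case: vw => [//|[e]]; rewrite inE => /and3P[_ _ /fintype.subsetP]; exact.
  rewrite inE => /and3P[eH _ /fintype.subsetP eD] h.
  have : e != finset.set0 by rewrite -card_gt0 (sH eH).
  by move=> /set0Pn[a ae]; exists a; [exact: eD|exact: h].
have [||||||||||y [/sA[z accz] /sB[w wD accw]]] := @split_see R _ H d sH dH W Hb D E EA EB
  (pos d (hub true)) (pos d (pv i)) EH EAH EBH; last first.
- case: (EAD [set hub z; w]%SET w) => //; last by rewrite !inE eqxx orbT.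
  have wm : (w < m)%N by move: wD; rewrite inE => /andP[].
  rewrite inE; apply/andP; split; last by apply/existsP; exists z; rewrite !inE eqxx.
  by apply: see accz accw; rewrite -(pv_val w); exact: cross_double_fan.
- move=> /(pts_vertex dH EH)[|[e]]; first by rewrite inE iD andbF.
  by rewrite inE => /and3P[_ _ /fintype.subsetP eW] /eW; rewrite inE iD andbF.
- by left; exists (pv i).
- move=> /(pts_vertex dH EH)[|[e]]; first by rewrite inE ltnNge hub_ge.
  by rewrite inE => /and3P[_ _ /fintype.subsetP eW] /eW; rewrite inE ltnNge hub_ge.
- by left; exists (hub true); rewrite // inE hub_ge.
- move=> w vA vB; have wD : w \in D.
    by case: vB => [//|[e]]; rewrite inE => /and3P[_ _ /fintype.subsetP]; exact.
  have wm : (w < m)%N by move: wD; rewrite inE => /andP[].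
  by case: vA => [|[e eA we]]; [rewrite inE leqNgt wm|case: (EAD e w)].
- by move=> e eA; rewrite [e \in EB]inE eA /= andbF.
- move=> e eH; have [eA|eA] := boolP (e \in EA); first by rewrite orbT.
  rewrite [e \in E]inE [e \in EB]inE eH eA /=.
  have hh := noEA e eH eA.
  have [/exists_inP[x xe xD]|] := boolP [exists x in e, x \in D].
    apply/orP; right; apply/fintype.subsetP => y ye; rewrite inE.
    have -> : (y < m)%N by have [//|[z yz]] := vertexP y; have := hh z; rewrite -yz ye.
    by apply/eqP; apply: path_comp ye _ => //; [exact: xe|move: xD; rewrite inE => /andP[_ /eqP]].
  rewrite negb_exists => /forallP hD; apply/orP; left; apply/fintype.subsetP => y ye; rewrite inE.
  have := hD y; rewrite ye /= => ->.
  by have [->//|[z yz]] := vertexP y; have := hh z; rewrite -yz ye.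
- move=> w; have [wm|[z ->]] := vertexP w; last by rewrite [hub z \in Hb]inE hub_ge orbT.
  by rewrite [w \in W]inE wm /=; case: (w \in D); rewrite ?orbT.
- by move=> e; rewrite inE => /and3P[].
- apply: (solvable_paths EH) => e z; rewrite inE => /and3P[eH eA _]; exact: noEA.
Qed.

(** Some point sees both ends of the hub edge and also, after sliding along another edge if
    necessary, a path vertex. *)
Lemma common_nbr : exists w, [/\ (w < m)%N, cross (true, w) & cross (false, w)].
Proof.
have [|y [p [accu Xp pu accp]]] := edge_face sH dH uv_in.
  by exists (pv 0); rewrite path_notin_uv//; lia.
suff [w [wm accw]] : exists w, (w < m)%N /\ visible X (pos d (pv w)) y.
  by exists w; split=> //; apply: see accw; rewrite ?cross_double_fan//; apply: accu; rewrite !inE eqxx ?orbT.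
have path_vertex x : x \notin uv -> (x < m)%N.
  by have [//|[[] ->]] := vertexP x; rewrite !inE eqxx ?orbT.
have [[w pw]|nv] := pselect (exists w, p = pos d w).
  exists w; rewrite pv_val -pw; split=> //; apply: path_vertex; apply/negP => /pu; exact.
case: Xp => [[w _ pw]|[e]]; first by case: nv; exists w.
rewrite !inE => /andP[euv eH] ep.
have [x xe xuv] : exists2 x, x \in e & x \notin uv.
  apply/subsetPn; apply: contra euv => euv.
  by rewrite eqEcard euv (sH eH) /uv cards2 hub_neq.
exists x; rewrite pv_val; split; first exact: path_vertex.
by apply: slide_edge2 accp _ xe => // w pw; apply: nv; exists w.
Qed.

(** By [cover] the vertex is not isolated in [H], and [edge_face] for an edge at it provides the
    point. *)
Lemma vertex_face i : (i < m)%N -> exists y, ~ X y /\ visible X (pos d (pv i)) y.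
Proof.
move=> im; have [e eH ie] : exists2 e, e \in H & pv i \in e.
  have [z [j [jm cj E]]] := cover im.
  have [ij|ij|ij] := ltngtP i j.
  - have := component_eq (ltnW ij) E; move=> /(_ i); rewrite leqnn ij => /(_ isT)/andP[_].
    by exists [set pv i; pv i.+1]%SET => //; rewrite !inE eqxx.
  - have := component_eq (ltnW ij) (esym E); move=> /(_ i.-1); case: i im ij {E} => // i im ij.
    rewrite /= ltnSn andbT -ltnS ij => /(_ isT)/andP[_].
    by exists [set pv i; pv i.+1]%SET => //; rewrite !inE eqxx orbT.
  - by exists [set hub z; pv j]%SET => //; rewrite ij !inE eqxx orbT.
have [|y [p [acc _ _ _]]] := edge_face sH dH eH.
  have [w /= _ we] : exists2 w, w \in [set: 'I_m.+2]%SET & w \notin e; last by exists w.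
  apply/subsetPn; apply/negP => /subset_leq_card; rewrite cardsT card_ord (sH eH); lia.
exists y; split; last exact: acc.
exact: visible_start (acc _ ie).
Qed.

Let nuv_cases e : e \in H -> e != uv ->
  (exists l, [/\ (l.+1 < m)%N, pedge l & e = [set pv l; pv l.+1]%SET]) \/
  (exists z i, [/\ (i < m)%N, cross (z, i) & e = [set hub z; pv i]%SET]).
Proof.
move=> eH; have [->|[z [i [im ee]]]|[l [lm ee]]] := Hcases eH; first by rewrite eqxx.
- by right; exists z, i; rewrite /cross -ee.
- by left; exists l; rewrite /pedge lm -ee.
Qed.

(** By [good], [H] without the hub edge and [e] is a forest, which does not separate a point of [e]
    from a point of the hub edge. A point seeing both edges gives the four cross edges between their
    ends; a point seeing [pv i] and the hub edge gives both cross edges at [i]. *)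
Lemma cut_edge w l : pedge l -> good m (rem_edge pedge l) cross w ->
  (forall i, (i < m)%N -> cross (true, i) && cross (false, i)) \/
  [/\ cross (true, l), cross (false, l), cross (true, l.+1) & cross (false, l.+1)].
Proof.
move=> /andP[lm eH] gd; set e := [set pv l; pv l.+1]%SET in eH.
have uvH := uv_in.
have euv : e != uv.
  apply/eqP => E0; have := path_notin_uv (ltnW lm); rewrite -E0 !inE eqxx //.
pose T := [set f in H | (f != uv) && (f != e)]%SET.
have TH : T \subset H by exact: subH.
have solT : solvable T.
  apply: (@solver m (rem_edge pedge l) cross w) => // f; rewrite inE => /and3P[fH fuv fe].
  have [[k [km pk fk]]|//] := nuv_cases fH fuv; [left|by right].
  exists k; split=> //; rewrite /rem_edge pk /=; apply: contraNneq fe => kl.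
  by rewrite fk kl.
have [p1 [ep1 Tp1]] := inner_point sH dH eH.
have [p2 [up2 Tp2]] := inner_point sH dH uvH.
have eT : e \notin T by rewrite inE eqxx !andbF.
have uvT : uv \notin T by rewrite inE eqxx !andbF.
have [four|not4] := pselect [/\ cross (true, l), cross (false, l), cross (true, l.+1) & cross (false, l.+1)].
  by right.
left=> i im; have [y [Xy accy]] := vertex_face im.
have [||[w' ]|[f [fH fT accf]]] := @hit_see R _ H d sH dH [set: 'I_m.+2]%SET T y p2 TH solT _ _ (Tp2 _ _ TH uvT) Xy.
- by move=> f _; exact: finset.subsetT.
- by right; exists uv.
- by rewrite inE.
have [fuv|fuv] := eqVneq f uv.
  by apply/andP; split; apply: see accy; rewrite ?cross_double_fan//; apply: accf; rewrite fuv !inE eqxx ?orbT.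
exfalso; apply: not4.
have see1 y' : seen H d [set: 'I_m.+2]%SET finset.set0 [set e]%SET y' -> forall x, x \in e -> visible X (pos d x) y'.
  by move=> [[x []]|[f' /set1P ->]]; rewrite ?inE.
have see2 y' : seen H d [set: 'I_m.+2]%SET finset.set0 [set uv]%SET y' -> forall x, x \in uv -> visible X (pos d x) y'.
  by move=> [[x []]|[f' /set1P ->]]; rewrite ?inE.
have [|||||||||y' [/see1 h1 /see2 h2]] := @split_see R _ H d sH dH [set: 'I_m.+2]%SET finset.set0 finset.set0 T
  [set e]%SET [set uv]%SET p1 p2 TH _ _ solT _ _ _ _ _ _ (Tp1 _ _ TH eT) _ (Tp2 _ _ TH uvT).
- by rewrite finset.sub1set.
- by rewrite finset.sub1set.
- by move=> f' _; exact: finset.subsetT.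
- by move=> x; rewrite inE.
- by move=> f' f'H; rewrite !inE f'H; case: (f' == uv); case: (f' == e).
- by move=> f' /set1P ->; rewrite inE.
- by move=> x _ _; rewrite inE.
- by right; exists e; rewrite ?inE.
- by right; exists uv; rewrite ?inE.
have lm' := ltnW lm.
have h1l : visible X (pos d (pv l)) y' by apply: h1; rewrite !inE eqxx.
have h1l' : visible X (pos d (pv l.+1)) y' by apply: h1; rewrite !inE eqxx orbT.
have h2' z : visible X (pos d (hub z)) y' by apply: h2; case: z; rewrite !inE eqxx ?orbT.
by split; apply: see (h2' _) _; rewrite ?cross_double_fan.
Qed.

(** Without its edges at hub [z], [H] is a forest missing that hub. On a path off this forest from a
    point seeing [pv i] to the hub, the first hit is the hub or one of its edges; either way the hub
    is visible. *)
Lemma cut_hub : (forall z, good m pedge (fun c => cross c && (c.1 != z)) m) ->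
  forall i, (i < m)%N -> cross (true, i) && cross (false, i).
Proof.
move=> gd i im; have [y [Xy accy]] := vertex_face im.
suff acch z : visible X (pos d (hub z)) y.
  by apply/andP; split; apply: see (acch _) accy; rewrite cross_double_fan.
pose E := [set e in H | hub z \notin e]%SET.
have EH : E \subset H by exact: subH.
have [|||||[w + acc]|[e [eH]]] := @hit_see R _ H d sH dH (~: [set hub z])%SET E y (pos d (hub z)) EH.
- apply: (@solver m pedge (fun c => cross c && (c.1 != z)) m) => // f; rewrite inE => /andP[fH zf].
  have fuv : f != uv by apply: contraNneq zf => ->; case: (z); rewrite !inE eqxx ?orbT.
  have [|[z' [k [km ck fk]]]] := nuv_cases fH fuv; [by left|right].
  exists z', k; split=> //; rewrite ck /=; apply: contraNneq zf => <-.
  by rewrite fk !inE eqxx.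
- move=> e; rewrite inE => /andP[_ ze]; apply/fintype.subsetP => x xe; rewrite !inE.
  by apply: contraNneq ze => <-.
- by left; exists (hub z); rewrite ?inE.
- by move=> /(pts_vertex dH EH)[|[e]]; rewrite !inE ?eqxx// => /andP[_ /negbTE ->].
- by [].
- by rewrite !inE negbK => /eqP <-.
- by rewrite inE eH /= negbK => ze; apply.
Qed.

Lemma lower_bound : (m + 4 <= #|H|)%N.
Proof.
rewrite leqNgt; apply/negP => Hlt.
have [w1 [w1m c1 c2]] := common_nbr.
apply: (@count_contra m pedge cross w1 m3 w1m cover _ (@cut_edge w1) cut_hub).
- by rewrite c1 c2.
- by move=> l /andP[].
set Q := [set i : 'I_m | _]%SET; set Cr := [set c : bool * 'I_m | _]%SET.
pose f (i : 'I_m) := [set pv i; pv i.+1]%SET.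
pose g (c : bool * 'I_m) := [set hub c.1; pv c.2]%SET.
have lt2 i : (i < m)%N -> (i < m.+2)%N by lia.
have pinj a b : (a < m)%N -> (b < m)%N -> pv a = pv b -> a = b.
  by move=> am bm /(congr1 (@nat_of_ord _)); rewrite !pvE ?lt2.
have Qm i : i \in Q -> (i.+1 < m)%N by rewrite inE => /andP[].
have finj : {in Q &, injective f}.
  move=> i j /Qm im /Qm jm E; apply: ord_inj.
  have : pv i \in f j by rewrite -E !inE eqxx.
  have : pv j \in f i by rewrite E !inE eqxx.
  rewrite !inE => /orP[/eqP/pinj h|/eqP/pinj h]; first by rewrite h.
  by move=> /orP[/eqP/pinj h'|/eqP/pinj h']; [apply: h'|have := h' _ _; have := h _ _; lia].
have ginj : {in Cr &, injective g}.
  move=> [z i] [z' j] _ _ E.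
  have : hub z \in g (z', j) by rewrite -E !inE eqxx.
  have : pv i \in g (z', j) by rewrite -E !inE eqxx orbT.
  rewrite !inE /= eq_sym (negbTE (hub_path _ (ltn_ord i))) (negbTE (hub_path _ (ltn_ord j))) orbF /=.
  move=> /eqP/pinj ij /eqP zz; congr pair; last by apply: ord_inj; apply: ij.
  by case: z z' zz {E} => -[] // /eqP; rewrite 1?[hub false == _]eq_sym (negbTE (hub_neq m)).
(* The three families are disjoint, so their sizes add up to at most that of [H]; the hub edge
   accounts for the step from [m + 2] to [m + 3]. *)
have sub : (uv |: (f @: Q :|: g @: Cr))%SET \subset H.
  apply/fintype.subsetP => e; rewrite !inE => /or3P[/eqP ->|/imsetP[i + ->]|/imsetP[c + ->]].
  - exact: uv_in.
  - by rewrite inE => /andP[].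
  - by rewrite inE.
have /subset_leq_card := sub; rewrite cardsU1 cardsU.
have -> : (f @: Q :&: g @: Cr)%SET = finset.set0.
  apply/finset.setP => e; rewrite !inE; apply/negP => /andP[/imsetP[i /Qm im ->] /imsetP[c _ E]].
  by have := hub_notin_path c.1 im; rewrite -/(f i) E !inE eqxx.
have -> : uv \notin (f @: Q :|: g @: Cr)%SET.
  rewrite !inE; apply/negP => /orP[/imsetP[i /Qm im E]|/imsetP[c _ E]].
    by have := hub_notin_path true im; rewrite -/(f i) -E !inE eqxx.
  by have := path_notin_uv (ltn_ord c.2); rewrite E !inE eqxx orbT.
rewrite cards0 subn0 !card_in_imset// add1n => h.
have ar (a b : nat) : (a < b -> b < m + 4 -> a <= m + 2)%N by lia.
exact: ar h Hlt.
Qed.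

End lower.

(** * Nonplanarity of K5 *)

Section windings.
Variable R : realType.
Local Notation P := (R * R)%type.
Implicit Types (u v p : P) (f g : R -> P) (th : R -> R).

Lemma turn_opp t u v : turn t u v -> turn t (- u) (- v).
Proof. by move=> [r r0 ->]; exists r => //; congr pair; rewrite /=; ring. Qed.

Lemma turn_pi t u v : turn t u v -> turn (t + pi) (- u) v.
Proof.
by move=> [r r0 ->]; exists r => //; rewrite cosDpi sinDpi; congr pair; rewrite /=; ring.
Qed.

(* The total turning angle of f around the origin along [0, 1] is r. *)
Definition variation f (r : R) := exists th u,
  [/\ {within @seg01 R, continuous th}, forall t, 0 <= t <= 1 -> turn (th t) (f t) u &
    r = th 1 - th 0].

Let i0 : 0 <= (0 : R) <= 1. Proof. by rewrite lexx ler01. Qed.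
Let i1 : 0 <= (1 : R) <= 1. Proof. by rewrite lexx ler01. Qed.

(** The difference of two choices is continuous with values in one coset of 2 pi Z; if it changed,
    it would pass through a half turn. *)
Lemma variation_uniq f r r' : (forall t, 0 <= t <= 1 -> f t != 0) ->
  variation f r -> variation f r' -> r = r'.
Proof.
move=> f0 [th [u [cth hth ->]]] [th' [v [cth' hth' ->]]].
pose de t := th (clamp t) - th' (clamp t).
have cde : continuous de.
  have cc (h : R -> R) : {within @seg01 R, continuous h} -> continuous (h \o (@clamp R)).
    move=> ch; apply/continuous_subspace_setT; apply: (within_comp ch (@clamp_cont R)) => t _.
    by rewrite seg01E clamp01.
  by move=> t; apply: continuousB; [exact: (cc _ cth)|exact: (cc _ cth')].
have v0 : v != 0 := turn_neq0 (turnN (hth' 0 i0)) (f0 0 i0).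
have deE t : exists k : int, de t = de 0 + k%:~R * (2 * pi).
  have tt s : turn (de s) v u.
    by rewrite /de addrC; apply: turnD (turnN (hth' _ (clamp01 s))) (hth _ (clamp01 s)).
  exact: turn_uniq v0 (tt t) (tt 0).
suff : de 1 = de 0 by rewrite /de !clamp_id//; lra.
have pi0 := pi_gt0 R; have pin0 : pi != 0 :> R by rewrite gt_eqF.
have no_half t (s : int) : odd `|s| -> de t <> de 0 + s%:~R * pi.
  move=> os E; have [k] := deE t; rewrite E => /addrI; rewrite mulrA => /(mulIf pin0)/eqP.
  by rewrite -[2]/(2%:~R) -intrM eqr_int => /eqP sE; move: os; rewrite sE; lia.
have [k kE] := deE 1; have [k0|k0|k0] := ltgtP k 0; last by rewrite kE k0 mul0r addr0.
- have [|x _ xE] := @segment_IVT R de 0 1 (de 0 - pi) ler01 cde.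
    right; rewrite kE; have : k%:~R <= -1 :> R by rewrite -[-1]/((-1)%:~R) ler_int; lia.
    nra.
  by case: (no_half x (-1)) => //; rewrite xE mulN1r.
- have [|x _ xE] := @segment_IVT R de 0 1 (de 0 + pi) ler01 cde.
    left; rewrite kE; have : 1 <= k%:~R :> R by rewrite -[1]/(1%:~R) ler_int; lia.
    nra.
  by case: (no_half x 1) => //; rewrite xE mul1r.
Qed.

Lemma variation_opp f r : variation f r -> variation (fun t => - f t) r.
Proof.
move=> [th [u [cth hth rE]]]; exists th, (- u); split=> // t t01.
exact/turn_opp/hth.
Qed.

Lemma variation_ex f p : continuous f -> (forall t, 0 <= t <= 1 -> f t != p) ->
  exists r, variation (fun t => f t - p) r.
Proof.
move=> cf fp; have [th cth hth] := lift_arc1 cf fp.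
by exists (th 1 - th 0), th, (1, 0); split=> // t t01; apply: hth; rewrite seg01E.
Qed.

Lemma variation_ends f r a b : variation f r -> turn a (f 0) (1, 0) -> turn b (f 1) (1, 0) ->
  exists k : int, r = b - a + k%:~R * (2 * pi).
Proof.
move=> [th [u [cth hth ->]]] ta tb.
have e10 : (1, 0) != 0 :> P by apply/negP => /eqP[/eqP]; rewrite oner_eq0.
have [k kE] := turn_uniq e10 (turnD (turnN tb) (hth 1 i1)) (turnD (turnN ta) (hth 0 i0)).
by exists k; lra.
Qed.

(** The difference [f s - g t] has a continuous angle on the unit square, which is contracted to a
    corner. The change from that corner to the opposite one is the same along either pair of
    sides. *)
Lemma variation_square f g r1 r2 r3 r4 : continuous f -> continuous g ->
  (forall s t, 0 <= s <= 1 -> 0 <= t <= 1 -> f s != g t) ->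
  variation (fun t => f t - g 0) r1 -> variation (fun t => f t - g 1) r2 ->
  variation (fun t => g t - f 0) r3 -> variation (fun t => g t - f 1) r4 ->
  r1 + r4 = r2 + r3.
Proof.
move=> cf cg fg v1 v2 v3 v4.
pose D : set P := @seg01 R `*` @seg01 R.
have cD : compact D by apply: compact_setX; exact: segment_compact.
have [|z s [/= z1 z2] s01|th cth hth] :=
  @lift_homotopy R P D (fun x => f (x.1.1 * x.2) - g (x.1.2 * x.2)) cD.
- have cc (h : R -> P) (pr : P -> R) : continuous h -> continuous pr ->
      continuous (fun x : P * R => h (pr x.1 * x.2)).
    move=> ch cpr x; apply: (@continuous_comp _ _ _ (fun x : P * R => pr x.1 * x.2) h); last exact: ch.
    apply: continuousM; last exact: cvg_snd.
    by apply: (@continuous_comp _ _ _ fst pr); [exact: cvg_fst|exact: cpr].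
  by move=> x; apply: cont_subP; [exact: cc cf (@fst_cont R) x|exact: cc cg (@snd_cont R) x].
- rewrite subr_eq0; move: z1 z2; rewrite !seg01E => z1 z2; apply: fg; nra.
have side (c : R -> P) (h : R -> P) : continuous c -> (forall t, 0 <= t <= 1 -> D (c t)) ->
    (forall t, 0 <= t <= 1 -> h t = f (c t).1 - g (c t).2) -> variation h (th (c 1) - th (c 0)).
  move=> cc Dc hE; exists (th \o c), (f 0 - g 0); split=> //.
    by apply: (within_comp cth cc) => t; rewrite seg01E; exact: Dc.
  move=> t t01; have := hth (c t) (Dc t t01).
  by rewrite /= !mulr1 !mulr0 -hE.
have D01 x y : 0 <= x <= 1 -> 0 <= y <= 1 -> D (x, y) by move=> x01 y01; split; rewrite seg01E.
have e1 : r1 = th (1, 0) - th (0, 0).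
  apply: (variation_uniq _ v1); first by move=> t t01; rewrite subr_eq0 fg.
  apply: (side (fun t => (t, 0))) => [t|t t01|//]; last exact: D01.
  by apply: cont_pair; [exact: cvg_id|exact: cvg_cst].
have e2 : r2 = th (1, 1) - th (0, 1).
  apply: (variation_uniq _ v2); first by move=> t t01; rewrite subr_eq0 fg.
  apply: (side (fun t => (t, 1))) => [t|t t01|//]; last exact: D01.
  by apply: cont_pair; [exact: cvg_id|exact: cvg_cst].
have e3 : r3 = th (0, 1) - th (0, 0).
  apply: (variation_uniq _ (variation_opp v3)).
    by move=> t t01; rewrite opprB subr_eq0 fg.
  apply: (side (fun t => (0, t))) => [t|t t01|t t01]; [|exact: D01|by rewrite opprB].
  by apply: cont_pair; [exact: cvg_cst|exact: cvg_id].
have e4 : r4 = th (1, 1) - th (1, 0).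
  apply: (variation_uniq _ (variation_opp v4)).
    by move=> t t01; rewrite opprB subr_eq0 fg.
  apply: (side (fun t => (1, t))) => [t|t t01|t t01]; [|exact: D01|by rewrite opprB].
  by apply: cont_pair; [exact: cvg_cst|exact: cvg_id].
by rewrite e1 e2 e3 e4; ring.
Qed.

(* Up to full turns, the variation of f a b - v x is the angle of v b - v x minus
   that of v a - v x. Modulo 2 the resulting integers cancel when
   [variation_square] is summed over the fifteen pairs of disjoint edges, whereas
   the half turns relating opposite directions add up to an odd number. *)
Lemma K5_not_plane (v : nat -> P) (f : nat -> nat -> R -> P) :
  (forall a b, (a < b < 5)%N -> [/\ continuous (f a b), f a b 0 = v a & f a b 1 = v b]) ->
  (forall a b c d, (a < b < 5)%N -> (c < d < 5)%N -> [&& a != c, a != d, b != c & b != d] ->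
    forall s t, 0 <= s <= 1 -> 0 <= t <= 1 -> f a b s != f c d t) ->
  False.
Proof.
move=> fP disj.
have vf x a b t : (x < 5)%N -> (a < b < 5)%N -> x != a -> x != b -> 0 <= t <= 1 -> f a b t != v x.
  move=> x5 ab xa xb t01.
  have [y [y5 yx ya yb]] : exists y, [/\ (y < 5)%N, y != x, y != a & y != b].
    have /allPn[y] : ~~ all (mem [:: x; a; b]) (iota 0 5).
      by apply/negP => /allP/(uniq_leq_size (iota_uniq 0 5)).
    by rewrite mem_iota !inE !negb_or /= add0n => y5 /and3P[yx ya yb]; exists y.
  have [xy|yx'] := ltnP x y.
    have xy5 : (x < y < 5)%N by rewrite xy.
    have [_ <- _] := fP _ _ xy5; apply: disj => //; rewrite ?lexx ?ler01 ?ab//; lia.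
  have yx5 : (y < x < 5)%N by lia.
  have [_ _ <-] := fP _ _ yx5; apply: disj => //; rewrite ?lexx ?ler01 ?ab//; lia.
have vinj x y : (x < 5)%N -> (y < 5)%N -> x != y -> v y - v x != 0.
  move=> x5 y5 xy; rewrite subr_eq0.
  have [z [z5 zx zy]] : exists z, [/\ (z < 5)%N, z != x & z != y].
    have /allPn[z] : ~~ all (mem [:: x; y]) (iota 0 5).
      by apply/negP => /allP/(uniq_leq_size (iota_uniq 0 5)).
    by rewrite mem_iota !inE !negb_or /= add0n => z5 /andP[zx zy]; exists z.
  have [yz|zy'] := ltnP y z.
    have yz5 : (y < z < 5)%N by rewrite yz.
    by have [_ <- _] := fP _ _ yz5; apply: vf; rewrite // eq_sym.
  have zy5 : (z < y < 5)%N by lia.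
  by have [_ _ <-] := fP _ _ zy5; apply: vf; rewrite // eq_sym.
have /choice[A AP] : forall xy : nat * nat, exists t, (xy.1 < xy.2 < 5)%N ->
    turn t (v xy.2 - v xy.1) (1, 0).
  move=> [x y] /=; have [xy|] := boolP (x < y < 5)%N; last by exists 0.
  have [|t ht] := @turn_e1 R (v y - v x); last by exists t.
  by apply: vinj; lia.
(* Opposite directions are tied together: for [y < x] the angle is that of the reversed pair plus a
   half turn. *)
pose al x y := A (minn x y, maxn x y) + (y < x)%N%:R * pi.
have alP x y : (x < 5)%N -> (y < 5)%N -> x != y -> turn (al x y) (v y - v x) (1, 0).
  move=> x5 y5; rewrite /al neq_ltn => /orP[xy|yx].
    rewrite (minn_idPl (ltnW xy)) (maxn_idPr (ltnW xy)) ltnNge (ltnW xy) mul0r addr0.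
    by apply: (AP (x, y)); rewrite /= xy.
  rewrite (minn_idPr (ltnW yx)) (maxn_idPl (ltnW yx)) yx mul1r -[v y - v x]opprB.
  by apply/turn_pi/(AP (y, x)); rewrite /= yx.
have /choice[D DP] : forall xab : nat * nat * nat, exists rn : R * int,
    let: (x, a, b) := xab in (x < 5)%N -> (a < b < 5)%N -> x != a -> x != b ->
    variation (fun t => f a b t - v x) rn.1 /\
    rn.1 = al x b - al x a + rn.2%:~R * (2 * pi).
  move=> [[x a] b]; have [/and4P[x5 ab xa xb]|no] :=
    boolP [&& (x < 5)%N, (a < b < 5)%N, x != a & x != b]; last first.
    by exists (0, 0) => x5 ab xa xb; move: no; rewrite x5 ab xa xb.
  have [cf f0 f1] := fP a b ab.
  have [|r hr] := variation_ex cf (p := v x); first by move=> t; exact: vf.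
  have [||k kE] := @variation_ends _ _ (al x a) (al x b) hr.
  - by rewrite f0; apply: alP => //; lia.
  - by rewrite f1; apply: alP => //; lia.
  by exists (r, k).
pose n x a b := (D (x, a, b)).2.
pose s x y : int := (y < x)%N%:Z.
(* The angles [A] cancel among the four variations; division by [pi] leaves the half turns [s] and
   the integers [n]. *)
have E a b c e : (a < b < 5)%N -> (c < e < 5)%N -> [&& a != c, a != e, b != c & b != e] ->
  s c b - s b c - s c a + s a c + s b e - s e b + s e a - s a e =
  2 * (n e a b + n a c e - n c a b - n b c e).
  move=> ab ce ne; have /and4P[ac ae bc be] := ne.
  have [cf f0 f1] := fP a b ab; have [cg g0 g1] := fP c e ce.
  have [|||| V1 E1] := DP (c, a, b); rewrite // 1?eq_sym//; first by lia.
  have [|||| V2 E2] := DP (e, a, b); rewrite // 1?eq_sym//; first by lia.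
  have [|||| V3 E3] := DP (a, c, e) => //; first by lia.
  have [|||| V4 E4] := DP (b, c, e) => //; first by lia.
  rewrite -g0 in V1; rewrite -g1 in V2; rewrite -f0 in V3; rewrite -f1 in V4.
  have := variation_square cf cg (disj a b c e ab ce ne) V1 V2 V3 V4.
  rewrite E1 E2 E3 E4 -/(n c a b) -/(n e a b) -/(n a c e) -/(n b c e) /al.
  rewrite (minnC c b) (maxnC c b) (minnC c a) (maxnC c a) (minnC e b) (maxnC e b) (minnC e a) (maxnC e a).
  move=> EQ; apply/eqP; rewrite -(eqr_int R) !rmorphD !rmorphN !rmorphM /= !rmorphD !rmorphN /= /s.
  rewrite -!pmulrn; have pin0 : pi != 0 :> R by rewrite gt_eqF// pi_gt0.
  apply/eqP; apply: (mulIf pin0).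
  move: EQ; lra.
have := E 0 1 2 3 isT isT isT; have := E 0 2 1 3 isT isT isT; have := E 0 3 1 2 isT isT isT.
have := E 0 1 2 4 isT isT isT; have := E 0 2 1 4 isT isT isT; have := E 0 4 1 2 isT isT isT.
have := E 0 1 3 4 isT isT isT; have := E 0 3 1 4 isT isT isT; have := E 0 4 1 3 isT isT isT.
have := E 0 2 3 4 isT isT isT; have := E 0 3 2 4 isT isT isT; have := E 0 4 2 3 isT isT isT.
have := E 1 2 3 4 isT isT isT; have := E 1 3 2 4 isT isT isT; have := E 1 4 2 3 isT isT isT.
rewrite /s /=; lia.
Qed.

End windings.

(** * Subdivisions of K5 in a drawing *)

Section K5.
Variables (R : realType) (V : finType) (E : {set {set V}}) (d : drawing R V).
Hypotheses (sE : simple_graph E) (dE : plane_drawing E d).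
Local Notation P := (R * R)%type.

Definition joined (Q : {set V} -> Prop) (a b : V) := exists f : R -> P,
  [/\ continuous f, f 0 = pos d a, f 1 = pos d b &
    forall t, 0 <= t <= 1 -> exists e, [/\ e \in E, Q e & curve d e (f t)]].

Lemma joined_edge (Q : {set V} -> Prop) a b : [set a; b]%SET \in E -> Q [set a; b]%SET ->
  joined Q a b.
Proof.
move=> eE Qe; have [_ dc _ _] := dE; have /simple_curveP[g [ag g0 g1 gE]] := dc a b eE.
exists g; split=> //; first exact: ag.1.
by move=> t t01; exists [set a; b]%SET; split=> //; rewrite gE; exists t; rewrite ?seg01E.
Qed.

Lemma joined_trans (Q : {set V} -> Prop) a b c : joined Q a b -> joined Q b c -> joined Q a c.
Proof.
move=> [f [cf f0 f1 fQ]] [g [cg g0 g1 gQ]].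
have [|k [ck k1 k2]] := path_cat cf cg; first by rewrite f1 g0.
exists k; split=> //.
- by rewrite k1 ?mulr0 ?clamp0.
- by rewrite k2 ?mulr1 ?clamp1//; lra.
- move=> t _; have [t2|t2] := leP t 2^-1; first by rewrite k1//; apply/fQ/clamp01.
  by rewrite k2 ?ltW//; apply/gQ/clamp01.
Qed.

(** The colouring replaces bookkeeping of paths: edges used between branch vertices [a] and [b]
    carry only these two colours, so disjoint pairs are joined through edges without a common
    vertex, which do not meet in the drawing. *)
Lemma K5_subdivision (br : nat -> V) (col : V -> nat) :
  (forall a b, (a < b < 5)%N ->
    joined (fun e => forall x, x \in e -> (col x == a) || (col x == b)) (br a) (br b)) ->
  False.
Proof.
move=> H; have /choice[f fP] : forall ab : nat * nat, exists f : R -> P, (ab.1 < ab.2 < 5)%N ->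
    [/\ continuous f, f 0 = pos d (br ab.1), f 1 = pos d (br ab.2) &
    forall t, 0 <= t <= 1 -> exists e, [/\ e \in E, forall x, x \in e ->
      (col x == ab.1) || (col x == ab.2) & curve d e (f t)]].
  move=> [a b] /=; have [ab|_] := boolP (a < b < 5)%N; last by exists (fun=> 0).
  by have [f hf] := H a b ab; exists f.
apply: (@K5_not_plane R (fun a => pos d (br a)) (fun a b => f (a, b))).
  by move=> a b ab; have [] := fP (a, b) ab.
move=> a b c e ab ce /and4P[ac ae bc be] s t s01 t01; apply/eqP => fst.
have [_ _ _ /(_ s s01)[x [xE xcol xs]]] := fP (a, b) ab.
have [_ _ _ /(_ t t01)[y [yE ycol yt]]] := fP (c, e) ce.
have no w : w \in x -> w \in y -> False.
  by move=> /xcol /= wx /ycol /= wy; lia.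
have [_ _ _ d4] := dE; have [xy|xy] := eqVneq x y.
  have : x != finset.set0 by rewrite -card_gt0 (sE xE).
  by move=> /set0Pn[w wx]; apply: (no w wx); rewrite -xy.
rewrite -fst in yt; have [w /= ] := d4 _ _ xE yE xy _ (conj xs yt).
by rewrite inE => /andP[wx wy] _; exact: no wx wy.
Qed.

End K5.

(** * Maximal planarity *)

Section double_fan_planar.
Variables (R : realType) (m : nat).
Local Notation P := (R * R)%type.
Local Notation pv := (pv m).
Local Notation hub := (hub m).
Local Notation uv := (uv m).

Lemma double_fan_saturated (e : {set 'I_m.+2}) : e \notin double_fan m -> ~ planar R (e |: double_fan m)%SET.
Proof.
move=> eF [sE [d dE]].
have eE : e \in (e |: double_fan m)%SET by rewrite !inE eqxx.
have FE f : f \in double_fan m -> f \in (e |: double_fan m)%SET by move=> fF; rewrite inE fF orbT.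
have [x [y [xy e_xy]]] : exists x y : 'I_m.+2, (x < y)%N /\ e = [set x; y]%SET.
  have /eqP/cards2P[x [y [xy ->]]] := sE e eE.
  have [h|h|/ord_inj h] := ltngtP x y; last by rewrite h eqxx in xy.
    by exists x, y.
  by exists y, x; rewrite finset.setUC.
have [ym xy1] : (y < m)%N /\ (x.+1 < y)%N.
  by split; rewrite ltnNge; apply: contra eF => h; apply/double_fanP; exists x, y; split=> //;
    rewrite ?h ?orbT// eqn_leq h xy.
have xm : (x < m)%N by lia.
(* Branch vertices are the hubs, the ends of the new edge [e] and the successor of [x]; only the
   connection from that successor to [y] may have more than one edge. *)
pose br (k : nat) : 'I_m.+2 := nth x [:: hub true; hub false; x; pv x.+1; y] k.
(* Path vertices strictly between [x] and [y] share the colour 3 of [pv x.+1]; 5 marks those outside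
   the range from [x] to [y]. *)
pose col (z : 'I_m.+2) : nat := if (z < m)%N then
  if z == y then 4 else if z == x then 2 else if (x < z < y)%N then 3 else 5
  else if z == hub true then 0 else 1.
have colh z : col (hub z) = if z then 0 else 1.
  rewrite /col ltnNge hub_ge; case: z => /=; first by rewrite eqxx.
  by rewrite eq_sym (negbTE (hub_neq m)).
have colx : col x = 2 by rewrite /col xm eqxx -val_eqE /= ltn_eqF.
have coly : col y = 4 by rewrite /col ym eqxx.
have colp k : (x < k <= y)%N -> col (pv k) = if k == y then 4 else 3.
  move=> /andP[xk ky]; have km : (k < m)%N by lia.
  have km2 : (k < m.+2)%N by lia.
  rewrite /col -!val_eqE /= !pvE// km; case: eqP => // kny.
  have -> : (k == x) = false by lia.
  by have -> : (x < k < y)%N by lia.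
apply: (@K5_subdivision R _ _ d sE dE br col) => a b ab.
have edge p q (k l : nat) : [set p; q]%SET \in (e |: double_fan m)%SET -> col p = k -> col q = l ->
    joined (e |: double_fan m)%SET d (fun e => forall x, x \in e -> (col x == k) || (col x == l)) p q.
  move=> pqE pk ql; apply: (joined_edge dE) => // w; rewrite !inE => /orP[]/eqP ->.
    by rewrite pk eqxx.
  by rewrite ql eqxx orbT.
have vcross z (p : 'I_m.+2) : (p < m)%N -> [set hub z; p]%SET \in (e |: double_fan m)%SET.
  by move=> pm; rewrite -(pv_val p); apply/FE/cross_double_fan.
have x1m : (pv x.+1 < m)%N by rewrite pvE; lia.
have colx1 : col (pv x.+1) = 3 by rewrite colp; [rewrite ltn_eqF|lia].
have path : joined (e |: double_fan m)%SET d (fun e => forall x, x \in e -> (col x == 3) || (col x == 4)) (pv x.+1) y.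
  have step k : (x < k < y)%N ->
      joined (e |: double_fan m)%SET d (fun e => forall x, x \in e -> (col x == 3) || (col x == 4)) (pv k) (pv k.+1).
    move=> /andP[xk ky]; apply: (joined_edge dE); first by apply: FE; apply: path_double_fan; lia.
    by move=> w; rewrite !inE => /orP[]/eqP ->; (rewrite colp; last lia); case: ifP.
  have main k : (x.+1 < k <= y)%N ->
      joined (e |: double_fan m)%SET d (fun e => forall x, x \in e -> (col x == 3) || (col x == 4)) (pv x.+1) (pv k).
    elim: k => [|k IH]; first by rewrite ltn0.
    move=> /andP[xk ky]; have [xk'|kx] := ltnP x.+1 k.
      by apply: joined_trans (IH _) (step k _); lia.
    have <- : x.+1 = k by lia.
    by apply: step; lia.
  by have := main y; rewrite pv_val; apply; rewrite xy1 leqnn.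
case: a b ab => [|[|[|[|a]]]] [|[|[|[|[|b]]]]] //; rewrite ?andbF// => _.
- by apply: edge; rewrite ?colh//; apply/FE/uv_double_fan.
- by apply: edge; rewrite ?colh//; exact: vcross.
- by apply: edge; rewrite ?colh//; exact: vcross.
- by apply: edge; rewrite ?colh//; exact: vcross.
- by apply: edge; rewrite ?colh//; exact: vcross.
- by apply: edge; rewrite ?colh//; exact: vcross.
- by apply: edge; rewrite ?colh//; exact: vcross.
- rewrite /br /=; apply: edge => //; apply: FE; have := @path_double_fan m x; rewrite pv_val; apply; lia.
- by apply: edge; rewrite // /br /= -e_xy.
Qed.

(* The path runs up the line x = 0 from height 1, the hubs are (-1, 0) and (1, 0). *)
Definition double_fan_pos (x : 'I_m.+2) : P :=
  if (x < m)%N then (0, x%:R + 1) else if x == hub true then (-1, 0) else (1, 0).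

(** Straight segments, with both orders of the ends allowed because a curve is attached to an edge
    as a set. *)
Definition double_fan_curve (e : {set 'I_m.+2}) : set P :=
  [set z | exists a b (t : R), [/\ e = [set a; b]%SET, 0 <= t <= 1 &
    z = double_fan_pos a + t *: (double_fan_pos b - double_fan_pos a)]].

Lemma double_fan_pos_hub z : double_fan_pos (hub z) = (if z then -1 else 1, 0).
Proof.
rewrite /double_fan_pos ltnNge hub_ge /=; case: z; first by rewrite eqxx.
by rewrite eq_sym (negbTE (hub_neq m)).
Qed.

Lemma double_fan_pos_path i : (i < m)%N -> double_fan_pos (pv i) = (0, i%:R + 1).
Proof. by move=> im; rewrite /double_fan_pos pvE ?im//; lia. Qed.

Lemma double_fan_curveE a b : double_fan_curve [set a; b]%SET =
  (fun t => double_fan_pos a + t *: (double_fan_pos b - double_fan_pos a)) @` (@seg01 R).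
Proof.
apply/seteqP; split=> z; last first.
  by move=> [t]; rewrite seg01E => t01 <-; exists a, b, t.
move=> [a' [b' [t [E t01 ->]]]].
have : a' \in [set a; b]%SET by rewrite E !inE eqxx.
have : b' \in [set a; b]%SET by rewrite E !inE eqxx orbT.
have : a \in [set a'; b']%SET by rewrite -E !inE eqxx.
have : b \in [set a'; b']%SET by rewrite -E !inE eqxx orbT.
have [ab|nab] := eqVneq a b.
  rewrite ab !inE !orbb => _ _ /eqP -> /eqP ->; exists t; rewrite ?seg01E//.
rewrite !inE => h1 h2 h3 h4.
have [[-> ->]|[-> ->]] : (a' = a /\ b' = b) \/ (a' = b /\ b' = a).
  case/orP: h4 => /eqP ha; case/orP: h3 => /eqP hb; [|by left|by right|].
  - by exfalso; move: h1; rewrite ha hb orbb eq_sym (negbTE nab).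
  - by exfalso; move: h2; rewrite ha hb orbb (negbTE nab).
  by exists t; rewrite ?seg01E.
exists (1 - t); first by rewrite seg01E; lra.
by rewrite -[double_fan_pos a - double_fan_pos b]opprB scalerN scalerBl scale1r addrA [double_fan_pos a + _]addrC subrK.
Qed.

Let scaleRE (x y : R) : x *: (y : R^o) = x * y. Proof. by []. Qed.

Lemma double_fan_curve_uv z : double_fan_curve uv z -> z.2 = 0.
Proof.
by rewrite /uv double_fan_curveE !double_fan_pos_hub => -[t _ <-] /=; rewrite scaleRE; ring.
Qed.

(** [s] is the horizontal distance from the line carrying the path; edges at different hubs lie on
    different sides of it and can meet only at [s = 0]. *)
Lemma double_fan_curve_cross (h : bool) i z : (i < m)%N -> double_fan_curve [set hub h; pv i]%SET z ->
  exists s, [/\ 0 <= s <= 1, z.1 = (if h then - s else s) & z.2 = (1 - s) * (i%:R + 1)].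
Proof.
move=> im; rewrite double_fan_curveE double_fan_pos_hub double_fan_pos_path// => -[t]; rewrite seg01E => t01 <-.
by exists (1 - t); split; [lra|case: h|]; rewrite /= ?scaleRE; ring.
Qed.

Lemma double_fan_curve_path l z : (l.+1 < m)%N -> double_fan_curve [set pv l; pv l.+1]%SET z ->
  z.1 = 0 /\ l%:R + 1 <= z.2 <= l%:R + 2.
Proof.
move=> lm; rewrite double_fan_curveE !double_fan_pos_path ?(ltnW lm)// => -[t]; rewrite seg01E => t01 <- /=.
by rewrite !scaleRE -natr1; split; [ring|lra].
Qed.

Lemma double_fan_planar : planar R (double_fan m).
Proof.
split; first exact: simple_double_fan.
have nat_inj (i j : nat) : i%:R + 1 = j%:R + 1 :> R -> i = j.
  by move=> /addIr/eqP; rewrite eqr_nat => /eqP.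
have nat_near (i l : nat) : (l%:R + 1 : R) <= (i%:R + 1 : R) <= l%:R + 2 -> i = l \/ i = l.+1.
  move=> h; have : (l <= i <= l.+1)%N by rewrite -!(ler_nat R) -natr1; lra.
  by lia.
have pathE (x : 'I_m.+2) : (x < m)%N -> double_fan_pos x = (0, x%:R + 1).
  by move=> xm; rewrite -{1}(pv_val x) double_fan_pos_path.
have inj : injective double_fan_pos.
  move=> x y; have [xm|[h ->]] := vertexP x; have [ym|[h' ->]] := vertexP y.
  - by rewrite !pathE// => -[/nat_inj/ord_inj].
  - by rewrite pathE// double_fan_pos_hub => -[E _]; exfalso; case: h' E; lra.
  - by rewrite [double_fan_pos y]pathE// double_fan_pos_hub => -[E _]; exfalso; case: h E; lra.
  - by rewrite !double_fan_pos_hub; case: h; case: h' => // -[E]; exfalso; lra.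
exists (Drawing double_fan_pos double_fan_curve); split=> //=.
- move=> a b abF; have ab : double_fan_pos a != double_fan_pos b.
    apply: contra_eq_neq (simple_double_fan abF) => /inj ->; by rewrite cards2 eqxx.
  have := arc_simple_curve (arc_segment ab).
  by rewrite -double_fan_curveE scale0r addr0 scale1r addrC subrK.
- move=> e w /double_fan_cases[->|[h [i [im ->]]]|[l [lm ->]]]; have [wm|[h' ->]] := vertexP w.
  + by move=> /double_fan_curve_uv; rewrite pathE//=; have := ler0n R w; lra.
  + by case: h'; rewrite !inE eqxx ?orbT.
  + move=> /(double_fan_curve_cross im)[s [s01]]; rewrite pathE//= => sE.
    have -> : s = 0 by case: h sE; lra.
    by rewrite subr0 mul1r => /nat_inj <-; rewrite pv_val !inE eqxx orbT.
  + move=> /(double_fan_curve_cross im)[s [s01]]; rewrite double_fan_pos_hub /=.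
    by case: h; case: h' => //= ; rewrite ?inE ?eqxx //; lra.
  + by move=> /(double_fan_curve_path lm)[_]; rewrite pathE//= => /nat_near[] <-; rewrite pv_val !inE eqxx ?orbT.
  + by move=> /(double_fan_curve_path lm)[]; rewrite double_fan_pos_hub; case: h' => /=; lra.
pose meet (e f : {set 'I_m.+2}) z := [set double_fan_pos w | w in [set` e :&: f]] z.
have meetC (e f : {set 'I_m.+2}) z : meet e f z -> meet f e z by rewrite /meet finset.setIC.
have meetI (e f : {set 'I_m.+2}) w z : w \in e -> w \in f -> double_fan_pos w = z -> meet e f z.
  by move=> we wf <-; exists w; rewrite //= inE we.
have uc h i z : (i < m)%N -> double_fan_curve uv z -> double_fan_curve [set hub h; pv i]%SET z ->
    meet uv [set hub h; pv i]%SET z.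
  move=> im /double_fan_curve_uv z2 /(double_fan_curve_cross im)[s [s01 z1]]; rewrite z2 => /esym/eqP.
  rewrite mulf_eq0 => /orP[/eqP s1|/eqP]; last by have := ler0n R i; lra.
  apply: (meetI _ _ (hub h)); rewrite ?inE ?eqxx//; first by case: (h); rewrite eqxx ?orbT.
  rewrite double_fan_pos_hub [z]surjective_pairing z2 z1; have -> : s = 1 by lra.
  by case: (h).
have up l z : (l.+1 < m)%N -> double_fan_curve uv z -> double_fan_curve [set pv l; pv l.+1]%SET z -> False.
  move=> lm /double_fan_curve_uv z2 /(double_fan_curve_path lm)[_]; rewrite z2; have := ler0n R l; lra.
have cc h i h' j z : (i < m)%N -> (j < m)%N -> [set hub h; pv i]%SET != [set hub h'; pv j]%SET ->
    double_fan_curve [set hub h; pv i]%SET z -> double_fan_curve [set hub h'; pv j]%SET z ->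
    meet [set hub h; pv i]%SET [set hub h'; pv j]%SET z.
  move=> im jm ne /(double_fan_curve_cross im)[s [s01 s1 s2]] /(double_fan_curve_cross jm)[t [t01 t1 t2]].
  have [hh|hh] := eqVneq h h'.
    have st : t = s by move: s1 t1; rewrite hh; case: (h') => -> //; lra.
    have [E|s0] := eqVneq s 1.
      apply: (meetI _ _ (hub h)); rewrite ?inE ?hh ?eqxx//.
      rewrite double_fan_pos_hub [z]surjective_pairing s1 s2 E hh; case: (h'); congr pair; ring.
    have ij : i = j.
      apply: nat_inj; have s10 : 1 - s != 0 by rewrite subr_eq0 eq_sym.
      by apply: (mulfI s10); rewrite -s2 t2 st.
    by rewrite hh ij eqxx in ne.
  have [s0 t0] : s = 0 /\ t = 0 by move: hh s1 t1; case: (h); case: (h') => // _ -> ; lra.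
  have ij : i = j by apply: nat_inj; move: s2 t2; rewrite s0 t0 subr0 !mul1r => ->.
  apply: (meetI _ _ (pv i)); rewrite ?inE -?ij ?eqxx ?orbT//.
  rewrite double_fan_pos_path// [z]surjective_pairing s1 s2 s0 subr0 mul1r.
  by case: (h); rewrite ?oppr0.
have cp h i l z : (i < m)%N -> (l.+1 < m)%N -> double_fan_curve [set hub h; pv i]%SET z ->
    double_fan_curve [set pv l; pv l.+1]%SET z -> meet [set hub h; pv i]%SET [set pv l; pv l.+1]%SET z.
  move=> im lm /(double_fan_curve_cross im)[s [s01 s1 s2]] /(double_fan_curve_path lm)[z1 z2].
  have s0 : s = 0 by move: s1; rewrite z1; case: (h); lra.
  rewrite s0 subr0 mul1r in s2; rewrite s2 in z2.
  apply: (meetI _ _ (pv i)); rewrite ?inE ?eqxx ?orbT//.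
    by case: (nat_near _ _ z2) => ->; rewrite eqxx ?orbT.
  by rewrite double_fan_pos_path// [z]surjective_pairing z1 s2.
have pp k l z : (k < l)%N -> (l.+1 < m)%N -> double_fan_curve [set pv k; pv k.+1]%SET z ->
    double_fan_curve [set pv l; pv l.+1]%SET z -> meet [set pv k; pv k.+1]%SET [set pv l; pv l.+1]%SET z.
  move=> kl lm /double_fan_curve_path[|z1 zk]; first by lia.
  move=> /(double_fan_curve_path lm)[_ zl].
  have lk : l%:R <= k%:R + 1 :> R by lra.
  have lE : l = k.+1 by move: lk; rewrite natr1 ler_nat; lia.
  apply: (meetI _ _ (pv l)); rewrite ?inE ?lE ?eqxx ?orbT//.
  rewrite double_fan_pos_path -?lE; last by lia.
  rewrite [z]surjective_pairing z1; congr pair; move: zk zl; rewrite lE -natr1; lra.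
move=> e f eF fF ef z [ez fz]; rewrite -/(meet e f z).
case: (double_fan_cases eF) ez ef => [->|[h [i [im ->]]]|[k [km ->]]] ez;
  case: (double_fan_cases fF) fz => [->|[h' [j [jm ->]]]|[l [lm ->]]] fz ef.
- by rewrite eqxx in ef.
- exact: uc.
- by case: (up l z).
- exact/meetC/uc.
- exact: cc.
- exact: cp.
- by case: (up k z).
- exact/meetC/cp.
- have [kl|lk|kl] := ltngtP k l; [exact: pp|exact/meetC/pp|].
  by rewrite kl eqxx in ef.
Qed.

End double_fan_planar.

(** The ratio falls as the number of edges grows, so an upper bound is wanted: one hub edge, 2m
    cross edges and m - 1 path edges. *)
Lemma card_double_fan m : (0 < m)%N -> (0 < #|double_fan m| <= 3 * m)%N.
Proof.
move=> m0; apply/andP; split; first by rewrite (cardD1 (uv m)) uv_double_fan.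
pose g (c : bool * 'I_m) := [set hub m c.1; pv m c.2]%SET.
pose f (i : 'I_m.-1) := [set pv m i; pv m i.+1]%SET.
have sub : double_fan m \subset (uv m |: (g @: [set: _] :|: f @: [set: _]))%SET.
  apply/fintype.subsetP => e /double_fan_cases[->|[h [i [im ->]]]|[l [lm ->]]]; rewrite !inE ?eqxx//.
    by rewrite (imset_f g (x := (h, Ordinal im))) ?inE ?orbT.
  have lm' : (l < m.-1)%N by lia.
  by rewrite (imset_f f (x := Ordinal lm')) ?inE ?orbT.
have /leq_trans := subset_leq_card sub; apply.
rewrite cardsU1; apply: leq_trans (leq_add (leq_b1 _) (leq_card_setU _ _).1) _.
have ar (a b : nat) : (a <= 2 * m -> b <= m.-1 -> 1 + (a + b) <= 3 * m)%N by lia.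
by apply: ar; apply: leq_trans (leq_imset_card _ _) _;
  rewrite cardsT ?card_prod ?card_bool card_ord.
Qed.

Theorem theorem1 (R : realType) (n : nat) (hn : (5 <= n)%N) :
  exists G : {set {set 'I_n}},
    maximal_planar R G /\
    (n%:R + 2) / (3 * n%:R - 6) <= lpsr R G.
Proof.
case: n hn => [|[|m]] // m3; exists (double_fan m); split.
  by split; [exact: double_fan_planar|exact: double_fan_saturated].
have [H [d [GHd ->]]] := lpsr_attained R (double_fan m).
have Hm : (m + 4 <= #|H|)%N by apply: (lower_bound _ GHd).
have /andP[G0 Gm] : (0 < #|double_fan m| <= 3 * m)%N by apply: card_double_fan; lia.
have mR : m.+2%:R = m%:R + 2 :> R by rewrite -addn2 natrD.
rewrite mR; have -> : 3 * (m%:R + 2) - 6 = (3 * m)%:R :> R by rewrite natrM; ring.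
have -> : m%:R + 2 + 2 = (m + 4)%:R :> R by rewrite natrD; ring.
apply: ler_pM; rewrite ?invr_ge0 ?ler0n ?ler_nat//.
by rewrite lef_pV2 ?posrE ?ltr0n ?ler_nat//; lia.
Qed.
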